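(* Let $\mathcal{G}=(\mathcal{P},\mathcal{L})$ and $S^*$ be as in the context, and let $\mathcal{Q}^*$ be the set of all quads of $\mathcal{G}$ (each of which is isomorphic to the generalized quadrangle $W(2)$). (1) The point-line geometry with point set $S^*$, line set $\mathcal{Q}^*$ and incidence given by containment is isomorphic to the dual split Cayley hexagon $\mathrm{H}(4)^D$. (2) Let $S\subseteq S^*$ and $\mathcal{Q}\subseteq\mathcal{Q}^*$ be such that $(S,\mathcal{Q})$ is a full subgeometry of $(S^*,\mathcal{Q}^* )$ which is a generalized hexagon of order $(4,1)$. Let $\mathcal{P}'$ be the set of points of $\mathcal{G}$ lying on a line of $S$ and $\mathcal{L}'$ the set of lines of $\mathcal{G}$ contained in a quad of $\mathcal{Q}$. Then $\mathcal{G}'=(\mathcal{P}',\mathcal{L}')$ is a full subgeometry of $\mathcal{G}$ that is a near octagon of order $(2,4)$.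
   Context: Let $G=\mathrm{G}_2(4){:}2$, let $\mathcal{P}$ be its conjugacy class of $4095$ central involutions (involutions whose centralizer contains a Sylow $2$-subgroup), and let $\mathcal{L}$ be the set of triples $\{x,y,xy\}$ with $x,y\in\mathcal{P}$ distinct, commuting, and $[G:N_G(\langle x,y\rangle)]\in\{1365,13650\}$; $\mathcal{G}=(\mathcal{P},\mathcal{L})$ is a near octagon of order $(2,10)$ (a near $2d$-gon is a partial linear space whose collinearity graph is connected of diameter $d$ and in which each point $x$ has a unique nearest point on each line; order $(s,t)$ means $s+1$ points per line and $t+1$ lines per point). $S^*$ is the set of lines $\{x,y,xy\}$ with $[G:N_G(\langle x,y\rangle)]=1365$. A quad of a near polygon is a convex set of points (containing every point on every shortest path between two of its points) of diameter $2$ such that the points and lines contained in it form a nondegenerate generalized quadrangle. A subgeometry is full if each of its lines has all its points in the subgeometry. *)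

(* Defs.v *)
From mathcomp Require Import all_boot all_algebra all_fingroup all_solvable all_field.

Set Implicit Arguments.
Unset Strict Implicit.
Unset Printing Implicit Defensive.

Import GRing.Theory.

Local Open Scope ring_scope.

Record geometry (P L : finType) := Geometry {
  points : {set P};
  lines : {set L};
  inc : P -> L -> bool
}.

Definition line_points (P L : finType) (X : geometry P L) (l : L) : {set P} :=
  [set x in points X | inc X x l].

Definition point_lines (P L : finType) (X : geometry P L) (x : P) : {set L} :=
  [set l in lines X | inc X x l].

Definition dual (P L : finType) (X : geometry P L) : geometry L P :=
  Geometry (lines X) (points X) (fun l x => inc X x l).

Definition isomorphic (P L P' L' : finType)
    (X : geometry P L) (Y : geometry P' L') : Prop :=
  exists (f : P -> P') (g : L -> L'),
    [/\ {in points X &, injective f} /\ f @: points X = points Y,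
        {in lines X &, injective g} /\ g @: lines X = lines Y
      & {in points X & lines X, forall x l, inc Y (f x) (g l) = inc X x l}].

Definition full_subgeometry (P L : finType) (Y X : geometry P L) : Prop :=
  [/\ points Y \subset points X,
      lines Y \subset lines X,
      {in points Y & lines Y, forall x l, inc Y x l = inc X x l}
    & {in lines Y, forall l, line_points X l \subset points Y}].

Definition induced (P L : finType) (X : geometry P L) (A : {set P}) :
    geometry P L :=
  Geometry (points X :&: A) [set l in lines X | line_points X l \subset A]
    (inc X).

Definition has_order (P L : finType) (s t : nat) (X : geometry P L) : Prop :=
  {in lines X, forall l, #|line_points X l| = s.+1} /\
  {in points X, forall x, #|point_lines X x| = t.+1}.

Definition partial_linear_space (P L : finType) (X : geometry P L) : bool :=
  [forall l in lines X, (1 < #|line_points X l|)%N] &&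
  [forall x in points X, forall y in points X,
     (x != y) ==> (#|point_lines X x :&: point_lines X y| <= 1)%N].

Definition collinear (P L : finType) (X : geometry P L) : rel P :=
  fun x y => [&& x \in points X, y \in points X, x != y
               & [exists l in lines X, inc X x l && inc X y l]].

(* The value #|T| stands for infinity: a shortest path has fewer than #|T|
   edges. *)
Definition dist (T : finType) (e : rel T) (x y : T) : nat :=
  find (fun n => [exists p : n.-tuple T, path e x p && (last x p == y)])
    (iota 0 #|T|).

Definition diameter (T : finType) (e : rel T) (A : {set T}) : nat :=
  \max_(x in A) \max_(y in A) dist e x y.

Definition near_2d_gon (P L : finType) (d : nat) (X : geometry P L) : Prop :=
  [/\ partial_linear_space X,
      {in points X &, forall x y, connect (collinear X) x y},
      diameter (collinear X) (points X) = d
    & {in points X & lines X, forall x l,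
        exists! y, y \in line_points X l /\
          {in line_points X l, forall z,
            (dist (collinear X) x y <= dist (collinear X) x z)%N}}].

Definition incidence_vertices (P L : finType) (X : geometry P L) : {set P + L} :=
  [set v | match v with inl x => x \in points X | inr l => l \in lines X end].

Definition incidence (P L : finType) (X : geometry P L) : rel (P + L) :=
  fun v w => match v, w with
  | inl x, inr l | inr l, inl x =>
      [&& x \in points X, l \in lines X & inc X x l]
  | _, _ => false
  end.

Definition has_girth (T : finType) (e : rel T) (g : nat) : Prop :=
  (exists c : seq T, [/\ (2 < size c)%N, ucycle e c & size c = g]) /\
  (forall c : seq T, (2 < size c)%N -> ucycle e c -> (g <= size c)%N).

(* Incidence graph of diameter n and girth 2n. *)
Definition generalized_polygon (P L : finType) (n : nat) (X : geometry P L) :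
    Prop :=
  [/\ {in incidence_vertices X &, forall v w, connect (incidence X) v w},
      diameter (incidence X) (incidence_vertices X) = n
    & has_girth (incidence X) n.*2].

Definition generalized_quadrangle (P L : finType) (X : geometry P L) : bool :=
  partial_linear_space X &&
  [forall x in points X, forall l in lines X,
     ~~ inc X x l ==> (#|[set y in line_points X l | collinear X x y]| == 1%N)].

Definition nondegenerate (P L : finType) (X : geometry P L) : bool :=
  [forall x in points X, exists l in lines X, ~~ inc X x l].

Definition convex (P L : finType) (X : geometry P L) (A : {set P}) : bool :=
  [forall x in A, forall y in A,
     forall p : (dist (collinear X) x y).-tuple P,
       (path (collinear X) x p && (last x p == y)) ==> (all (mem A) p)].

Definition quads (P L : finType) (X : geometry P L) : {set {set P}} :=
  [set A : {set P} |
    [&& A \subset points X, convex X A, diameter (collinear X) A == 2%N,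
        generalized_quadrangle (induced X A) & nondegenerate (induced X A)]].

Definition subspaces (F : finFieldType) (n k : nat) : {set {set 'rV[F]_n}} :=
  [set [set v | (v <= M)%MS] | M : 'M[F]_(k, n) & row_free M].

(* The standard nondegenerate alternating form on F^4. *)
Definition symp (F : finFieldType) (x y : 'rV[F]_4) : F :=
  x 0 (inord 0) * y 0 (inord 1) - x 0 (inord 1) * y 0 (inord 0) +
  x 0 (inord 2) * y 0 (inord 3) - x 0 (inord 3) * y 0 (inord 2).

Definition symplectic_gq (F : finFieldType) :
    geometry {set 'rV[F]_4} {set 'rV[F]_4} :=
  Geometry (subspaces F 4 1)
    [set U in subspaces F 4 2 |
       [forall x in U, forall y in U, symp x y == 0]]
    (fun U V => U \subset V).

(* Split octonions over F as Zorn vector matrices [a, u; v, b]. *)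
Notation octonion F := 'rV[F]_((1 + 3) + (3 + 1)).

Definition oct_a (F : finFieldType) (x : octonion F) := lsubmx (lsubmx x).
Definition oct_u (F : finFieldType) (x : octonion F) := rsubmx (lsubmx x).
Definition oct_v (F : finFieldType) (x : octonion F) := lsubmx (rsubmx x).
Definition oct_b (F : finFieldType) (x : octonion F) := rsubmx (rsubmx x).

(* The indices live in the ring 'I_3 of integers modulo 3. *)
Definition cross (F : finFieldType) (u v : 'rV[F]_3) : 'rV[F]_3 :=
  \row_(i < 3) (u 0 (i + 1) * v 0 (i + 2) - u 0 (i + 2) * v 0 (i + 1)).

Definition oct_mul (F : finFieldType) (x y : octonion F) : octonion F :=
  row_mx
    (row_mx
       (oct_a x *m oct_a y + oct_u x *m (oct_v y)^T)
       (oct_a x *m oct_u y + oct_b y *m oct_u x - cross (oct_v x) (oct_v y)))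
    (row_mx
       (oct_a y *m oct_v x + oct_b x *m oct_v y + cross (oct_u x) (oct_u y))
       (oct_b x *m oct_b y + oct_v x *m (oct_u y)^T)).

(* All ring automorphisms of the octonions, not only the F-linear ones: they
   preserve the centre F * 1, hence are semilinear, and form the extension of
   G_2(F) by the field automorphisms of F.  For #|F| = 4 this is G_2(4):2. *)
Definition oct_ring_aut (F : finFieldType) : {set {perm octonion F}} :=
  [set s : {perm octonion F} |
    [forall x, forall y,
      (s (x + y) == s x + s y) && (s (oct_mul x y) == oct_mul (s x) (s y))]].

Lemma oct_ring_autP (F : finFieldType) (s : {perm octonion F}) :
  reflect (forall x y, s (x + y) = s x + s y /\
                       s (oct_mul x y) = oct_mul (s x) (s y))
          (s \in oct_ring_aut F).
Proof.
rewrite inE; apply: (iffP forallP) => [sP x y | sP x].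
  by have /forallP /(_ y) /andP [/eqP -> /eqP ->] := sP x.
by apply/forallP => y; have [-> ->] := sP x y; rewrite !eqxx.
Qed.

Lemma oct_ring_aut_group_set (F : finFieldType) :
  group_set (oct_ring_aut F).
Proof.
apply/group_setP; split.
  by apply/oct_ring_autP => x y; rewrite !perm1.
move=> s t /oct_ring_autP sP /oct_ring_autP tP.
apply/oct_ring_autP => x y; rewrite !permM.
have [-> ->] := sP x y.
by have [-> ->] := tP (s x) (s y).
Qed.

Canonical oct_ring_aut_group (F : finFieldType) : {group {perm octonion F}} :=
  Group (oct_ring_aut_group_set F).

(* H(q): the points are the 1-spaces <x> of octonions with x ^ 2 = 0, i.e. of
   trace and norm zero (the points of the parabolic quadric Q(6, q)); the lines
   are the 2-spaces with zero multiplication.  Up to signs, in the coordinates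
   u = (X0, X1, X2), a = - b = X3, v = (X4, X5, X6) of the
   trace-zero octonions these are the lines of Q(6, q) selected by Tits' six
   linear equations in the Grassmann coordinates. *)
Definition split_cayley_hexagon (F : finFieldType) :
    geometry {set octonion F} {set octonion F} :=
  let null (U : {set octonion F}) :=
    [forall x in U, forall y in U, oct_mul x y == 0] in
  Geometry [set U in subspaces F _ 1 | null U]
           [set U in subspaces F _ 2 | null U]
           (fun U V => U \subset V).

Local Open Scope group_scope.

Definition central_involutions (gT : finGroupType) (G : {group gT}) :
    {set gT} :=
  [set x in G | (#[x] == 2%N) &&
                [exists T in 'Syl_2(G), T \subset 'C_G[x]]].

(* D constrains the index [G : N_G(<x, y>)]. *)
Definition involution_lines (gT : finGroupType) (G : {group gT}) (D : pred nat) :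
    {set {set gT}} :=
  [set l : {set gT} |
    [exists x in central_involutions G, exists y in central_involutions G,
      [&& x != y, x * y == y * x, l == [set x; y; x * y]
        & D #|G : 'N_G(<<[set x; y]>>)|]]].

Definition octagon_lines (gT : finGroupType) (G : {group gT}) :=
  involution_lines G (pred2 1365%N 13650%N).

Definition octagon (gT : finGroupType) (G : {group gT}) :
    geometry gT {set gT} :=
  Geometry (central_involutions G) (octagon_lines G) (fun x l => x \in l).

Definition Sstar (gT : finGroupType) (G : {group gT}) : {set {set gT}} :=
  involution_lines G (pred1 1365%N).

Definition Qstar (gT : finGroupType) (G : {group gT}) : {set {set gT}} :=
  quads (octagon G).

Definition containment (T : finType) (A B : {set {set T}}) :
    geometry {set T} {set T} :=
  Geometry A B (fun U V => U \subset V).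

(* Main.v *)
Require Import Defs.
From mathcomp Require Import all_boot all_algebra all_fingroup all_solvable all_field.
From mathcomp Require Import ring.

(* G is the ring automorphism group of the octonions over F_4.  A null octonion p
   (p <> 0, p p = 0) spans a point of H(4), and <p, q> is a line when p q = 0.  For
   v with p v = 0 and v v = 0 the map x |-> x + p (v x) is an automorphism; these
   long root elements are the central involutions.  Those attached to p form the
   star of p: with 1 they are an elementary abelian group of order 16 with an
   F_2-valued symplectic form.  Commuting long root elements share a star, the
   lines of the octagon are the isotropic lines {x, y, xy} of the stars, and stars
   of distinct points <p>, <q> are disjoint unless p q = 0, when they meet in the
   octagon line of the root group of <p, q>, a member of S*.  Because H(4) has no
   triangles, quadrangles or pentagons, the quads are exactly the stars, which gives
   (1).  For (2), from a point x to a star q of the subhexagon one walks along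
   the chain of stars of Q leading to q, projecting x successively on the root lines
   where consecutive stars meet.  If z is the result and k the length of the chain,
   then k + d(z, y) is the distance from x to y in q, and near polygon axioms are
   inherited from the quadrangle q.  This value must not depend on the choice of
   q containing y; the only case that is not settled by the girth is that of two
   chains closing up to an ordinary hexagon, where both projections agree by an
   identity for the octonion products around a hexagon ([hexagon_holonomy]). *)

Set Implicit Arguments.
Unset Strict Implicit.
Unset Printing Implicit Defensive.

Import GRing.Theory.

(** * Counting and distances *)

(** The obstacle is to read isotropy off the two indices. Write two elements of the star of p as
    elations along v and w, with v ** w = d p. Replacing p by c p divides d by c ^ 3 = 1, so over
    F_4 the scalar d depends on the pair only. The subgroups <x, y> with d = 0 are the 1365 root
    groups and those with d = 1 form one class of 13650; the two families with d outside F_2, again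
    of 13650 members each, are fused by the field automorphism, so that their index is at least
    27300. The indices 1365 and 13650 thus say that d lies in F_2, that is, that the trace of d
    vanishes, and this trace is the F_2-valued form on the star. Indices are obtained as orbit
    lengths; the order of G is never computed. Central involutions are found without a Sylow
    subgroup of G, as the involutions whose class has odd size: an explicit 2-group must fix an
    element of such a class. All later geometry depends only on the axioms of [star_system], which
    are carried over to G by the isomorphism. *)

Section Generic.

Lemma card_fibres (T U : finType) (f : T -> U) (D : {set T}) k :
  {in D, forall x, #|[set y in D | f y == f x]| = k} -> #|D| = #|f @: D| * k.
Proof.
move=> fk; rewrite -sum1_card (partition_big_imset f) /= -sum_nat_const.
apply: eq_bigr => u /imsetP[x xD ->]; rewrite -[RHS](fk x xD) -sum1_card.
by apply: eq_bigl => y; rewrite inE.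
Qed.

Lemma double_count (T U : finType) (D : {set T}) (E : {set U}) (r : T -> U -> bool) m n :
  {in D, forall x, #|[set u in E | r x u]| = m} ->
  {in E, forall u, #|[set x in D | r x u]| = n} -> #|D| * m = #|E| * n.
Proof.
move=> Dm En; rewrite -!sum_nat_const.
have -> : \sum_(x in D) m = \sum_(x in D) \sum_(u in E) r x u.
  apply: eq_bigr => x xD; rewrite -[LHS](Dm x xD) -sum1_card -big_mkcondr /=.
  by apply: eq_bigl => u; rewrite inE.
rewrite exchange_big /=; apply: eq_bigr => u uE.
rewrite -[RHS](En u uE) -sum1_card -big_mkcondr /=.
by apply: eq_bigl => x; rewrite inE.
Qed.

(** The size of the class of x is the index of its centraliser, and a subgroup contains a Sylow
    2-subgroup exactly when its index is odd. Centrality becomes a matter of counting. *)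
Lemma central_involutionP (gT : finGroupType) (G : {group gT}) x :
  reflect [/\ x \in G, #[x]%g = 2 & odd #|x ^: G|%g] (x \in central_involutions G).
Proof.
rewrite inE -index_cent1; apply: (iffP and3P) => -[xG].
  move=> /eqP x2 /existsP[T /andP[]]; rewrite inE => sylT sTC; split=> //.
  have sCG : ('C_G[x] \subset G)%g by apply: subsetIl.
  have := pHall_sub sylT; have /and3P[_ _] := sylT.
  rewrite -odd_2'nat -(Lagrange_index sCG sTC) oddM.
  by case/andP.
move=> x2 oddx; split=> //; first exact/eqP.
have [S sylS] := Sylow_exists 2 'C_G[x]%g.
have sCG : ('C_G[x] \subset G)%g by apply: subsetIl.
have sSC := pHall_sub sylS.
apply/existsP; exists S; rewrite inE sSC andbT pHallE (subset_trans sSC sCG) /=.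
rewrite (card_Hall sylS) -(Lagrange sCG) partnM ?cardG_gt0 //.
have odd' : 2^'.-nat #|G : 'C_G[x]|%g by rewrite -odd_2'nat.
by rewrite (part_p'nat odd') muln1.
Qed.

End Generic.

Section Distance.
Variables (T : finType) (e : rel T).
Implicit Types (x y z : T) (p : seq T).

Lemma dist_le x p : path e x p -> dist e x (last x p) <= size p.
Proof.
move=> xp; rewrite leqNgt; apply/negP => lt; have := lt => /(before_find 0).
have sz : size p < #|T|.
  by apply: leq_trans lt _; rewrite -(size_iota 0 #|T|) find_size.
rewrite nth_iota // add0n => /existsP; apply.
by exists (in_tuple p); rewrite xp /=.
Qed.

(** A path without repeated vertices has fewer than [#|T|] edges, so the search that defines [dist]
    succeeds on connected pairs. *)
Lemma dist_path x y : connect e x y ->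
  exists p, [/\ path e x p, last x p = y & size p = dist e x y].
Proof.
case/connectP=> p xp Ey; case/shortenP: xp Ey => q xq uq _ Ey.
have sz : size q < #|T| by have := max_card (mem (x :: q)); rewrite (card_uniqP uq).
pose a n := [exists t : n.-tuple T, path e x t && (last x t == y)].
have hasa : has a (iota 0 #|T|).
  apply/hasP; exists (size q); first by rewrite mem_iota.
  by apply/existsP; exists (in_tuple q); rewrite xq /= Ey.
have := nth_find 0 hasa; rewrite -/(dist e x y) nth_iota; last by rewrite -[X in _ < X](size_iota 0) -has_find.
rewrite add0n => /existsP[t /andP[xt /eqP lt]]; exists t; split=> //.
exact: size_tuple.
Qed.

Lemma dist0 x : dist e x x = 0.
Proof. by apply/eqP; rewrite -leqn0; apply: (@dist_le x [::]). Qed.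

Lemma dist_eq0 x y : connect e x y -> dist e x y = 0 -> x = y.
Proof. by move=> /dist_path[[|? ?] [_ /= <- <-]]. Qed.

Lemma dist1 x y : e x y -> x != y -> dist e x y = 1.
Proof.
move=> xy ne; apply/eqP; rewrite eqn_leq (@dist_le x [:: y]) /= ?xy //.
rewrite lt0n; apply: contraNneq ne => /dist_eq0 -> //; exact: connect1.
Qed.

Lemma dist2 x z y : e x z -> e z y -> x != y -> ~~ e x y -> dist e x y = 2.
Proof.
move=> xz zy ne nxy; have cxy : connect e x y.
  by apply: (connect_trans (connect1 xz)); apply: connect1.
apply/eqP; rewrite eqn_leq (@dist_le x [:: z; y]) /= ?xz ?zy //.
have [p [xp Ey <-]] := dist_path cxy.
case: p xp Ey => [|u [|//]] /=; first by move=> _ E; rewrite E eqxx in ne.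
by rewrite andbT => xu E; rewrite E (negPf nxy) in xu.
Qed.

(* If every value of [r] other than the one at [x] can be decreased along an edge
   and no edge increases it by more than 1, then [r] is the distance from [x]. *)
Lemma dist_rel x (r : T -> nat -> Prop) :
  r x 0 -> (forall y n m, r y n -> r y m -> n = m) ->
  (forall y n, r y n -> y != x -> exists z m, [/\ r z m, e z y & n = m.+1]) ->
  (forall y n z, r y n -> e y z -> exists2 m, r z m & m <= n.+1) ->
  forall y n, r y n -> connect e x y /\ dist e x y = n.
Proof.
move=> rx fr desc lip.
have up n : forall y, r y n -> exists p, [/\ path e x p, last x p = y & size p = n].
  elim: n => [|n IH] y ry.
    have [-> | ne] := eqVneq y x; first by exists [::].
    by have [z [m [_ _]]] := desc y 0 ry ne.
  have ne : y != x by apply/eqP => E; rewrite E in ry; have := fr _ _ _ ry rx.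
  have [z [m [rz zy [En]]]] := desc y n.+1 ry ne; rewrite -En in rz.
  have [p [xp Ez sz]] := IH z rz.
  by exists (rcons p y); rewrite rcons_path last_rcons size_rcons xp Ez zy sz.
have low p : path e x p -> exists2 m, r (last x p) m & m <= size p.
  elim/last_ind: p => [|p y IH]; first by exists 0.
  rewrite rcons_path last_rcons size_rcons => /andP[/IH[m rm lm] py].
  have [k rk lk] := lip _ _ _ rm py; exists k => //.
  exact: leq_trans lk _.
move=> y n ry; have [p [xp Ey sz]] := up n y ry.
have cxy : connect e x y by apply/connectP; exists p.
split=> //; apply/eqP; rewrite eqn_leq -{1}sz -{1}Ey dist_le //=.
have [q [xq Eq <-]] := dist_path cxy.
by have [m] := low q xq; rewrite Eq => rm; rewrite (fr _ _ _ ry rm).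
Qed.

End Distance.

(** * Stars with the incidences of a generalized hexagon *)

Definition meets (T : finType) (P Q : {set T}) := P :&: Q != set0.

(* The stars of the points of the hexagon inside the root involutions: each star
   together with 1 is a symplectic space over F_2 with form [~~ perp], two stars
   meet in a root group, and the incidence graph of the stars has the girth and
   the hexagon property of H(4). *)
Record star_system (gT : finGroupType) (Pts : {set {set gT}}) (perp : rel gT) :
    Prop := StarSystem {
  star_inv P x : P \in Pts -> x \in P -> x != 1%g /\ (x * x = 1)%g;
  star_mulC P x y : P \in Pts -> x \in P -> y \in P -> (x * y = y * x)%g;
  star_mul P x y : P \in Pts -> x \in P -> y \in P -> x != y -> (x * y)%g \in P;
  perp_refl P x : P \in Pts -> x \in P -> perp x x;
  perp_sym P x y : P \in Pts -> x \in P -> y \in P -> perp x y = perp y x;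
  perp_mul P x y z : P \in Pts -> x \in P -> y \in P -> z \in P -> x != y ->
    perp z (x * y)%g = (perp z x == perp z y);
  perp_nondeg P x : P \in Pts -> x \in P -> exists2 y, y \in P & ~~ perp x y;
  perp_max P x y z : P \in Pts -> x \in P -> y \in P -> z \in P ->
    x != y -> x != z -> y != z -> perp x y -> perp x z -> perp y z ->
    z = (x * y)%g;
  symplectic_basis P : P \in Pts -> exists a c b d,
    [/\ [/\ a \in P, c \in P, b \in P & d \in P], ~~ perp a c, ~~ perp b d,
        perp a b && perp a d & perp c b && perp c d];
  card_star15 P : P \in Pts -> #|P| = 15;
  meet_perp P Q x y : P \in Pts -> Q \in Pts -> P != Q ->
    x \in P :&: Q -> y \in P :&: Q -> perp x y;
  card_meet P Q : P \in Pts -> Q \in Pts -> P != Q -> meets P Q -> #|P :&: Q| = 3;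
  meet_eq P Q R x : P \in Pts -> Q \in Pts -> R \in Pts -> P != Q -> P != R ->
    x \in P -> x \in Q -> x \in R -> P :&: Q = P :&: R;
  no_triangle P Q R : P \in Pts -> Q \in Pts -> R \in Pts ->
    P != Q -> Q != R -> P != R ->
    meets P Q -> meets Q R -> meets P R -> exists x, [/\ x \in P, x \in Q & x \in R];
  no_quadrangle : forall P1 P2 P3 P4,
    [/\ P1 \in Pts, P2 \in Pts, P3 \in Pts & P4 \in Pts] ->
    [/\ meets P1 P2, meets P2 P3, meets P3 P4 & meets P4 P1] ->
    P2 = P4 \/ meets P1 P3;
  no_pentagon : forall P1 P2 P3 P4 P5,
    [/\ P1 \in Pts, P2 \in Pts, P3 \in Pts, P4 \in Pts & P5 \in Pts] ->
    [/\ meets P1 P2, meets P2 P3, meets P3 P4, meets P4 P5 & meets P5 P1] ->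
    meets P1 P3 \/ meets P2 P4;
  holonomy : forall P1 P2 P3 P4 P5 P6,
    [/\ P1 \in Pts, P2 \in Pts & P3 \in Pts] ->
    [/\ P4 \in Pts, P5 \in Pts & P6 \in Pts] ->
    [/\ ~~ meets P1 P3, ~~ meets P2 P4 & ~~ meets P3 P5] ->
    [/\ ~~ meets P4 P6, ~~ meets P5 P1 & ~~ meets P6 P2] ->
    forall x1 x2 x3 x4 x4' x5 x6,
    [/\ x1 \in P1 :&: P2, x2 \in P2 :&: P3, x3 \in P3 :&: P4 & x4 \in P4 :&: P5] ->
    [/\ x6 \in P6 :&: P1, x5 \in P5 :&: P6 & x4' \in P4 :&: P5] ->
    [/\ perp x1 x2, perp x2 x3 & perp x3 x4] ->
    [/\ perp x1 x6, perp x6 x5 & perp x5 x4'] -> x4 = x4'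
}.

Local Open Scope ring_scope.

(** * Split octonions *)

Section Coordinates.
Variable F : finFieldType.
Implicit Types (c a b u v w z : F).

Definition row3 (u1 u2 u3 : F) : 'rV[F]_3 := \row_(i < 3) [:: u1; u2; u3]`_i.

Definition mx_oct (a u1 u2 u3 v1 v2 v3 b : F) : octonion F :=
  row_mx (row_mx a%:M (row3 u1 u2 u3)) (row_mx (row3 v1 v2 v3) b%:M).

Lemma row3_eta (u : 'rV[F]_3) : exists u1 u2 u3, u = row3 u1 u2 u3.
Proof.
exists (u 0 0), (u 0 1), (u 0 2%:R); apply/rowP => i; rewrite mxE.
by case: i => [[|[|[|//]]] ?] /=; congr (u _ _); apply: val_inj.
Qed.

Lemma mx_octW (x : octonion F) : exists a u1 u2 u3 v1 v2 v3 b, x = mx_oct a u1 u2 u3 v1 v2 v3 b.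
Proof.
have [u1 [u2 [u3 Eu]]] := row3_eta (oct_u x).
have [v1 [v2 [v3 Ev]]] := row3_eta (oct_v x).
exists (oct_a x 0 0), u1, u2, u3, v1, v2, v3, (oct_b x 0 0).
by rewrite /mx_oct -Eu -Ev -!mx11_scalar !hsubmxK.
Qed.

Lemma row3D u1 u2 u3 v1 v2 v3 :
  row3 u1 u2 u3 + row3 v1 v2 v3 = row3 (u1 + v1) (u2 + v2) (u3 + v3).
Proof. by apply/rowP=> -[[|[|[|//]]] ?]; rewrite !mxE. Qed.

Lemma row3Z c u1 u2 u3 : c *: row3 u1 u2 u3 = row3 (c * u1) (c * u2) (c * u3).
Proof. by apply/rowP=> -[[|[|[|//]]] ?]; rewrite !mxE. Qed.

Lemma row3N u1 u2 u3 : - row3 u1 u2 u3 = row3 (- u1) (- u2) (- u3).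
Proof. by apply/rowP=> -[[|[|[|//]]] ?]; rewrite !mxE. Qed.

Lemma row3_dot u1 u2 u3 v1 v2 v3 :
  row3 u1 u2 u3 *m (row3 v1 v2 v3)^T = (u1 * v1 + u2 * v2 + u3 * v3)%:M.
Proof.
by rewrite [LHS]mx11_scalar !mxE !big_ord_recl big_ord0 !mxE /= addr0 !addrA.
Qed.

Lemma row3_cross u1 u2 u3 v1 v2 v3 :
  cross (row3 u1 u2 u3) (row3 v1 v2 v3) =
  row3 (u2 * v3 - u3 * v2) (u3 * v1 - u1 * v3) (u1 * v2 - u2 * v1).
Proof. by apply/rowP=> -[[|[|[|//]]] ?]; rewrite !mxE. Qed.

Lemma mx_octD a u1 u2 u3 v1 v2 v3 b (a' : F) w1 w2 w3 z1 z2 z3 (b' : F) :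
  mx_oct a u1 u2 u3 v1 v2 v3 b + mx_oct a' w1 w2 w3 z1 z2 z3 b' =
  mx_oct (a + a') (u1 + w1) (u2 + w2) (u3 + w3)
      (v1 + z1) (v2 + z2) (v3 + z3) (b + b').
Proof. by rewrite /mx_oct !add_row_mx !row3D -!raddfD. Qed.

Lemma mx_octZ c a u1 u2 u3 v1 v2 v3 b :
  c *: mx_oct a u1 u2 u3 v1 v2 v3 b =
  mx_oct (c * a) (c * u1) (c * u2) (c * u3) (c * v1) (c * v2) (c * v3) (c * b).
Proof. by rewrite /mx_oct !scale_row_mx !row3Z !scale_scalar_mx. Qed.

Lemma mx_octM a u1 u2 u3 v1 v2 v3 b (a' : F) w1 w2 w3 z1 z2 z3 (b' : F) :
  oct_mul (mx_oct a u1 u2 u3 v1 v2 v3 b) (mx_oct a' w1 w2 w3 z1 z2 z3 b') =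
  mx_oct (a * a' + (u1 * z1 + u2 * z2 + u3 * z3))
      (a * w1 + b' * u1 - (v2 * z3 - v3 * z2))
      (a * w2 + b' * u2 - (v3 * z1 - v1 * z3))
      (a * w3 + b' * u3 - (v1 * z2 - v2 * z1))
      (a' * v1 + b * z1 + (u2 * w3 - u3 * w2))
      (a' * v2 + b * z2 + (u3 * w1 - u1 * w3))
      (a' * v3 + b * z3 + (u1 * w2 - u2 * w1))
      (b * b' + (v1 * w1 + v2 * w2 + v3 * w3)).
Proof.
rewrite /oct_mul /oct_a /oct_b /oct_u /oct_v /mx_oct.
rewrite !(row_mxKl, row_mxKr) !mul_scalar_mx !row3_dot !row3_cross.
by rewrite !scale_scalar_mx -!raddfD !row3Z !row3N !row3D.
Qed.

Lemma mx_oct_inj a u1 u2 u3 v1 v2 v3 b (a' : F) w1 w2 w3 z1 z2 z3 (b' : F) :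
  mx_oct a u1 u2 u3 v1 v2 v3 b = mx_oct a' w1 w2 w3 z1 z2 z3 b' ->
  [/\ [/\ a = a', u1 = w1, u2 = w2 & u3 = w3],
      v1 = z1, v2 = z2, v3 = z3 & b = b'].
Proof.
move=> /eq_row_mx[/eq_row_mx[Ea Eu] /eq_row_mx[Ev Eb]].
move/matrixP/(_ 0 0): Ea; move/matrixP/(_ 0 0): Eb; rewrite !mxE !mulr1n.
have row3I (r1 r2 r3 s1 s2 s3 : F) : row3 r1 r2 r3 = row3 s1 s2 s3 ->
    [/\ r1 = s1, r2 = s2 & r3 = s3].
  move=> E; split.
  - by move/matrixP/(_ 0 0): E; rewrite !mxE.
  - by move/matrixP/(_ 0 1): E; rewrite !mxE.
  - by move/matrixP/(_ 0 2%:R): E; rewrite !mxE.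
by have [-> -> ->] := row3I _ _ _ _ _ _ Eu; have [-> -> ->] := row3I _ _ _ _ _ _ Ev.
Qed.

Definition mx_otr (x : octonion F) : F := oct_a x 0 0 + oct_b x 0 0.

Lemma mx_otrE a u1 u2 u3 v1 v2 v3 b :
  mx_otr (mx_oct a u1 u2 u3 v1 v2 v3 b) = a + b.
Proof.
by rewrite /mx_otr /oct_a /oct_b /mx_oct !(row_mxKl, row_mxKr) !mxE !mulr1n.
Qed.

End Coordinates.

(* The octonions are handled through an abstract carrier because unification on
   the underlying row vectors is intractable. *)
Record zorn_algebra (F : finFieldType) := ZornAlgebra {
  zorn_space :> finLmodType F;
  omul : zorn_space -> zorn_space -> zorn_space;
  otr : zorn_space -> F;
  oct : F -> F -> F -> F -> F -> F -> F -> F -> zorn_space;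
  octW (x : zorn_space) :
    exists a u1 u2 u3 v1 v2 v3 b, x = oct a u1 u2 u3 v1 v2 v3 b;
  oct_inj a u1 u2 u3 v1 v2 v3 b a' w1 w2 w3 z1 z2 z3 b' :
    oct a u1 u2 u3 v1 v2 v3 b = oct a' w1 w2 w3 z1 z2 z3 b' ->
    [/\ [/\ a = a', u1 = w1, u2 = w2 & u3 = w3],
        v1 = z1, v2 = z2, v3 = z3 & b = b'];
  octD a u1 u2 u3 v1 v2 v3 b a' w1 w2 w3 z1 z2 z3 b' :
    oct a u1 u2 u3 v1 v2 v3 b + oct a' w1 w2 w3 z1 z2 z3 b' =
    oct (a + a') (u1 + w1) (u2 + w2) (u3 + w3)
        (v1 + z1) (v2 + z2) (v3 + z3) (b + b');
  octZ c a u1 u2 u3 v1 v2 v3 b :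
    c *: oct a u1 u2 u3 v1 v2 v3 b =
    oct (c * a) (c * u1) (c * u2) (c * u3) (c * v1) (c * v2) (c * v3) (c * b);
  octM a u1 u2 u3 v1 v2 v3 b a' w1 w2 w3 z1 z2 z3 b' :
    omul (oct a u1 u2 u3 v1 v2 v3 b) (oct a' w1 w2 w3 z1 z2 z3 b') =
    oct (a * a' + (u1 * z1 + u2 * z2 + u3 * z3))
        (a * w1 + b' * u1 - (v2 * z3 - v3 * z2))
        (a * w2 + b' * u2 - (v3 * z1 - v1 * z3))
        (a * w3 + b' * u3 - (v1 * z2 - v2 * z1))
        (a' * v1 + b * z1 + (u2 * w3 - u3 * w2))
        (a' * v2 + b * z2 + (u3 * w1 - u1 * w3))
        (a' * v3 + b * z3 + (u1 * w2 - u2 * w1))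
        (b * b' + (v1 * w1 + v2 * w2 + v3 * w3));
  otrE a u1 u2 u3 v1 v2 v3 b : otr (oct a u1 u2 u3 v1 v2 v3 b) = a + b
}.

Definition octonions (F : finFieldType) : zorn_algebra F :=
  @ZornAlgebra F (octonion F) (@oct_mul F) (@mx_otr F) (@mx_oct F)
    (@mx_octW F) (@mx_oct_inj F) (@mx_octD F) (@mx_octZ F) (@mx_octM F)
    (@mx_otrE F).

Arguments oct {F} Z a u1 u2 u3 v1 v2 v3 b : rename.
Notation "x ** y" := (omul x y) (at level 40, left associativity).

Section Derived.
Variables (F : finFieldType) (Z : zorn_algebra F).
Implicit Types (c a b u v w z : F).

Lemma octN a u1 u2 u3 v1 v2 v3 b :
  - oct Z a u1 u2 u3 v1 v2 v3 b =
  oct Z (- a) (- u1) (- u2) (- u3) (- v1) (- v2) (- v3) (- b).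
Proof. by rewrite -scaleN1r octZ !mulN1r. Qed.

Lemma oct0 : 0 = oct Z 0 0 0 0 0 0 0 0.
Proof. by rewrite -(scale0r (oct Z 0 0 0 0 0 0 0 0)) octZ !mul0r. Qed.

Definition octE := (@octM F Z, @octD F Z, @octZ F Z, octN, @otrE F Z).

End Derived.

Ltac to_coords x :=
  let a := fresh "a" in let b := fresh "b" in
  let u1 := fresh "u" in let u2 := fresh "u" in let u3 := fresh "u" in
  let v1 := fresh "v" in let v2 := fresh "v" in let v3 := fresh "v" in
  move: (octW x) => [a [u1 [u2 [u3 [v1 [v2 [v3 [b ->]]]]]]]].

Ltac oct_ring := rewrite ?octE; try congr oct; ring.

Section Algebra.
Variables (F : finFieldType) (Z : zorn_algebra F).
Implicit Types (x y z p q : Z) (c : F).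

Lemma omulDl x y z : (x + y) ** z = x ** z + y ** z.
Proof. to_coords x; to_coords y; to_coords z; oct_ring. Qed.
Lemma omulDr x y z : x ** (y + z) = x ** y + x ** z.
Proof. to_coords x; to_coords y; to_coords z; oct_ring. Qed.
Lemma omulZl c x y : (c *: x) ** y = c *: (x ** y).
Proof. to_coords x; to_coords y; oct_ring. Qed.
Lemma omulZr c x y : x ** (c *: y) = c *: (x ** y).
Proof. to_coords x; to_coords y; oct_ring. Qed.
Lemma omul0l x : 0 ** x = 0 :> Z.
Proof. by rewrite -(scale0r x) omulZl !scale0r. Qed.
Lemma omul0r x : x ** 0 = 0 :> Z.
Proof. by rewrite -(scale0r x) omulZr !scale0r. Qed.
Lemma omulNl x y : (- x) ** y = - (x ** y).
Proof. by rewrite -!scaleN1r omulZl. Qed.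
Lemma omulNr x y : x ** (- y) = - (x ** y).
Proof. by rewrite -!scaleN1r omulZr. Qed.

Lemma otrD x y : otr (x + y) = otr x + otr y.
Proof. to_coords x; to_coords y; oct_ring. Qed.
Lemma otrZ c x : otr (c *: x) = c * otr x.
Proof. to_coords x; oct_ring. Qed.
Lemma otr0 : otr (0 : Z) = 0.
Proof. by rewrite oct0 otrE addr0. Qed.
Lemma otrN x : otr (- x) = - otr x.
Proof. by rewrite -scaleN1r otrZ mulN1r. Qed.
Lemma otrC x y : otr (x ** y) = otr (y ** x).
Proof. to_coords x; to_coords y; oct_ring. Qed.
Lemma otrA x y z : otr ((x ** y) ** z) = otr (x ** (y ** z)).
Proof. to_coords x; to_coords y; to_coords z; oct_ring. Qed.

Lemma omul_altl x y : x ** (x ** y) = (x ** x) ** y.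
Proof. to_coords x; to_coords y; oct_ring. Qed.
Lemma omul_altr x y : (y ** x) ** x = y ** (x ** x).
Proof. to_coords x; to_coords y; oct_ring. Qed.
Lemma omul_altl_lin x y z : x ** (y ** z) + y ** (x ** z) = (x ** y + y ** x) ** z.
Proof. to_coords x; to_coords y; to_coords z; oct_ring. Qed.

(** This is the polarisation of x x = - N(x) 1 on trace-zero octonions; [oct Z 1 0 0 0 0 0 0 1] is
    the unit. *)
Lemma omul_anticomm x y : otr x = 0 -> otr y = 0 ->
  x ** y + y ** x = otr (x ** y) *: oct Z 1 0 0 0 0 0 0 1.
Proof.
to_coords x; to_coords y; rewrite !otrE.
move=> /eqP; rewrite addrC addr_eq0 => /eqP-> /eqP; rewrite addrC addr_eq0 => /eqP->.
oct_ring.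
Qed.

(** For p ** q = 0 the last term drops out and p ** (q ** x) falls into the span of p and q, with
    coefficients given by the trace form. Hence a long root element moves vectors only along the
    line <p, q>. *)
Lemma omul_key p q x : otr p = 0 -> otr q = 0 ->
  p ** (q ** x) = otr (q ** x) *: p - otr (p ** x) *: q + x ** (p ** q).
Proof.
to_coords p; to_coords q; to_coords x; rewrite !otrE.
move=> /eqP; rewrite addrC addr_eq0 => /eqP-> /eqP; rewrite addrC addr_eq0 => /eqP->.
oct_ring.
Qed.

Definition assoc_defect w d z : Z := 3%:R *: (w ** z) - d ** z + z ** d.

(* 3 p(qz) - assoc_defect z is the standard derivation D_{p,q} of an
   alternative algebra applied to z. *)
Lemma derivation p q x y : otr p = 0 -> otr q = 0 ->
  let D z : Z :=
    3%:R *: (p ** (q ** z)) - assoc_defect (p ** q) (p ** q - q ** p) z in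
  D (x ** y) = D x ** y + x ** D y.
Proof.
to_coords p; to_coords q; to_coords x; to_coords y; rewrite !otrE.
move=> /eqP; rewrite addrC addr_eq0 => /eqP-> /eqP; rewrite addrC addr_eq0 => /eqP->.
by cbv beta zeta; rewrite /assoc_defect !octE; congr oct; ring.
Qed.

Lemma assoc_defect0 z : assoc_defect 0 0 z = 0.
Proof. by rewrite /assoc_defect omul0l omul0r scaler0 subrr addr0. Qed.

End Algebra.

(** * Automorphisms and long root elements *)

Section Automorphisms.
Variables (F : finFieldType) (Z : zorn_algebra F).
Implicit Types (x y : Z) (s : {perm Z}).

(** A copy of [oct_ring_aut] over the abstract carrier; on [octonions F] the two are convertible. *)
Definition zorn_aut : {set {perm Z}} :=
  [set s : {perm Z} |
    [forall x, forall y,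
      (s (x + y) == s x + s y) && (s (x ** y) == s x ** s y)]].

Lemma zorn_autP s :
  reflect (forall x y, s (x + y) = s x + s y /\ s (x ** y) = s x ** s y)
          (s \in zorn_aut).
Proof.
rewrite inE; apply: (iffP forallP) => [sP x y | sP x].
  by have /forallP /(_ y) /andP [/eqP -> /eqP ->] := sP x.
by apply/forallP => y; have [-> ->] := sP x y; rewrite !eqxx.
Qed.

Lemma zorn_aut_group_set : group_set zorn_aut.
Proof.
apply/group_setP; split; first by apply/zorn_autP => x y; rewrite !perm1.
move=> s t /zorn_autP sP /zorn_autP tP; apply/zorn_autP => x y.
by rewrite !permM; have [-> ->] := sP x y; have [-> ->] := tP (s x) (s y).
Qed.

Canonical zorn_aut_group := Group zorn_aut_group_set.

Lemma autD s x y : s \in zorn_aut -> s (x + y) = s x + s y.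
Proof. by move/zorn_autP/(_ x y)=> []. Qed.
Lemma autM s x y : s \in zorn_aut -> s (x ** y) = s x ** s y.
Proof. by move/zorn_autP/(_ x y)=> []. Qed.
Lemma aut0 s : s \in zorn_aut -> s 0 = 0.
Proof.
by move=> sA; apply: (addrI (s 0)); rewrite -autD // !addr0.
Qed.

End Automorphisms.

Section Elations.
Variables (F : finFieldType) (Z : zorn_algebra F).
Hypothesis F4 : #|F| = 4%N.
Implicit Types (x y z p q r u v w : Z) (c : F).

Lemma F4_pchar2 : 2 \in [pchar F].
Proof. exact: (@card_finPcharP F 2 2). Qed.

Lemma F4_addxx c : c + c = 0. Proof. exact: (addrr_pchar2 F4_pchar2). Qed.
Lemma F4_opp c : - c = c. Proof. exact: (oppr_pchar2 F4_pchar2). Qed.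
Lemma F4_cube c : c != 0 -> c ^+ 3 = 1.
Proof.
move=> c0; apply: (mulIf c0); rewrite mul1r -exprSr -[in RHS](expf_card c).
by rewrite F4.
Qed.
Lemma F4_pow4 c : c ^+ 4 = c.
Proof. by rewrite -[RHS]expf_card F4. Qed.

Lemma addxx x : x + x = 0.
Proof. by rewrite -mulr2n -scaler_nat mulr2n F4_addxx scale0r. Qed.
Lemma oppx x : - x = x.
Proof. by apply/eqP; rewrite -subr_eq0 -opprD addxx oppr0. Qed.
Lemma addxK x y : x + y + y = x.
Proof. by rewrite -addrA addxx addr0. Qed.

Lemma otr_nondeg x : (forall y, otr (x ** y) = 0) -> x = 0.
Proof.
to_coords x => E; rewrite oct0.
have := E (oct Z 1 0 0 0 0 0 0 0); have := E (oct Z 0 0 0 0 0 0 0 1).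
have := E (oct Z 0 1 0 0 0 0 0 0); have := E (oct Z 0 0 1 0 0 0 0 0).
have := E (oct Z 0 0 0 1 0 0 0 0); have := E (oct Z 0 0 0 0 1 0 0 0).
have := E (oct Z 0 0 0 0 0 1 0 0); have := E (oct Z 0 0 0 0 0 0 1 0).
by rewrite !octE !(mulr0, mul0r, mulr1, addr0, add0r) => -> -> -> -> -> -> -> ->.
Qed.

Lemma otr_dual x : x != 0 -> exists y, otr (x ** y) = 1.
Proof.
move=> x0; have [y ynz] : exists y, otr (x ** y) != 0.
  apply/existsP; apply: contraNT x0; rewrite negb_exists => /forallP E.
  by apply/eqP/otr_nondeg => y; apply/eqP; have := E y; rewrite negbK.
by exists ((otr (x ** y))^-1 *: y); rewrite omulZr otrZ mulVf.
Qed.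

Lemma otr_sep x w : (forall c, w <> c *: x) ->
  exists2 y, otr (x ** y) = 0 & otr (w ** y) = 1.
Proof.
move=> wx; have [x0 | x0] := eqVneq x 0.
  have /otr_dual[y wy] : w != 0.
    by apply/eqP => w0; apply: (wx 0); rewrite scale0r.
  by exists y; rewrite // x0 omul0l otr0.
have [z xz] := otr_dual x0; pose c := otr (w ** z).
have /otr_dual[y wy] : w - c *: x != 0.
  by apply/eqP => /eqP; rewrite subr_eq0 => /eqP /wx.
exists (y - otr (x ** y) *: z).
  by rewrite omulDr omulNr omulZr otrD otrN otrZ xz mulr1 subrr.
rewrite -wy omulDr omulDl !omulNr omulNl omulZr omulZl !otrD !otrN !otrZ.
by rewrite /c; ring.
Qed.

Definition null p := (p != 0) && (p ** p == 0).
(** For null p these vectors form the 3-space swept out by the lines of the hexagon through <p>; 0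
    and the multiples of p are included. *)
Definition plane p v := (p ** v == 0) && (v ** v == 0).

(** With a non-zero trace the u-coordinates of p ** p = 0 would force u = 0, then a = b = 0, and the
    trace would vanish after all. *)
Lemma sqr0_otr p : p ** p = 0 -> otr p = 0.
Proof.
to_coords p; rewrite !octE oct0 => /oct_inj[[Ea E1 E2 E3] E4 E5 E6 Eb].
apply/eqP; apply: contraT => ab0.
have scal (t : F) : a * t + b * t = 0 -> t = 0.
  by rewrite -mulrDl => /eqP; rewrite mulf_eq0 (negPf ab0) => /eqP.
have u_0 : u = 0 by apply: scal; rewrite -E1; ring.
have u0_0 : u0 = 0 by apply: scal; rewrite -E2; ring.
have u1_0 : u1 = 0 by apply: scal; rewrite -E3; ring.
move: Ea Eb ab0; rewrite u_0 u0_0 u1_0 !mul0r !mulr0 !addr0.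
move=> /eqP; rewrite mulf_eq0 orbb => /eqP-> /eqP.
by rewrite mulf_eq0 orbb => /eqP->; rewrite addr0 eqxx.
Qed.

Lemma null_neq0 p : null p -> p != 0. Proof. by case/andP. Qed.
Lemma null_sqr p : null p -> p ** p = 0. Proof. by case/andP=> _ /eqP. Qed.
Lemma null_otr p : null p -> otr p = 0. Proof. by move/null_sqr/sqr0_otr. Qed.
Lemma planeP p v : plane p v -> [/\ p ** v = 0, v ** v = 0 & otr v = 0].
Proof. by case/andP=> /eqP pv /eqP vv; split=> //; apply: sqr0_otr. Qed.

Lemma omulC0 x y : otr x = 0 -> otr y = 0 -> x ** y = 0 -> y ** x = 0.
Proof.
move=> tx ty xy; have := omul_anticomm tx ty.
by rewrite xy add0r otr0 scale0r.
Qed.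

Lemma omulCN x y : otr x = 0 -> otr y = 0 -> otr (x ** y) = 0 ->
  y ** x = x ** y.
Proof.
move=> tx ty txy; have := omul_anticomm tx ty; rewrite txy scale0r.
by move/eqP; rewrite addrC addr_eq0 oppx => /eqP.
Qed.

Lemma plane_sym p v : null p -> v != 0 -> plane p v -> null v && plane v p.
Proof.
move=> np v0 /planeP[pv vv tv]; rewrite /null /plane v0 vv.
by rewrite (omulC0 _ tv pv) ?null_sqr ?null_otr ?eqxx.
Qed.

Lemma flag_mul p q x : null p -> plane p q ->
  p ** (q ** x) = otr (q ** x) *: p + otr (p ** x) *: q.
Proof.
move=> /null_otr tp /planeP[pq _ tq].
by rewrite omul_key // pq omul0r addr0 oppx.
Qed.

(** As p and q annihilate each other on both sides, [assoc_defect] vanishes, and 3 = 1 in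
    characteristic 2: the standard derivation reduces to p ** (q ** x). *)
Lemma flag_derivation p q x y : null p -> plane p q ->
  p ** (q ** (x ** y)) = (p ** (q ** x)) ** y + x ** (p ** (q ** y)).
Proof.
move=> np /planeP[pq qq tq]; have tp := null_otr np.
have three : 3%:R = 1 :> F by rewrite -addn1 natrD -(addn1 1) natrD F4_addxx add0r.
have := derivation x y tp tq; cbv beta zeta.
rewrite pq (omulC0 tp tq pq) subrr three.
rewrite !assoc_defect0 !subr0 (scale1r (p ** (q ** (x ** y)))).
by rewrite (scale1r (p ** (q ** x))) (scale1r (p ** (q ** y))).
Qed.

Definition elation_fun p q x := x + p ** (q ** x).

Lemma elation_funK p q : null p -> plane p q -> involutive (elation_fun p q).
Proof.
move=> np /planeP[pq qq tq] x; have tp := null_otr np.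
rewrite /elation_fun; set y := p ** (q ** x).
have /eqP: q ** (p ** (q ** x)) + p ** (q ** (q ** x)) = 0.
  by rewrite omul_altl_lin pq (omulC0 tp tq pq) addr0 omul0l.
rewrite omul_altl qq omul0l omul0r addr0 -/y => /eqP qy.
by rewrite !omulDr qy omul0r addr0 -/y addxK.
Qed.

(** The default 1 stands for a map [elation_fun p q] that is not injective; [null p] and [plane p q]
    exclude this, since the map is then an involution by [elation_funK]. *)
Definition elation p q : {perm Z} := insubd (1%g : {perm Z}) (finfun (elation_fun p q)).

Lemma elationE p q x : null p -> plane p q ->
  elation p q x = x + p ** (q ** x).
Proof.
move=> np pq; rewrite /elation -pvalE val_insubd.
case: ifP => [_|/injectiveP[]]; first by rewrite ffunE.
by move=> y z; rewrite !ffunE => /(inv_inj (elation_funK np pq)).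
Qed.

(** Adding the identity to a derivation D gives a multiplicative map as soon as D x ** D y = 0; here
    D takes its values in the span of p and q, where all products vanish. *)
Lemma elation_aut p q : null p -> plane p q -> elation p q \in zorn_aut Z.
Proof.
move=> np pq; apply/zorn_autP => x y; rewrite !elationE //.
split; first by rewrite !omulDr addrACA.
rewrite omulDr !omulDl flag_derivation // -!addrA; congr (_ + (_ + _)).
suff -> : (p ** (q ** x)) ** (p ** (q ** y)) = 0 by rewrite addr0.
rewrite (flag_mul x np pq) (flag_mul y np pq).
have [pq0 qq tq] := planeP pq.
rewrite !(omulDl, omulDr, omulZl, omulZr) pq0 qq null_sqr //.
by rewrite (omulC0 (null_otr np) tq pq0) !(scaler0, addr0).
Qed.

Lemma aut_null s p : s \in zorn_aut Z -> null p -> null (s p).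
Proof.
move=> sA /andP[p0 /eqP pp]; rewrite /null -autM // pp aut0 // eqxx andbT.
by rewrite -(aut0 sA) (inj_eq perm_inj).
Qed.

Lemma aut_plane s p v : s \in zorn_aut Z -> plane p v -> plane (s p) (s v).
Proof.
by move=> sA /andP[/eqP pv /eqP vv]; rewrite /plane -!autM // pv vv aut0 ?eqxx.
Qed.

Lemma elationJ s p v : s \in zorn_aut Z -> null p -> plane p v ->
  (elation p v ^ s)%g = elation (s p) (s v).
Proof.
move=> sA np pv; apply/permP => x; rewrite !permM.
rewrite !elationE ?aut_null ?aut_plane // autD // !autM // permKV //.
Qed.

(* Independence of p and v is expressed as [elation p v != 1], which is visibly
   invariant under conjugation. *)
Lemma elation_eq1 p v : null p -> plane p v ->
  reflect (exists c, v = c *: p) (elation p v == 1%g).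
Proof.
move=> np pv; apply: (iffP eqP) => [E | [c ->]]; last first.
  apply/permP => x; rewrite perm1 elationE //; last first.
    by rewrite /plane omulZl !omulZr null_sqr // !scaler0 eqxx.
  by rewrite omulZl omulZr omul_altl null_sqr // omul0l scaler0 addr0.
have [y py] := otr_dual (null_neq0 np).
have := elationE y np pv; rewrite E perm1 flag_mul // py scale1r.
move=> /eqP; rewrite -subr_eq0 opprD addrA subrr add0r oppx addr_eq0 oppx.
by move=> /eqP <-; exists (otr (v ** y)).
Qed.

(** By [flag_mul] the displacement p ** (v ** x) is symmetric in p and v: a root group belongs to a
    line rather than to one of its points. *)
Lemma elationC p v : null p -> null v -> plane p v -> elation p v = elation v p.
Proof.
move=> np nv pv; have /andP[_ vp] := plane_sym np (null_neq0 nv) pv.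
apply/permP => x; rewrite !elationE //.
by rewrite (flag_mul x np pv) (flag_mul x nv vp); congr (_ + _); rewrite addrC.
Qed.

Lemma planeZ p v c : plane p v -> plane p (c *: v).
Proof.
by move=> /andP[/eqP pv /eqP vv];
   rewrite /plane omulZl !omulZr pv vv !scaler0 eqxx.
Qed.

Lemma nullZ p c : c != 0 -> null p -> null (c *: p).
Proof.
move=> c0 /andP[p0 /eqP pp].
by rewrite /null omulZl omulZr pp !scaler0 scaler_eq0 negb_or c0 p0 eqxx.
Qed.

Lemma planeZl p v c : plane p v -> plane (c *: p) v.
Proof. by move=> /andP[/eqP pv vv]; rewrite /plane omulZl pv scaler0 eqxx. Qed.

Lemma elationZ p v c : c != 0 -> null p -> plane p v ->
  elation (c *: p) v = elation p (c *: v).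
Proof.
move=> c0 np pv; apply/permP=> x.
by rewrite !elationE ?nullZ ?planeZ ?planeZl // omulZl !omulZl omulZr.
Qed.

End Elations.

(** * Transitivity on null octonions, and frames of their planes *)

Section Hexagon.
Variables (F : finFieldType) (Z : zorn_algebra F).
Hypothesis F4 : #|F| = 4%N.
Implicit Types (x y z p q r u v w : Z) (c : F) (s : {perm Z}).
Local Notation A := (zorn_aut_group Z).

Lemma omul_artin x y : (x ** y) ** (x ** y) = ((x ** y) ** x) ** y.
Proof. to_coords x; to_coords y; oct_ring. Qed.

Lemma null_mul_sqr p y : null p -> otr (p ** y) = 0 ->
  (p ** (p ** y) = 0) /\ ((p ** y) ** (p ** y) = 0).
Proof.
move=> np ty; have E : p ** (p ** y) = 0 by rewrite omul_altl null_sqr ?omul0l.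
by rewrite omul_artin (omulC0 (null_otr np) ty E) omul0l.
Qed.

(** The elation at b along b ** y moves p by otr ((p ** b) ** y) b. Since p ** b is not a multiple
    of b, some y makes this coefficient 1 while otr (b ** y) = 0, so that b ** y lies in the plane
    of b. *)
Lemma null_shift p b : null p -> null b -> otr (p ** b) = 0 -> p ** b != 0 ->
  p + b \in orbit 'P A p.
Proof.
move=> np nb tpb pb0.
have [|y by0 wy1] := @otr_sep _ Z b (p ** b).
  move=> c E; have : p ** (p ** b) = 0 by rewrite omul_altl null_sqr ?omul0l.
  rewrite {1}E omulZr => /eqP; rewrite scaler_eq0 (negPf pb0) orbF => /eqP c0.
  by rewrite E c0 scale0r eqxx in pb0.
have [ba aa] := null_mul_sqr nb by0.
have pla : plane b (b ** y) by rewrite /plane ba aa eqxx.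
apply/orbitP; exists (elation b (b ** y)); first exact: elation_aut.
rewrite /= apermE elationE // flag_mul //.
by rewrite (otrC b p) tpb scale0r addr0 otrC -otrA wy1 scale1r.
Qed.

(** The octonion p + b lies in both orbits, because [null_shift] applies to p and b in either
    order. *)
Lemma null_conj p b : null p -> null b -> otr (p ** b) = 0 -> p ** b != 0 ->
  b \in orbit 'P A p.
Proof.
move=> np nb tpb pb0; apply: (@orbit_trans _ _ _ _ _ (p + b));
  last exact: null_shift.
rewrite orbit_sym addrC; apply: null_shift => //; first by rewrite otrC.
apply: contraNneq pb0 => /(omulC0 (null_otr nb) (null_otr np)) ->.
exact: eqxx.
Qed.

Lemma null_coords (a u1 u2 u3 v1 v2 v3 b : F) : null (oct Z a u1 u2 u3 v1 v2 v3 b) ->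
  b = a /\ a ^+ 2 = u1 * v1 + u2 * v2 + u3 * v3.
Proof.
move=> np; have := null_otr np; rewrite otrE => /eqP.
rewrite addr_eq0 F4_opp // => /eqP <-; split=> //.
have := null_sqr np; rewrite octM oct0 => /oct_inj[[E _ _ _] _ _ _ _].
by apply/eqP; rewrite -subr_eq0 F4_opp // expr2 E.
Qed.

Lemma oct_eq0 (a u1 u2 u3 v1 v2 v3 b : F) :
  (oct Z a u1 u2 u3 v1 v2 v3 b == 0) =
  [&& a == 0, u1 == 0, u2 == 0, u3 == 0, v1 == 0, v2 == 0, v3 == 0 & b == 0].
Proof.
apply/eqP/idP => [|/and5P[] + + + + /and4P[]].
  by rewrite oct0 => /oct_inj[[-> -> -> ->] -> -> -> ->]; rewrite !eqxx.
by do 8!move=> /eqP->; rewrite oct0.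
Qed.

Local Notation e1 := (oct Z 0 1 0 0 0 0 0 0).
Local Notation e2 := (oct Z 0 0 1 0 0 0 0 0).
Local Notation e3 := (oct Z 0 0 0 1 0 0 0 0).
Local Notation f1 := (oct Z 0 0 0 0 1 0 0 0).
Local Notation f2 := (oct Z 0 0 0 0 0 1 0 0).
Local Notation f3 := (oct Z 0 0 0 0 0 0 1 0).

Definition zeros := (mulr0, mul0r, mulr1, mul1r, addr0, add0r, subr0, oppr0, sub0r).

Lemma null_units : [/\ [/\ null e1, null e2 & null e3], null f1, null f2 & null f3].
Proof. by rewrite /null !octE !zeros !oct_eq0 !eqxx !oner_eq0 !andbF. Qed.

(** In each case the equation is the vanishing of the trace of the product of the unit with r, and
    the disjunction keeps that product from being 0, as [null_conj] demands. *)
Lemma conj_units (a u1 u2 u3 v1 v2 v3 : F) (r := oct Z a u1 u2 u3 v1 v2 v3 a) :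
  null r ->
  [/\ [/\ v1 = 0 -> [|| a != 0, u2 != 0 | u3 != 0] -> r \in orbit 'P A e1,
          v2 = 0 -> [|| a != 0, u1 != 0 | u3 != 0] -> r \in orbit 'P A e2
        & v3 = 0 -> [|| a != 0, u1 != 0 | u2 != 0] -> r \in orbit 'P A e3],
      u1 = 0 -> [|| a != 0, v2 != 0 | v3 != 0] -> r \in orbit 'P A f1,
      u2 = 0 -> [|| a != 0, v1 != 0 | v3 != 0] -> r \in orbit 'P A f2
    & u3 = 0 -> [|| a != 0, v1 != 0 | v2 != 0] -> r \in orbit 'P A f3].
Proof.
move=> nr; have [[n1 n2 n3] m1 m2 m3] := null_units.
by split; [split | | |] => z0 nz; apply: null_conj => //;
   rewrite ?octE ?otrE !zeros ?oct_eq0 ?z0 ?addr0 ?oppr_eq0 //;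
   apply: contraL nz => /and5P[? ? ? ? /and4P[? ? ? ?]]; rewrite !negb_or !negbK;
   apply/and3P; split.
Qed.

(** The product of e1 and f1 has trace 1, so [null_conj] does not link them directly; e2 + f3 is
    conjugate to both. *)
Lemma units_conj : [/\ e2 \in orbit 'P A e1, f1 \in orbit 'P A e1 & f3 \in orbit 'P A e1].
Proof.
have [[n1 n2 n3] m1 m2 m3] := null_units.
have nr : null (oct Z 0 0 1 0 0 0 1 0).
  by rewrite /null !octE !zeros !oct_eq0 !eqxx !oner_eq0 !andbF.
have [[/(_ erefl) re1 _ _] /(_ erefl) rf1 _ _] := conj_units nr.
rewrite !oner_eq0 !orbT in re1 rf1.
have f1e1 : f1 \in orbit 'P A e1.
  by apply: (@orbit_trans _ _ _ _ _ _ _ _ (re1 isT)); rewrite orbit_sym rf1.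
split=> //.
  have [[/(_ erefl) + _ _] _ _ _] := conj_units n2; apply.
  by rewrite oner_eq0 orbT.
apply: orbit_trans f1e1.
have [_ /(_ erefl) + _ _] := conj_units m3; apply.
by rewrite oner_eq0 !orbT.
Qed.

Lemma null_transitive p : null p -> p \in orbit 'P A e1.
Proof.
have [e2e1 f1e1 f3e1] := units_conj; have [[n1 n2 n3] m1 m2 m3] := null_units.
to_coords p => np; have [? E] := null_coords np; subst b.
have [v0_0 | v0nz] := eqVneq v0 0.
  subst v0; have [[ce1 /(_ erefl) ce2 _] cf1 _ cf3] := conj_units np.
  have [/ce2 H | ] := boolP [|| a != 0, u != 0 | u1 != 0].
    exact: orbit_trans H e2e1.
  rewrite !negb_or !negbK => /and3P[/eqP ? /eqP ? /eqP ?]; subst a u u1.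
  have [/(cf1 erefl) H | ] := boolP [|| 0 != 0 :> F, 0 != 0 :> F | v1 != 0].
    exact: orbit_trans H f1e1.
  rewrite eqxx /= negbK => /eqP ?; subst v1.
  have [/(cf3 erefl) H | ] := boolP [|| 0 != 0 :> F, v != 0 | 0 != 0 :> F].
    exact: orbit_trans H f3e1.
  rewrite eqxx orbF /= negbK => /eqP ?; subst v; apply: ce1 => //.
  by have := null_neq0 np; rewrite oct_eq0 !eqxx !andbT /= orbF.
(* With this t the elation clears the coordinate v, after which [conj_units] applies at e1 or,
   failing that, at f3, because v0 is kept and is not 0. *)
pose t := v / v0.
have plf : plane e2 (t *: f1).
  by rewrite /plane !octE !zeros !oct_eq0 ?subrr !eqxx.
have Er : elation e2 (t *: f1) (oct Z a u u0 u1 v v0 v1 a) =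
    oct Z a u (u0 + t * u) u1 0 v0 v1 a.
  rewrite elationE // !octE; congr oct; try by ring.
  by transitivity (v - t * v0); [ring | rewrite /t divfK // subrr].
have tA : elation e2 (t *: f1) \in zorn_aut Z by exact: elation_aut.
have := aut_null tA np; rewrite Er => nr.
apply: (@orbit_trans _ _ _ _ _ (oct Z a u (u0 + t * u) u1 0 v0 v1 a)).
  rewrite orbit_sym; apply/orbitP.
  by exists (elation e2 (t *: f1)); [exact: tA | exact: Er].
have [[/(_ erefl) ce1 _ _] _ _ cf3] := conj_units nr.
have [/ce1 // |] := boolP [|| a != 0, u0 + t * u != 0 | u1 != 0].
rewrite !negb_or !negbK => /and3P[_ _ /eqP /cf3 H].
by apply: orbit_trans f3e1; apply: H; rewrite v0nz !orbT.
Qed.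

Lemma oct_center z : (forall x, z ** x = x ** z) ->
  exists c, z = c *: oct Z 1 0 0 0 0 0 0 1.
Proof.
to_coords z => E; exists a; rewrite octZ !zeros.
have := E e1; rewrite !octE !zeros => /oct_inj[[<- Eb _ _] _ _ _ _].
have := E e2; rewrite !octE !zeros => /oct_inj[[<- _ _ _] _ _ _ _].
have := E e3; rewrite !octE !zeros => /oct_inj[[<- _ _ _] _ _ _ _].
have := E f1; rewrite !octE !zeros => /oct_inj[[-> _ _ _] _ _ _ _].
have := E f2; rewrite !octE !zeros => /oct_inj[[-> _ _ _] _ _ _ _].
have := E f3; rewrite !octE !zeros => /oct_inj[[-> _ _ _] _ _ _ _].
by rewrite Eb.
Qed.

Lemma oct_scal c x : c *: oct Z 1 0 0 0 0 0 0 1 ** x = c *: x.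
Proof. by rewrite omulZl; congr (_ *: _); to_coords x; oct_ring. Qed.

Lemma oct_scalC c x : x ** (c *: oct Z 1 0 0 0 0 0 0 1) = c *: x.
Proof. by rewrite omulZr; congr (_ *: _); to_coords x; oct_ring. Qed.

Lemma aut_semilinear s c : s \in zorn_aut Z ->
  exists c', forall x, s (c *: x) = c' *: s x.
Proof.
move=> sA; have [z|c' Ec] := @oct_center (s (c *: oct Z 1 0 0 0 0 0 0 1)).
  by rewrite -[z](permKV s) -!autM // oct_scal oct_scalC.
by exists c' => x; rewrite -(oct_scal c) autM // Ec oct_scal.
Qed.

Lemma planeD p v w : null p -> plane p v -> plane p w -> v ** w + w ** v = 0 ->
  plane p (v + w).
Proof.
move=> np /andP[/eqP pv /eqP vv] /andP[/eqP pw /eqP ww] vw.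
rewrite /plane omulDr pv pw addr0 eqxx omulDl !omulDr vv ww add0r addr0.
exact/eqP.
Qed.

(** The normalisation v ** w = p makes every product on the plane a 2 x 2 determinant in the v, w
    coordinates, times p. *)
Definition frame p v w := [/\ plane p v, plane p w, v ** w = p &
  forall y, plane p y -> exists c a b, y = c *: p + a *: v + b *: w].

Lemma frame_e1 : frame e1 f3 f2.
Proof.
split; try by rewrite /plane !octE !zeros !oct_eq0 !eqxx.
  by rewrite !octE !zeros ?opprK.
move=> y; to_coords y => py; have [_ _] := planeP py; case/andP: py.
rewrite octM !zeros oct_eq0 otrE => /and5P[/eqP-> /eqP-> _ _ /and4P[_ + /eqP-> _]] _.
rewrite oppr_eq0 => /eqP->; rewrite !zeros => ->.
by exists u, v1, v0; rewrite !octE !zeros.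
Qed.

Lemma aut_frame s p v w : s \in zorn_aut Z -> frame p v w ->
  frame (s p) (s v) (s w).
Proof.
move=> sA [pv pw vw sp]; split; try exact: aut_plane.
  by rewrite -autM // vw.
have sVA : (s^-1)%g \in zorn_aut Z by rewrite groupV.
move=> y py; have [|c [a [b Ey]]] := sp (s^-1 y)%g.
  by rewrite -[p](permK s) aut_plane.
have [c' Ec] := aut_semilinear c sA; have [a' Ea] := aut_semilinear a sA.
have [b' Eb] := aut_semilinear b sA.
by exists c', a', b'; rewrite -[y](permKV s) Ey !autD // Ec Ea Eb.
Qed.

Lemma frame_exists p : null p -> exists v w, frame p v w.
Proof.
move=> /null_transitive/orbitP[s sA /= <-]; rewrite apermE.
by exists (s f3), (s f2); apply: aut_frame => //; apply: frame_e1.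
Qed.

End Hexagon.

(** * Multiplication and elations on the plane of a point *)

Section Planes.
Variables (F : finFieldType) (Z : zorn_algebra F).
Hypothesis F4 : #|F| = 4%N.
Implicit Types (x y z p q r u v w : Z) (c : F) (s : {perm Z}).
Local Notation A := (zorn_aut_group Z).

Lemma frameC p v w : null p -> frame p v w -> w ** v = p.
Proof.
move=> np [/planeP[_ _ tv] /planeP[_ _ tw] vw _].
by rewrite (omulCN F4 tv tw) vw ?null_otr.
Qed.

Lemma frame_mul p v w c a b c' a' b' : null p -> frame p v w ->
  (c *: p + a *: v + b *: w) ** (c' *: p + a' *: v + b' *: w) =
  (a * b' + b * a') *: p.
Proof.
move=> np fr; have wv := frameC np fr.
case: fr => /planeP[pv vv tv] /planeP[pw ww tw] vw _.
have vp := omulC0 (null_otr np) tv pv; have wp := omulC0 (null_otr np) tw pw.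
rewrite !(omulDl, omulDr) !(omulZl, omulZr) null_sqr // pv pw vv ww vp wp vw wv.
by rewrite !scaler0 !addr0 !add0r !scalerA -scalerDl addrC.
Qed.

Lemma plane_mul p v w : null p -> plane p v -> plane p w ->
  exists c, v ** w = c *: p.
Proof.
move=> np; have [v0 [w0 fr]] := frame_exists F4 np.
case: (fr) => _ _ _ sp /sp[c [a [b ->]]] /sp[c' [a' [b' ->]]].
by exists (a * b' + b * a'); rewrite frame_mul.
Qed.

(** The product on the plane is a determinant modulo p, so it vanishes only on pairs that are
    dependent modulo p. *)
Lemma plane_dep p v w : null p -> plane p v -> plane p w -> v ** w = 0 ->
  (exists c, v = c *: p) \/ (exists a b, w = a *: p + b *: v).
Proof.
move=> np; have [v0 [w0 fr]] := frame_exists F4 np.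
case: (fr) => _ _ _ sp /sp[c [a [b ->]]] /sp[c' [a' [b' ->]]].
rewrite frame_mul // => /eqP; rewrite scaler_eq0 (negPf (null_neq0 np)) orbF.
rewrite addr_eq0 F4_opp // => /eqP E.
have [a0 | a0] := eqVneq a 0; last first.
  right; exists (c' - a' / a * c), (a' / a).
  rewrite !scalerDr !scalerA addrA addrA -scalerDl subrK divfK //.
  by rewrite mulrAC -[a' * b]mulrC -E mulrC mulKf.
have [b0 | b0] := eqVneq b 0; last first.
  right; exists (c' - b' / b * c), (b' / b).
  rewrite !scalerDr !scalerA addrA addrA -scalerDl subrK divfK //.
  by rewrite mulrAC -[b' * a]mulrC E mulrC mulKf.
by left; exists c; rewrite a0 b0 !scale0r !addr0.
Qed.

Lemma plane_addP p v w : null p -> plane p v -> plane p w -> plane p (v + w).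
Proof.
move=> np pv pw; apply: planeD => //; have [c E] := plane_mul np pv pw.
have [[_ _ tv] [_ _ tw]] := (planeP pv, planeP pw).
by rewrite omul_anticomm // E otrZ null_otr // mulr0 scale0r.
Qed.

Lemma planeC p v w : null p -> plane p v -> plane p w -> w ** v = v ** w.
Proof.
move=> np pv pw; have [c E] := plane_mul np pv pw.
have [[_ _ tv] [_ _ tw]] := (planeP pv, planeP pw).
by rewrite (omulCN F4 tv tw) // E otrZ null_otr // mulr0.
Qed.

Lemma plane_pp p c : null p -> plane p (c *: p).
Proof.
by move=> np; rewrite /plane omulZl !omulZr null_sqr // !scaler0 eqxx.
Qed.

Lemma elationD p v w : null p -> plane p v -> plane p w ->
  (elation p v * elation p w)%g = elation p (v + w).
Proof.
move=> np pv pw; apply/permP => x.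
rewrite permM !elationE ?plane_addP // omulDl !omulDr.
suff -> : p ** (w ** (p ** (v ** x))) = 0 by rewrite addr0 -addrA.
have [c E] := plane_mul np pw pv.
have [[_ _ tw] [pw0 _ _]] := (planeP pw, planeP pw).
rewrite (flag_mul F4 x np pv) omulDr !omulZr E.
rewrite (omulC0 (null_otr np) tw pw0) omulDr !omulZr null_sqr //.
by rewrite omul0r !scaler0 addr0.
Qed.

Lemma elation_comm p v w : null p -> plane p v -> plane p w ->
  commute (elation p v) (elation p w).
Proof. by move=> np pv pw; rewrite /commute !elationD // addrC. Qed.

Lemma elation1 p : null p -> elation p 0 = 1%g.
Proof.
move=> np; apply/eqP/elation_eq1 => //; first by rewrite /plane !omul0r eqxx.
by exists 0; rewrite scale0r.
Qed.

Lemma elation_sqr p v : null p -> plane p v -> (elation p v * elation p v = 1)%g.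
Proof. by move=> np pv; rewrite elationD // addxx // elation1. Qed.

Lemma elationV p v : null p -> plane p v -> (elation p v)^-1%g = elation p v.
Proof. by move=> np pv; apply/eqP; rewrite eq_invg_mul elation_sqr. Qed.

Lemma elation_inj p v w : null p -> plane p v -> plane p w ->
  elation p v = elation p w <-> exists c, w = v + c *: p.
Proof.
move=> np pv pw; split=> [E | [c ->]].
  have : elation p (v + w) == 1%g by rewrite -elationD // -E elation_sqr.
  case/(elation_eq1 F4 np (plane_addP np pv pw)) => c Ec.
  by exists c; rewrite -Ec addrA addxx ?add0r.
rewrite -elationD ?plane_pp //.
have -> : elation p (c *: p) = 1%g.
  by apply/eqP/elation_eq1; rewrite ?plane_pp //; exists c.
by rewrite mulg1.
Qed.

End Planes.

(** * Short circuits of the hexagon, and the holonomy of an ordinary hexagon *)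

Section Polygons.
Variables (F : finFieldType) (Z : zorn_algebra F).
Hypothesis F4 : #|F| = 4%N.
Implicit Types (x y z p q r u v w : Z) (c d : F) (s : {perm Z}).

Lemma null_planeE p q : null p -> null q -> p ** q = 0 -> plane p q.
Proof. by move=> np nq pq; rewrite /plane pq null_sqr // eqxx. Qed.

Lemma null_mulC p q : null p -> null q -> p ** q = 0 -> q ** p = 0.
Proof. by move=> np nq; apply: omulC0; apply: null_otr. Qed.

Lemma path_mul r1 r2 r3 : null r1 -> null r2 -> null r3 ->
  r1 ** r2 = 0 -> r2 ** r3 = 0 -> exists d, r1 ** r3 = d *: r2.
Proof.
move=> n1 n2 n3 r12 r23; apply: plane_mul => //; apply: null_planeE => //.
exact: null_mulC.
Qed.

(** If the trace vanished, m = r1 ** r4 would be 0 or null. If m = 0, then r1 ** r3 is a multiple of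
    both r2 and r4, against r2 ** r4 != 0. Otherwise m is annihilated by r3 and r4, hence lies on
    <r3, r4>; multiplying by r1, which kills m, shows that m is a multiple of r2, and m ** r4 = 0
    gives the same contradiction. *)
Lemma opposite_otr r1 r2 r3 r4 :
  null r1 -> null r2 -> null r3 -> null r4 ->
  r1 ** r2 = 0 -> r2 ** r3 = 0 -> r3 ** r4 = 0 ->
  r1 ** r3 != 0 -> r2 ** r4 != 0 -> otr (r1 ** r4) != 0.
Proof.
move=> n1 n2 n3 n4 r12 r23 r34 r13 r24; apply/eqP => t14.
have [d2 E2] := path_mul n1 n2 n3 r12 r23.
have [d3 E3] := path_mul n2 n3 n4 r23 r34.
have d20 : d2 != 0 by apply: contraNneq r13 => d0; rewrite E2 d0 scale0r.
pose m := r1 ** r4.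
have r3m : r3 ** m = 0.
  have := omul_altl_lin r1 r3 r4; rewrite r34 omul0r add0r -/m => ->.
  rewrite (omul_anticomm (null_otr n1) (null_otr n3)) E2 otrZ null_otr //.
  by rewrite mulr0 scale0r omul0l.
have r1m : r1 ** m = 0 by rewrite omul_altl null_sqr // omul0l.
have mr4 : m ** r4 = 0 by rewrite omul_altr null_sqr // omul0r.
have [m0 | m0] := eqVneq m 0.
  have n41 := null_mulC n1 n4 m0.
  have [d] := path_mul n1 n4 n3 m0 (null_mulC n3 n4 r34).
  rewrite E2 => Ed; case/eqP: r24.
  have <- : d2^-1 *: (d2 *: r2) = r2 by rewrite scalerA mulVf // scale1r.
  by rewrite Ed !omulZl null_sqr // !scaler0.
have [_ mm] := null_mul_sqr n1 t14.
have nm : null m by rewrite /null m0 /m mm eqxx.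
have pl3m : plane r3 m by apply: null_planeE.
have pl34 : plane r3 r4 by apply: null_planeE.
have r4m : r4 ** m = 0 by apply: null_mulC.
have [[c Ec] | [a [b Em]]] := plane_dep F4 n3 pl34 pl3m r4m.
  by case/eqP: r24; rewrite Ec omulZr r23 scaler0.
have /eqP : r1 ** m = 0 by [].
rewrite Em omulDr !omulZr E2 -/m scalerA addr_eq0 => /eqP E.
have [b0 | b0] := eqVneq b 0.
  move/eqP: E; rewrite b0 scale0r oppr0 scaler_eq0 (negPf (null_neq0 n2)) orbF.
  rewrite mulf_eq0 (negPf d20) orbF => /eqP a0.
  by move: m0; rewrite Em a0 b0 !scale0r addr0 eqxx.
have Em2 : m = (- b^-1 * (a * d2)) *: r2.
  apply: (scalerI b0); rewrite -[LHS]opprK -E scalerA mulrA mulrN mulfV //.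
  by rewrite mulN1r scaleNr.
move/eqP: mr4; rewrite Em2 omulZl scaler_eq0 (negPf r24) orbF => /eqP c0.
by move: m0; rewrite Em2 c0 scale0r eqxx.
Qed.

(** By associativity of the trace, otr (r1 ** (r3 ** r5)) is d4, d2 or d6 times the trace of an
    opposite pair, and otr (r2 ** (r4 ** r6)) is d1, d5 or d3 times the same three traces.
    Multiplying the three expressions gives the cube of a non-zero element of F_4, which is 1, in
    both cases. *)
Lemma hexagon_holonomy r1 r2 r3 r4 r5 r6 d1 d2 d3 d4 d5 d6 :
  null r1 -> null r2 -> null r3 -> null r4 -> null r5 -> null r6 ->
  [/\ r1 ** r2 = 0, r2 ** r3 = 0 & r3 ** r4 = 0] ->
  [/\ r4 ** r5 = 0, r5 ** r6 = 0 & r6 ** r1 = 0] ->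
  [/\ r6 ** r2 = d1 *: r1, r1 ** r3 = d2 *: r2 & r2 ** r4 = d3 *: r3] ->
  [/\ r3 ** r5 = d4 *: r4, r4 ** r6 = d5 *: r5 & r5 ** r1 = d6 *: r6] ->
  [/\ d1 != 0, d2 != 0 & d3 != 0] -> [/\ d4 != 0, d5 != 0 & d6 != 0] ->
  d1 * d3 * d5 = d2 * d4 * d6.
Proof.
move=> n1 n2 n3 n4 n5 n6 [r12 r23 r34] [r45 r56 r61] [E1 E2 E3] [E4 E5 E6].
move=> [d10 d20 d30] [d40 d50 d60].
have nz r d : null r -> d != 0 -> d *: r != 0.
  by move=> /null_neq0 r0 d0; rewrite scaler_eq0 negb_or d0.
have B14 : otr (r1 ** r4) != 0.
  by apply: (opposite_otr n1 n2 n3 n4); rewrite ?E2 ?E3 ?nz.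
have B25 : otr (r2 ** r5) != 0.
  by apply: (opposite_otr n2 n3 n4 n5); rewrite ?E3 ?E4 ?nz.
have B36 : otr (r3 ** r6) != 0.
  by apply: (opposite_otr n3 n4 n5 n6); rewrite ?E4 ?E5 ?nz.
pose t := otr (r1 ** (r3 ** r5)); pose t' := otr (r2 ** (r4 ** r6)).
have T1 : t = d4 * otr (r1 ** r4) by rewrite /t E4 omulZr otrZ.
have T2 : t = d2 * otr (r2 ** r5) by rewrite /t -otrA E2 omulZl otrZ.
have T3 : t = d6 * otr (r3 ** r6).
  by rewrite /t otrC otrA -[RHS]otrZ -omulZr -E6.
have T1' : t' = d5 * otr (r2 ** r5) by rewrite /t' E5 omulZr otrZ.
have T2' : t' = d3 * otr (r3 ** r6) by rewrite /t' -otrA E3 omulZl otrZ.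
have T3' : t' = d1 * otr (r1 ** r4).
  by rewrite /t' otrC otrA -[RHS]otrZ -omulZl -E1 otrC.
have t3 : t ^+ 3 = 1 by apply: F4_cube; rewrite // T1 mulf_neq0.
have t'3 : t' ^+ 3 = 1 by apply: F4_cube; rewrite // T1' mulf_neq0.
pose B := otr (r1 ** r4) * otr (r2 ** r5) * otr (r3 ** r6).
have B0 : B != 0 by rewrite !mulf_neq0.
apply: (mulIf B0); transitivity (t' ^+ 3).
  by rewrite [in RHS]exprS expr2 {1}T3' {1}T2' T1' /B; ring.
by rewrite t'3 -t3 [in LHS]exprS expr2 {1}T2 {1}T1 T3 /B; ring.
Qed.

End Polygons.

(** * Stars, their intersections, and commuting long root elements *)

Section Stars.
Variables (F : finFieldType) (Z : zorn_algebra F).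
Hypothesis F4 : #|F| = 4%N.
Implicit Types (p q r u v w m : Z) (a b c d : F) (s x y : {perm Z}).
Local Notation A := (zorn_aut_group Z).

Definition star p : {set {perm Z}} :=
  [set x | (x != 1%g) && [exists v, plane p v && (x == elation p v)]].

Definition long_roots : {set {perm Z}} :=
  [set x | [exists p, null p && (x \in star p)]].

Lemma starP p x :
  reflect (exists v, [/\ plane p v, x = elation p v & x != 1%g]) (x \in star p).
Proof.
rewrite inE; apply: (iffP andP) => [[x1 /existsP[v /andP[pv /eqP Ex]]] | ].
  by exists v.
by case=> v [pv Ex x1]; split=> //; apply/existsP; exists v; rewrite pv Ex eqxx.
Qed.

Lemma long_rootsP x : reflect (exists2 p, null p & x \in star p) (x \in long_roots).
Proof.
rewrite inE; apply: (iffP existsP) => [[p /andP[np xp]] | [p np xp]]; exists p => //.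
by rewrite np.
Qed.

Lemma elation_neq0 p v : null p -> plane p v -> elation p v != 1%g -> null v.
Proof.
move=> np pv nt; have v0 : v != 0.
  by apply: contraNneq nt => ->; rewrite elation1 // eqxx.
by have /andP[] := plane_sym np v0 pv.
Qed.

Lemma elation_nt p v c : null p -> plane p v -> elation p v != 1%g -> v <> c *: p.
Proof. by move=> np pv /negP nt E; case: nt; apply/(elation_eq1 F4 np pv); exists c. Qed.

(** For y with otr (q ** y) = 0 and otr (w ** y) = 1 the displacement under [elation q w] is q
    itself, while under [elation p v] it lies in the span of p and v. *)
Lemma elation_span p v q w : null p -> plane p v -> null q -> plane q w ->
  elation p v = elation q w -> elation p v != 1%g ->
  exists a b, q = a *: p + b *: v.
Proof.
move=> np pv nq qw E nt.
have [c | y qy wy] := @otr_sep F Z q w.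
  by apply: elation_nt => //; rewrite -E.
exists (otr (v ** y)), (otr (p ** y)).
have := congr1 (fun s : {perm Z} => s y) E; rewrite /= !elationE //.
move/addrI; rewrite (flag_mul F4 y np pv) (flag_mul F4 y nq qw) qy wy.
by rewrite scale1r scale0r addr0.
Qed.

(** Any point m of the line <p, v> can take over the role of p: for b = 0 this is a rescaling, and
    otherwise m replaces v modulo p and is then exchanged with p by [elationC]. *)
Lemma elation_repoint p v a b (m := a *: p + b *: v) : null p -> plane p v ->
  elation p v != 1%g -> m != 0 ->
  null m /\ exists a' b', let w := a' *: p + b' *: v in
    plane m w /\ elation p v = elation m w.
Proof.
move=> np pv nt m0; have nv := elation_neq0 np pv nt.
have [pv0 vv tv] := planeP pv.
have pm : plane p m by apply: plane_addP => //; rewrite ?plane_pp ?planeZ.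
have [_ mm _] := planeP pm; have nm : null m by rewrite /null m0 mm eqxx.
split=> //; have [b0 | b0] := eqVneq b 0.
  have a0 : a != 0.
    by apply: contraNneq m0 => a0; rewrite /m a0 b0 !scale0r addr0 eqxx.
  exists 0, a^-1; rewrite /= scale0r add0r.
  have -> : m = a *: p by rewrite /m b0 scale0r addr0.
  split; first by rewrite planeZl ?planeZ.
  by rewrite elationZ ?planeZ // scalerA mulfV // scale1r.
exists b^-1, 0; rewrite /= scale0r addr0.
have pmp : plane m p by have /andP[] := plane_sym np m0 pm.
split; first exact: planeZ.
rewrite -elationZ ?invr_eq0 //.
have nbm : null (b^-1 *: m) by rewrite nullZ ?invr_eq0.
rewrite (elationC F4 nbm np) ?planeZl //.
apply/elation_inj; rewrite ?planeZ //.
exists (b^-1 * a).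
by rewrite /m scalerDr !scalerA mulVf // scale1r addrC.
Qed.

Lemma star_repoint p v a b : null p -> plane p v -> elation p v != 1%g ->
  a *: p + b *: v != 0 -> elation p v \in star (a *: p + b *: v).
Proof.
move=> np pv nt m0; have [nm [a' [b' [pw E]]]] := elation_repoint np pv nt m0.
by apply/starP; eexists; split; [exact: pw | exact: E | ].
Qed.

Lemma star_meet p q x : null p -> null q -> x \in star p -> x \in star q ->
  (exists c, q = c *: p) \/ (p ** q = 0 /\ exists c, x = elation p (c *: q)).
Proof.
move=> np nq /starP[v [pv -> nt]] /starP[w [qw E _]].
have [a [b Eq]] := elation_span np pv nq qw E nt.
have [b0 | b0] := eqVneq b 0.
  by left; exists a; rewrite Eq b0 scale0r addr0.
have [pv0 _ _] := planeP pv.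
right; split; first by rewrite Eq omulDr !omulZr pv0 null_sqr // !scaler0 addr0.
exists b^-1; apply/elation_inj => //.
  apply/planeZ/null_planeE => //.
  by rewrite Eq omulDr !omulZr pv0 null_sqr // !scaler0 addr0.
by exists (b^-1 * a); rewrite Eq scalerDr !scalerA mulVf // scale1r addrC.
Qed.

Lemma star_line p q c : null p -> null q -> p ** q = 0 ->
  elation p (c *: q) != 1%g ->
  elation p (c *: q) \in star p /\ elation p (c *: q) \in star q.
Proof.
move=> np nq pq nt; have pl : plane p (c *: q) by apply/planeZ/null_planeE.
split; first by apply/starP; exists (c *: q).
have c0 : c != 0.
  by apply: contraNneq nt => ->; rewrite scale0r elation1 // eqxx.
have := @star_repoint p (c *: q) 0 c^-1 np pl nt.
rewrite scale0r add0r scalerA mulVf // scale1r; apply; exact: null_neq0.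
Qed.

Lemma starZ p c : c != 0 -> null p -> star (c *: p) = star p.
Proof.
move=> c0 np; apply/setP => x; apply/starP/starP => -[v [pv Ex nt]].
  exists (c *: v); have pv' : plane p v.
    by rewrite -[p]scale1r -(mulVf c0) -scalerA planeZl.
  by rewrite planeZ // -elationZ.
exists (c^-1 *: v); rewrite planeZl ?planeZ // elationZ ?planeZ //.
by rewrite scalerA mulfV // scale1r.
Qed.

Lemma starJ s p x : s \in zorn_aut Z -> null p -> x \in star p ->
  (x ^ s)%g \in star (s p).
Proof.
move=> sA np /starP[v [pv -> nt]]; apply/starP; exists (s v).
by rewrite aut_plane // elationJ // -elationJ // conjg_eq1.
Qed.

Lemma elation_star p v : plane p v -> (elation p v \in star p) = (elation p v != 1%g).
Proof.
by move=> pv; apply/starP/idP => [[w []]| nt] //; exists v.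
Qed.

Lemma frame_nt p v w : null p -> frame p v w ->
  elation p v != 1%g /\ elation p w != 1%g.
Proof.
move=> np [pv pw vw _]; have [[pv0 _ tv] [pw0 _ tw]] := (planeP pv, planeP pw).
split; apply/(elation_eq1 F4 np); rewrite // => -[c E].
  by have := null_neq0 np; rewrite -vw E omulZl pw0 scaler0 eqxx.
have := null_neq0 np; rewrite -vw E omulZr (omulC0 (null_otr np) tv pv0).
by rewrite scaler0 eqxx.
Qed.

(** For a frame v, w the point <q> lies on both lines <p, v> and <p, w>, which meet in <p>. *)
Lemma star_inj p q : null p -> null q -> star p = star q -> exists c, q = c *: p.
Proof.
move=> np nq E; have [v [w fr]] := frame_exists F4 np.
have [ntv ntw] := frame_nt np fr; have wv := frameC F4 np fr.
case: fr => pv pw vw _.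
have vq : elation p v \in star q by rewrite -E elation_star.
have wq : elation p w \in star q by rewrite -E elation_star.
have [v' [qv' Ev _]] := starP _ _ vq; have [w' [qw' Ew _]] := starP _ _ wq.
have [a [b Eq]] := elation_span np pv nq qv' Ev ntv.
have [a' [b' Eq']] := elation_span np pw nq qw' Ew ntw.
have [[pv0 vv tv] [pw0 ww tw]] := (planeP pv, planeP pw).
have : q ** v = b' *: p by rewrite Eq' omulDl !omulZl pv0 wv scaler0 add0r.
rewrite {1}Eq omulDl !omulZl pv0 vv !scaler0 addr0 => /esym/eqP.
rewrite scaler_eq0 (negPf (null_neq0 np)) orbF => /eqP b'0.
by exists a'; rewrite Eq' b'0 scale0r addr0.
Qed.

(** Let x and y be the elations of (p, q) and (r, s). As x centralises y, it preserves the span of r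
    and s. If it moves r or s, the displacement is a common point of the two lines, and its star
    contains x and y. Otherwise r and s have trace product 0 with p and q, and [opposite_otr]
    applied to chains between the two lines forces a coincidence: at once if p ** r = 0, and else
    after replacing p by the point p ** r, which turns out to lie on <p, q>. *)
Lemma commuting_concurrent x y : x \in long_roots -> y \in long_roots -> commute x y ->
  exists p, [/\ null p, x \in star p & y \in star p].
Proof.
have collinear_case p q r (s : Z) : null p -> null r -> plane p q -> plane r s ->
    elation p q != 1%g -> elation r s != 1%g -> p ** r = 0 -> otr (q ** s) = 0 ->
    exists m, [/\ null m, elation p q \in star m & elation r s \in star m].
  move=> np nr pq rs nt nt' pr tqs.
  have [nq ns] := (elation_neq0 np pq nt, elation_neq0 nr rs nt').
  have [[pq0 _ _] [rs0 _ _]] := (planeP pq, planeP rs).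
  have [qr | qr] := eqVneq (q ** r) 0.
    have [[c Ec] | [a [b Er]]] := plane_dep F4 np pq (null_planeE np nr pr) qr.
      by case: (@elation_nt p q c).
    exists r; rewrite nr elation_star // nt'; split=> //.
    by rewrite Er star_repoint // -Er null_neq0.
  have [ps | ps] := eqVneq (p ** s) 0.
    have sp := null_mulC np ns ps; have rp := null_mulC np nr pr.
    have [[c Ec] | [a [b Er]]] := plane_dep F4 nr rs (null_planeE nr np rp) sp.
      by case: (@elation_nt r s c).
    exists p; rewrite np elation_star // nt; split=> //.
    by rewrite Er star_repoint // -Er null_neq0.
  have := opposite_otr F4 nq np nr ns (null_mulC np nq pq0) pr rs0 qr ps.
  by rewrite tqs eqxx.
move=> /long_rootsP[p np /starP[q [pq -> nt]]] /long_rootsP[r nr /starP[s [rs -> nt']]] xy.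
have xA : elation p q \in zorn_aut Z by exact: elation_aut.
have fixed : elation r s = elation (elation p q r) (elation p q s).
  by rewrite -elationJ // conjgE -xy mulKg.
have [[pq0 qq tq] [rs0 ss ts]] := (planeP pq, planeP rs).
have nq := elation_neq0 np pq nt; have ns := elation_neq0 nr rs nt'.
have shared u : null u -> (exists a b, u = a *: r + b *: s) ->
    (exists a b, elation p q u = a *: r + b *: s) ->
    otr (q ** u) *: p + otr (p ** u) *: q != 0 ->
    exists m, [/\ null m, elation p q \in star m & elation r s \in star m].
  move=> nu [a [b Eu]] [a' [b' Eu']] m0.
  have Em : otr (q ** u) *: p + otr (p ** u) *: q =
            (a' + a) *: r + (b' + b) *: s.
    rewrite !scalerDl addrACA -Eu -Eu' elationE // flag_mul //.
    by rewrite addrC addrA addxx // add0r.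
  have [nm _] := elation_repoint np pq nt m0.
  by exists (otr (q ** u) *: p + otr (p ** u) *: q); rewrite nm star_repoint // Em star_repoint // -Em.
have nind a b : a *: p + b *: q = 0 -> a = 0 /\ b = 0.
  move=> /eqP; rewrite addrC addr_eq0 => /eqP E.
  have b0 : b = 0.
    apply/eqP; apply: contraT => b0; case: (@elation_nt p q (- (b^-1 * a)) np pq nt).
    apply: (scalerI b0); rewrite E scalerA mulrN mulrA mulfV // mul1r scaleNr //.
  split=> //; move/eqP: E; rewrite b0 scale0r eq_sym oppr_eq0 scaler_eq0.
  by rewrite (negPf (null_neq0 np)) orbF => /eqP.
have nxr : null (elation p q r) by apply: aut_null.
have nxs : null (elation p q s) by apply: aut_null.
have pxs : plane (elation p q r) (elation p q s) by apply: aut_plane.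
have xr := elation_span nr rs nxr pxs fixed nt'.
have xs : exists a b, elation p q s = a *: r + b *: s.
  apply: (elation_span nr rs nxs _ _ nt').
    by have /andP[_ +] := plane_sym nxr (null_neq0 nxs) pxs; apply.
  by rewrite fixed elationC.
have [r0 | /(shared r nr) H] :=
    eqVneq (otr (q ** r) *: p + otr (p ** r) *: q) 0; last first.
  by apply: H => //; exists 1, 0; rewrite scale1r scale0r addr0.
have [s0 | /(shared s ns) H] :=
    eqVneq (otr (q ** s) *: p + otr (p ** s) *: q) 0; last first.
  by apply: H => //; exists 0, 1; rewrite scale1r scale0r add0r.
have [[tqr tpr] [tqs tps]] := (nind _ _ r0, nind _ _ s0).
have [pr | pr] := eqVneq (p ** r) 0; first exact: collinear_case.
have [pm mm] := null_mul_sqr np tpr.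
have nm : null (p ** r) by rewrite /null pr mm eqxx.
have mr : (p ** r) ** r = 0 by rewrite omul_altr null_sqr // omul0r.
have [qm | qm] := eqVneq (q ** (p ** r)) 0; last first.
  have := opposite_otr F4 nq np nm nr (null_mulC np nq pq0) pm mr qm pr.
  by rewrite tqr eqxx.
have [[c Ec] | [a [b Em]]] := plane_dep F4 np pq (null_planeE np nm pm) qm.
  by case: (@elation_nt p q c).
have m0 := null_neq0 nm; rewrite Em in m0.
have [_ [a' [b' [pw E]]]] := elation_repoint np pq nt m0.
rewrite E; apply: collinear_case => //; rewrite -?E -?Em //.
by rewrite omulDl !omulZl otrD !otrZ tps tqs !mulr0 addr0.
Qed.

End Stars.

(** * Conjugacy of frames and the field automorphism *)

Section FrameTransitivity.
Variables (F : finFieldType) (Z : zorn_algebra F).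
Hypothesis F4 : #|F| = 4%N.
Implicit Types (p q r u v w m : Z) (a b c d : F) (s x y : {perm Z}).
Local Notation A := (zorn_aut_group Z).
Local Notation e1 := (oct Z 0 1 0 0 0 0 0 0).
Local Notation e2 := (oct Z 0 0 1 0 0 0 0 0).
Local Notation e3 := (oct Z 0 0 0 1 0 0 0 0).
Local Notation f1 := (oct Z 0 0 0 0 1 0 0 0).
Local Notation f2 := (oct Z 0 0 0 0 0 1 0 0).
Local Notation f3 := (oct Z 0 0 0 0 0 0 1 0).

(** The matrix (a b; c d) acts on the f2, f3 coordinates of the plane of e1. These automorphisms
    come from the SL_2 in a Levi factor of the stabiliser of <e1>. *)
Definition levi a b c d := exists s : {perm Z},
  [/\ s \in zorn_aut Z, s e1 = e1 & forall k x y : F,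
    s (oct Z 0 k 0 0 0 x y 0) =
    oct Z 0 k 0 0 0 (a * x + b * y) (c * x + d * y) 0].

Lemma leviM a b c d a' b' c' d' : levi a b c d -> levi a' b' c' d' ->
  levi (a' * a + b' * c) (a' * b + b' * d) (c' * a + d' * c) (c' * b + d' * d).
Proof.
move=> [s [sA s1 sE]] [t [tA t1 tE]]; exists (s * t)%g; split.
- exact: (groupM (G := A)).
- by rewrite permM s1.
by move=> k x y; rewrite permM sE tE; congr oct; ring.
Qed.

Lemma levi_upper t : levi 1 t 0 1.
Proof.
have [[n1 n2 n3] m1 m2 m3] := null_units Z.
have pl : plane e3 (t *: f2).
  by rewrite /plane !octE !zeros !oct_eq0 ?subrr !eqxx.
exists (elation e3 (t *: f2)); split; first exact: elation_aut.
  by rewrite elationE // !octE; congr oct; ring.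
move=> k x y; rewrite elationE // !octE !zeros; congr oct; try ring.
by rewrite F4_opp.
Qed.

Lemma levi_lower t : levi 1 0 t 1.
Proof.
have [[n1 n2 n3] m1 m2 m3] := null_units Z.
have pl : plane e2 (t *: f3).
  by rewrite /plane !octE !zeros !oct_eq0 ?subrr !eqxx.
exists (elation e2 (t *: f3)); split; first exact: elation_aut.
  by rewrite elationE // !octE; congr oct; ring.
move=> k x y; rewrite elationE // !octE !zeros; congr oct; try ring.
by rewrite !F4_opp // addrC.
Qed.

Lemma levi_SL2 a b c d : a * d - b * c = 1 -> levi a b c d.
Proof.
have main a' b' c' d' : c' != 0 -> a' * d' - b' * c' = 1 -> levi a' b' c' d'.
  (* For a non-zero lower left entry the matrix is upper(x) lower(c') upper(y), with x and y read
     off from the diagonal. *)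
  move=> c0 det; pose x := (a' - 1) / c'; pose y := (d' - 1) / c'.
  have Ea : x * c' = a' - 1 by rewrite divfK.
  have Ed : y * c' = d' - 1 by rewrite divfK.
  have := leviM (leviM (levi_upper y) (levi_lower c')) (levi_upper x).
  rewrite !(mul1r, mulr1, mul0r, mulr0, addr0, add0r).
  have -> : 1 + x * c' = a' by rewrite Ea; ring.
  have -> : c' * y + 1 = d' by rewrite mulrC Ed; ring.
  suff -> : y + x * d' = b' by [].
  apply: (mulIf c0); rewrite mulrDl Ed mulrAC Ea.
  have -> : b' * c' = a' * d' - 1 by rewrite -det; ring.
  by ring.
move=> det; have [c0 | c0] := eqVneq c 0; last exact: main.
have a0 : a != 0.
  by apply: contra_eqN det => /eqP->; rewrite c0 mul0r mulr0 subrr eq_sym oner_eq0.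
(* Adding the first row to the second makes the lower left entry a, which is not 0; in
   characteristic 2 the same row operation undoes it. *)
have h : levi a b a (b + d) by apply: main; rewrite // -det c0; ring.
have := leviM h (levi_lower 1).
rewrite !(mul1r, mulr1, mul0r, mulr0, addr0, add0r) F4_addxx // addrA.
by rewrite F4_addxx // add0r c0.
Qed.

(** Once p is moved to e1, the product v ** w = p says that the f-coordinates of the images of v and
    w have determinant 1, so [levi_SL2] supplies the inverse matrix. The e1-components remain, but
    elations do not see them. *)
Lemma frame_transitive p v w : null p -> plane p v -> plane p w -> v ** w = p ->
  exists s, [/\ s \in zorn_aut Z, s p = e1, exists k, s v = f3 + k *: e1
              & exists k, s w = f2 + k *: e1].
Proof.
move=> np pv pw vw; have := null_transitive F4 np.
rewrite orbit_sym => /orbitP[s sA]; rewrite /= apermE => sp.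
have [_ _ _ span] := frame_e1 Z.
have [|c [y [x Ev]]] := span (s v); first by rewrite -sp aut_plane.
have [|c' [y' [x' Ew]]] := span (s w); first by rewrite -sp aut_plane.
have det : y * x' - y' * x = 1.
  have := autM v w sA; rewrite vw sp Ev Ew !octE !zeros.
  by move=> /oct_inj[[_ E _ _] _ _ _ _]; rewrite E; ring.
have [|t [tA t1 tE]] := @levi_SL2 y (- x) (- y') x'.
  by rewrite -det; ring.
exists (s * t)%g; rewrite !permM sp Ev Ew; split=> //.
- exact: (groupM (G := A)).
- exists c; have := tE c x y; rewrite !octE !zeros => ->; congr oct; try ring.
  by rewrite -det; ring.
exists c'; have := tE c' x' y'; rewrite !octE !zeros => ->; congr oct; try ring.
by rewrite -det; ring.
Qed.

Lemma plane_complement p v : null p -> plane p v -> elation p v != 1%g ->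
  exists2 w, plane p w & v ** w = p.
Proof.
move=> np pv nt; have [v0 [w0 fr]] := frame_exists F4 np.
case: (fr) => pv0 pw0 _ sp; have [c [a [b Ev]]] := sp v pv.
have E a' b' : v ** (a' *: v0 + b' *: w0) = (a * b' + b * a') *: p.
  by rewrite Ev -(frame_mul F4 c a b 0 a' b' np fr) scale0r add0r.
have [a0 | a0] := eqVneq a 0; last first.
  exists (0 *: v0 + a^-1 *: w0); first by rewrite plane_addP ?planeZ.
  by rewrite E mulfV // mulr0 addr0 scale1r.
have [b0 | b0] := eqVneq b 0; last first.
  exists (b^-1 *: v0 + 0 *: w0); first by rewrite plane_addP ?planeZ.
  by rewrite E mulfV // mulr0 add0r scale1r.
case: (@elation_nt _ Z F4 p v c np pv nt).
by rewrite Ev a0 b0 !scale0r !addr0.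
Qed.

Lemma long_roots_class x : x \in long_roots Z ->
  exists2 s, s \in zorn_aut Z & (x ^ s)%g = elation e1 f3.
Proof.
case/long_rootsP => p np /starP[v [pv -> nt]].
have [w pw vw] := plane_complement np pv nt.
have [s [sA sp [k sv] _]] := frame_transitive np pv pw vw.
exists s => //; rewrite elationJ // sp sv.
have [pf3 _ _ _] := frame_e1 Z; have [[n1 _ _] _ _ _] := null_units Z.
apply/esym/elation_inj => //; last by exists k.
by apply: plane_addP => //; apply: plane_pp.
Qed.

(** The structure constants of the Zorn product lie in the prime field, so squaring all coordinates
    is a ring automorphism. It will exchange the two elements of F_4 outside F_2 as values of the
    form on a star. *)
Lemma frobenius_aut : exists2 s : {perm Z}, s \in zorn_aut Z &
  forall a u1 u2 u3 v1 v2 v3 b : F, s (oct Z a u1 u2 u3 v1 v2 v3 b) =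
    oct Z (a ^+ 2) (u1 ^+ 2) (u2 ^+ 2) (u3 ^+ 2)
          (v1 ^+ 2) (v2 ^+ 2) (v3 ^+ 2) (b ^+ 2).
Proof.
pose P (z y : Z) := exists a u1 u2 u3 v1 v2 v3 b : F,
  z = oct Z a u1 u2 u3 v1 v2 v3 b /\
  y = oct Z (a ^+ 2) (u1 ^+ 2) (u2 ^+ 2) (u3 ^+ 2)
            (v1 ^+ 2) (v2 ^+ 2) (v3 ^+ 2) (b ^+ 2).
(* On the abstract carrier coordinates exist only propositionally, so the map is obtained by choice
   and its formula recovered from [oct_inj]. *)
have [|f fP] := @fin_all_exists Z (fun=> Z) P.
  move=> z; have [a [u1 [u2 [u3 [v1 [v2 [v3 [b ->]]]]]]]] := octW z.
  by eexists; exists a, u1, u2, u3, v1, v2, v3, b.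
have fE (a u1 u2 u3 v1 v2 v3 b : F) : f (oct Z a u1 u2 u3 v1 v2 v3 b) =
    oct Z (a ^+ 2) (u1 ^+ 2) (u2 ^+ 2) (u3 ^+ 2)
          (v1 ^+ 2) (v2 ^+ 2) (v3 ^+ 2) (b ^+ 2).
  have [a' [x1 [x2 [x3 [y1 [y2 [y3 [b' [/oct_inj E ->]]]]]]]]] :=
    fP (oct Z a u1 u2 u3 v1 v2 v3 b).
  by case: E => -[-> -> -> ->] -> -> -> ->.
have fK : involutive f.
  move=> z; to_coords z; rewrite !fE -!exprM.
  by rewrite !F4_pow4.
exists (perm (inv_inj fK)); last by move=> *; rewrite permE fE.
have sqrD (a b : F) : (a + b) ^+ 2 = a ^+ 2 + b ^+ 2.
  by rewrite sqrrD mulr2n F4_addxx // addr0.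
have sqrN (a : F) : (- a) ^+ 2 = - a ^+ 2 by rewrite sqrrN F4_opp.
apply/zorn_autP => z y; to_coords z; to_coords y; rewrite !permE.
by rewrite !octE !fE !octE !(sqrD, sqrN, exprMn).
Qed.

End FrameTransitivity.

(** * Star groups and the common centraliser of those on one line *)

Section StarGroup.
Variables (F : finFieldType) (Z : zorn_algebra F).
Hypothesis F4 : #|F| = 4%N.
Implicit Types (p q r u v w m : Z) (a b c d : F) (s x y : {perm Z}).
Local Notation A := (zorn_aut_group Z).

Definition star_group p : {group {perm Z}} := <<star p>>%G.

Lemma star_groupP p x : null p ->
  reflect (exists2 v, plane p v & x = elation p v) (x \in star_group p).
Proof.
move=> np; set S := [set x | [exists v, plane p v && (x == elation p v)]].
have SP y : reflect (exists2 v, plane p v & y = elation p v) (y \in S).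
  rewrite inE; apply: (iffP existsP) => [[v /andP[pv /eqP ->]] | [v pv ->]].
    by exists v.
  by exists v; rewrite pv eqxx.
have gS : group_set S.
  apply/group_setP; split.
    by apply/SP; exists 0; rewrite ?elation1 // /plane !omul0r eqxx.
  move=> y z /SP[v pv ->] /SP[w pw ->]; apply/SP.
  by exists (v + w); rewrite ?elationD ?plane_addP.
suff -> : (star_group p : {set _}) = Group gS by exact: SP.
apply/eqP; rewrite eqEsubset gen_subG; apply/andP; split.
  by apply/subsetP => y /starP[v [pv -> _]]; apply/SP; exists v.
apply/subsetP => y /SP[v pv ->].
have [-> | nt] := eqVneq (elation p v) 1%g; first exact: group1.
by rewrite mem_gen ?elation_star.
Qed.

Lemma star_group_2 p : null p -> 2.-group%g (star_group p).
Proof.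
move=> np; apply/pgroupP => l l_pr /Cauchy[] // x.
case/star_groupP=> // v pv -> ol.
have : (#[elation p v]%g %| 2)%N by rewrite order_dvdn expgS expg1 elation_sqr.
by rewrite ol dvdn_prime2 // => /eqP->.
Qed.

Lemma star_group_sub p : null p -> star_group p \subset zorn_aut Z.
Proof.
by move=> np; apply/subsetP => x /star_groupP[// | v pv ->]; apply: elation_aut.
Qed.

(** The elations at q fix the vector p, because q annihilates their displacements of p down to
    multiples of q ** q = 0, and so they permute the elations at p. This serves to build a large
    2-group. *)
Lemma star_group_norm p q : null p -> null q -> p ** q = 0 ->
  star_group q \subset 'N(star_group p)%g.
Proof.
move=> np nq pq; have qp := null_mulC np nq pq.
have pl := null_planeE nq np qp.
apply/subsetP => x /star_groupP[// | v qv ->]; rewrite inE.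
have sA : elation q v \in zorn_aut Z by exact: elation_aut.
have sp : elation q v p = p.
  rewrite elationE //; have [c ->] := plane_mul F4 nq qv pl.
  by rewrite omulZr null_sqr // scaler0 addr0.
apply/subsetP => y; rewrite mem_conjg => /star_groupP[// | w pw E].
rewrite -(conjgKV (elation q v) y) {}E elationJ // sp.
by apply/star_groupP => //; exists (elation q v w); rewrite // -{1}sp aut_plane.
Qed.

End StarGroup.

Section Centralizer.
Variables (F : finFieldType) (Z : zorn_algebra F).
Hypothesis F4 : #|F| = 4%N.
Implicit Types (p q r u v w m : Z) (a b c d : F) (s x y : {perm Z}).
Local Notation A := (zorn_aut_group Z).
Local Notation e1 := (oct Z 0 1 0 0 0 0 0 0).
Local Notation e2 := (oct Z 0 0 1 0 0 0 0 0).
Local Notation e3 := (oct Z 0 0 0 1 0 0 0 0).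
Local Notation f1 := (oct Z 0 0 0 0 1 0 0 0).
Local Notation f2 := (oct Z 0 0 0 0 0 1 0 0).
Local Notation f3 := (oct Z 0 0 0 0 0 0 1 0).
Local Notation rt t := (oct Z 0 1 0 0 0 0 t 0).

Lemma null_rt (t : F) : null (rt t).
Proof. by rewrite /null !octE !zeros !oct_eq0 oner_eq0 !eqxx !andbF. Qed.

Lemma F4_omega : exists2 t : F, t != 0 & t != 1.
Proof.
apply/exists_inP; apply: contraT; rewrite negb_exists_in => /forall_inP H.
suff : (#|F| <= #|[:: (0 : F)%R; 1%R]|)%N.
  by rewrite F4 => /leq_trans/(_ (card_size _)).
apply/subset_leq_card/subsetP => t _; rewrite !inE.
by have [//|/H] := eqVneq t 0; rewrite negbK orbC => ->.
Qed.

Lemma centralizes_star_point s p : s \in zorn_aut Z -> null p ->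
  s \in 'C(star_group p)%g -> exists c, s p = c *: p.
Proof.
move=> sA np /centP cs; apply: (star_inj F4) => //; first exact: aut_null.
apply/setP => x; apply/idP/idP => xs.
  by have := starJ F4 sA np xs; rewrite conjgE -(cs x (mem_gen xs)) mulKg.
have sVA : (s^-1)%g \in zorn_aut Z by rewrite groupV.
have := starJ F4 sVA (aut_null sA np) xs; rewrite permK => xs'.
rewrite -[x](conjgKV s) [in X in X \in _]conjgE.
by rewrite -(cs _ (mem_gen xs')) mulKg.
Qed.

Lemma centralizes_star_plane s p v c : s \in zorn_aut Z -> null p ->
  s \in 'C(star_group p)%g -> s p = c *: p -> plane p v ->
  exists d, c *: s v = v + d *: p.
Proof.
move=> sA np /centP cs sp pv.
have c0 : c != 0.
  apply: contraTneq (null_neq0 (aut_null sA np)) => c0.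
  by rewrite sp c0 scale0r eqxx.
have : (elation p v ^ s)%g = elation p v.
  rewrite conjgE -cs ?mulKg //; apply/star_groupP => //; by exists v.
have psv : plane p (s v).
  rewrite -(scale1r p) -(mulVf c0) -scalerA -sp.
  by apply: planeZl; apply: aut_plane.
rewrite elationJ // sp elationZ //.
move/esym/(elation_inj F4 np pv) => -[]; rewrite ?planeZ // => d Ed.
by exists d.
Qed.

(* The points of the line <e1, f3> are represented by f3 and the [rt t]; their
   planes together span its orthogonal, on which an automorphism that centralizes
   the four star groups must be trivial because the points f2, e2 and
   [oct t 0 (t^2) 0 0 1 0 t] of the quotient lie on a conic. *)
Lemma centralizes_line_stars s (t : F) : t != 0 -> t != 1 -> s \in zorn_aut Z ->
  s \in 'C(star_group (rt 0%R))%g -> s \in 'C(star_group f3)%g ->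
  s \in 'C(star_group (rt 1%R))%g -> s \in 'C(star_group (rt t))%g ->
  exists c, s = elation e1 (c *: f3).
Proof.
move=> t0 t1 sA c0 c3 c1 ct; have [[n1 n2 n3] m1 m2 m3] := null_units Z.
have [[a1 E1] [a3 E3]] := (centralizes_star_point sA n1 c0,
                           centralizes_star_point sA m3 c3).
have [b1 Eb1] := centralizes_star_point sA (null_rt 1) c1.
have r1 : rt 1 = e1 + f3 by rewrite octD !zeros.
have [a1b1 a3b1] : a1 = b1 /\ a3 = b1.
  move: Eb1; rewrite {1}r1 autD // E1 E3 !octE !zeros.
  by move=> /oct_inj[[_ -> _ _] _ _ -> _].
have pl13 c : plane e1 (c *: f3).
  by rewrite /plane !octE !zeros !oct_eq0 ?subrr ?eqxx.
(* The scalars on e1 and f3 agree because the point of e1 + f3 is fixed too. Centralising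
   [elation e1 f3] gives a1 ^ 2 = 1, and a1 ^ 3 = 1 in F_4 leaves a1 = 1. *)
have sqr1 : a1 * a1 = 1.
  have := pl13 1; rewrite scale1r => pl.
  have [d] := centralizes_star_plane sA n1 c0 E1 pl.
  rewrite E3 a3b1 -a1b1 scalerA !octE !zeros.
  by move=> /oct_inj[_ _ _ -> _].
have a1_1 : a1 = 1.
  have := F4_cube F4 (_ : a1 != 0); rewrite exprS expr2 sqr1 mulr1; apply.
  by apply: contra_eqN sqr1 => /eqP->; rewrite mul0r eq_sym oner_eq0.
move: E1 E3; rewrite a3b1 -a1b1 a1_1 !scale1r => E1 E3.
have plane1 p v : null p -> s \in 'C(star_group p)%g -> s p = p ->
    plane p v -> exists d, s v = v + d *: p.
  move=> np cp sp pv.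
  have [|d] := @centralizes_star_plane s p v 1 sA np cp _ pv.
    by rewrite scale1r.
  by rewrite scale1r; exists d.
have sZ c v : s (c *: v) = c *: s v.
  have [c' Ec] := aut_semilinear c sA; rewrite Ec; congr (_ *: _).
  have [d] := plane1 _ _ n1 c0 E1 (pl13 c).
  rewrite Ec E3 !octE !zeros.
  by move=> /oct_inj[_ _ _ -> _].
have [al Eal] : exists d, s f2 = f2 + d *: e1.
  by apply: plane1 => //; rewrite /plane !octE !zeros !oct_eq0 ?subrr ?eqxx.
have [be Ebe] : exists d, s e2 = e2 + d *: f3.
  by apply: plane1 => //; rewrite /plane !octE !zeros !oct_eq0 ?subrr ?eqxx.
have s1 : s (oct Z 1 0 0 0 0 0 0 1) = oct Z 1 0 0 0 0 0 0 1.
  have one (x : Z) : oct Z 1 0 0 0 0 0 0 1 ** x = x by have := oct_scal 1 x; rewrite !scale1r.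
  have one' (x : Z) : x ** oct Z 1 0 0 0 0 0 0 1 = x by have := oct_scalC 1 x; rewrite !scale1r.
  rewrite -[LHS]one' -[X in _ ** X](permKV s) -autM // one permKV.
  by [].
have conic c : null (rt c) -> s \in 'C(star_group (rt c))%g -> c ^+ 2 * be = c * al.
  move=> nc cc; have Ec : rt c = e1 + c *: f3 by rewrite !octE !zeros.
  have sc : s (rt c) = rt c by rewrite Ec autD // sZ E1 E3.
  have pl : plane (rt c) (oct Z c 0 (c ^+ 2) 0 0 1 0 c).
    rewrite /plane !octE !zeros !oct_eq0 expr2.
    by rewrite ?subrr ?F4_addxx ?F4_opp // ?F4_addxx ?eqxx.
  have [d] := plane1 _ _ nc cc sc pl.
  have -> : oct Z c 0 (c ^+ 2) 0 0 1 0 c =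
      c *: oct Z 1 0 0 0 0 0 0 1 + c ^+ 2 *: e2 + f2.
    by rewrite !octE !zeros.
  rewrite !autD // !sZ s1 Ebe Eal !octE !zeros.
  by move=> /oct_inj[[_ -> _ _] _ _ -> _]; rewrite mulrC.
have be_al : be = al.
  by have := conic 1 (null_rt 1) c1; rewrite expr1n !mul1r.
have be0 : be = 0.
  have := conic t (null_rt t) ct; rewrite -be_al expr2 -mulrA => /(mulfI t0).
  move=> /eqP; rewrite -subr_eq0 -{2}[be]mul1r -mulrBl mulf_eq0 subr_eq0.
  by rewrite (negPf t1) => /eqP.
rewrite -be_al be0 !scale0r !addr0 in Ebe Eal.
move: Ebe Eal => E2 Ef2.
have sM (x y z w : Z) : x ** y = z -> s x = x -> s z = z -> s y = w -> x ** w = z.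
  by move=> <- sx + <-; rewrite autM // sx.
pose eps := oct Z 0 0 0 0 0 0 0 1.
have seps : s eps = eps.
  have E : f2 ** e2 = eps by rewrite octM !zeros.
  by rewrite -E autM // Ef2 E2.
(* The products of the fixed vectors e1, f2 and f3 with e3 are themselves fixed by s; this
   determines every coordinate of [s e3] except the one at e1. *)
have [c Ec] : exists c, s e3 = e3 + c *: e1.
  have [a [u1 [u2 [u3 [v1 [v2 [v3 [b Es]]]]]]]] := octW (s e3).
  have := sM e1 e3 (- f2) _ _ E1 _ Es; have := sM f2 e3 0 _ _ Ef2 _ Es.
  have := sM f3 e3 eps _ _ E3 _ Es; rewrite /eps.
  rewrite seps oct0 !octE !zeros.
  move=> /(_ erefl erefl)/oct_inj[[_ Hv2 _ _] _ _ Ha Hu3].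
  rewrite -oct0 aut0 // => /(_ erefl erefl).
  rewrite oct0 => /oct_inj[[_ Hv3 _ _] _ _ _ Hu2].
  have sNf2 : s (oct Z 0 0 0 0 0 (-1) 0 0) = oct Z 0 0 0 0 0 (-1) 0 0.
    have -> : oct Z 0 0 0 0 0 (-1) 0 0 = -1 *: f2 by rewrite octZ !zeros.
    by rewrite sZ Ef2.
  move=> /(_ erefl sNf2)/oct_inj[[Hv1 Hb _ _] _ _ _ _]; exists u1.
  move: Hv2 Hv3; rewrite !F4_opp // => Hv2 Hv3.
  by rewrite Es !octE !zeros Ha Hu2 Hu3 Hv1 Hv2 Hv3 Hb.
have Ef1 : s f1 = f1 + c *: f3.
  have E : e2 ** e3 = f1 by rewrite octM !zeros.
  by rewrite -{1}E autM // E2 Ec !octE !zeros F4_opp.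
exists c; apply/permP => x; rewrite elationE //; to_coords x.
have -> : oct Z a u u0 u1 v v0 v1 b =
    a *: oct Z 1 0 0 0 0 0 0 1 + (b - a) *: eps + u *: e1 + u0 *: e2 +
    u1 *: e3 + v *: f1 + v0 *: f2 + v1 *: f3.
  by rewrite !octE !zeros addrCA subrr addr0.
rewrite !autD // !sZ s1 seps E1 E2 Ec Ef1 Ef2 E3.
rewrite !octE !zeros; congr oct; first by rewrite mulrC.
by rewrite F4_opp // addrC mulrC.
Qed.

End Centralizer.

(** * The numbers of null octonions, stars and long root elements *)

Section Counting.
Variables (F : finFieldType) (Z : zorn_algebra F).
Hypothesis F4 : #|F| = 4%N.
Implicit Types (p q r v w m : Z) (a b c d : F) (s x y : {perm Z}).
Local Notation A := (zorn_aut_group Z).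

Definition null_set : {set Z} := [set p | null p].
Definition star_set : {set {set {perm Z}}} := [set star p | p in null_set].

(** The quadric equation determines a from u and v, the square root in F_4 being squaring, which
    leaves 4 ^ 6 - 1 vectors. *)
Lemma card_null_set : #|null_set| = 4095%N.
Proof.
pose T := (F * F * F * F * F * F)%type.
pose h (t : T) := let: (u1, u2, u3, v1, v2, v3) := t in
  let a := (u1 * v1 + u2 * v2 + u3 * v3) ^+ 2 in oct Z a u1 u2 u3 v1 v2 v3 a.
have hI : injective h.
  move=> [[[[[u1 u2] u3] v1] v2] v3] [[[[[w1 w2] w3] z1] z2] z3].
  by move=> /oct_inj[[_ -> -> ->] -> -> -> _].
have h0 : h (0, 0, 0, 0, 0, 0) = 0 by rewrite /h !mul0r !addr0 expr0n -oct0.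
have -> : null_set = (h @: setT) :\ 0.
  apply/setP => p; rewrite !inE /null; apply: andb_id2l => p0.
  apply/idP/imsetP => [pp | [t _ ->]].
    have np : null p by rewrite /null p0.
    move: np {p0 pp}; to_coords p => np; have [-> E] := null_coords F4 np.
    exists (u, u0, u1, v, v0, v1) => //=.
    by rewrite -E -exprM F4_pow4.
  case: t => -[[[[u1 u2] u3] v1] v2] v3; rewrite /h octM oct_eq0.
  set S := u1 * v1 + u2 * v2 + u3 * v3.
  have SS : S ^+ 2 * S ^+ 2 = S by rewrite -exprD F4_pow4.
  have -> : v1 * u1 + v2 * u2 + v3 * u3 = S by rewrite /S; ring.
  rewrite SS F4_addxx // !(mulrC (S ^+ 2)) !F4_addxx //.
  rewrite (mulrC v3 v2) (mulrC v3 v1) (mulrC v2 v1).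
  by rewrite (mulrC u3 u2) (mulrC u3 u1) (mulrC u2 u1) !subrr !addr0 !eqxx.
have := cardsD1 (0 : Z) (h @: setT); rewrite card_imset // cardsT !card_prod F4.
have -> : 0 \in h @: setT by apply/imsetP; exists (0, 0, 0, 0, 0, 0).
by move=> E; apply: (@addnI 1); rewrite -E.
Qed.

Lemma scaler_null_inj p c d : null p -> c *: p = d *: p -> c = d.
Proof.
move=> /null_neq0 p0 /eqP; rewrite -subr_eq0 -scalerBl scaler_eq0 (negPf p0).
by rewrite orbF subr_eq0 => /eqP.
Qed.

Lemma card_F_nonzero : #|[set c : F | c != 0]| = 3%N.
Proof.
have := cardsD1 (0 : F) setT; rewrite cardsT F4 inE => -[E].
by rewrite E; apply: eq_card => c; rewrite !inE andbT.
Qed.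

Lemma card_star_set : #|star_set| = 1365%N.
Proof.
have := @card_fibres _ _ (@star F Z) null_set 3; rewrite card_null_set -/star_set => H.
apply/eqP; rewrite -(@eqn_pmul2r 3) // -H // => {H} p; rewrite inE => np.
rewrite -card_F_nonzero -(@card_imset _ _ (fun c => c *: p)); last first.
  by move=> c d; apply: scaler_null_inj.
apply: eq_card => q; rewrite !inE; apply/andP/imsetP => [[nq /eqP E] | [c]].
  have [c Ec] := star_inj F4 np nq (esym E); exists c => //; rewrite inE.
  by apply: contraNneq (null_neq0 nq) => c0; rewrite Ec c0 scale0r.
by rewrite inE => c0 ->; rewrite nullZ // starZ // eqxx.
Qed.

(* Coordinates on a star: by [frame_mul] the product of two elements of the
   plane is the determinant of their coordinates. *)
Definition frame_elation (v w : Z) p (t : F * F) := elation p (t.1 *: v + t.2 *: w).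

Lemma frame_plane p v w a b : null p -> frame p v w -> plane p (a *: v + b *: w).
Proof. by move=> np [pv pw _ _]; rewrite plane_addP ?planeZ. Qed.

Lemma frame_mul0 p v w a b a' b' : null p -> frame p v w ->
  (a *: v + b *: w) ** (a' *: v + b' *: w) = (a * b' + b * a') *: p.
Proof.
move=> np fr; have := frame_mul F4 0 a b 0 a' b' np fr.
by rewrite scale0r !add0r.
Qed.

Lemma frame_elation_inj p v w : null p -> frame p v w ->
  injective (frame_elation v w p).
Proof.
move=> np fr [a b] [a' b']; rewrite /frame_elation /=.
move/(elation_inj F4 np (frame_plane _ _ np fr)).
move=> /(_ (frame_plane _ _ np fr))[c Ec].
have E (x y : F) : (x *: v + y *: w) ** (a' *: v + b' *: w) =
             (x *: v + y *: w) ** (a *: v + b *: w).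
  rewrite Ec omulDr omulZr.
  have [+ _ _] := planeP (frame_plane x y np fr).
  have [_ _ t] := planeP (frame_plane x y np fr).
  by move/(omulC0 (null_otr np) t) => ->; rewrite scaler0 addr0.
have := E 1 0; have := E 0 1; do 4!rewrite (frame_mul0 _ _ _ _ np fr).
move=> /(scaler_null_inj np) + /(scaler_null_inj np).
by rewrite !mul1r !mul0r !addr0 !add0r => -> ->.
Qed.

Lemma frame_elation_onto p v w x : null p -> frame p v w ->
  reflect (exists t, x = frame_elation v w p t) (x \in star_group p).
Proof.
move=> np fr; apply: (iffP (star_groupP F4 _ np)) => [[u pu ->] | [t ->]].
  case: (fr) => pv pw _ /(_ u pu)[c [a [b Eu]]]; exists (a, b).
  have [_ E] := elation_inj F4 np (frame_plane a b np fr) pu.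
  by apply/esym/E; exists c; rewrite Eu [RHS]addrC addrA.
by exists (t.1 *: v + t.2 *: w) => //; apply: frame_plane.
Qed.

Lemma star_groupD1 p : null p -> star p = (star_group p :\ 1%g).
Proof.
move=> np; apply/setP => x; rewrite in_setD1.
apply/starP/andP => [[v [pv -> nt]] | [nt /(star_groupP F4 _ np)[v pv Ex]]].
  by split=> //; apply/star_groupP => //; exists v.
by exists v.
Qed.

Lemma card_star_group p : null p -> #|star_group p| = 16%N.
Proof.
move=> np; have [v [w fr]] := frame_exists F4 np.
transitivity #|frame_elation v w p @: setT|.
  apply: eq_card => x; apply/(frame_elation_onto x np fr)/imsetP => -[t].
    by exists t.
  by move=> _ ->; exists t.
rewrite card_imset; last exact: frame_elation_inj.
by rewrite cardsT card_prod F4.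
Qed.

Lemma card_star p : null p -> #|star p| = 15%N.
Proof.
move=> np; have := cardsD1 1%g (star_group p).
by rewrite card_star_group // group1 -star_groupD1 // => -[].
Qed.

Lemma long_roots_line p v q : null p -> plane p v -> elation p v != 1%g ->
  null q -> elation p v \in star q <-> exists2 t : F * F,
    t != (0, 0) & q = t.1 *: p + t.2 *: v.
Proof.
move=> np pv nt nq; split=> [/starP[w [qw E _]] | [[a b] /= _ Eq]].
  have [a [b Eq]] := elation_span F4 np pv nq qw E nt; exists (a, b) => //.
  apply: contraNneq (null_neq0 nq) => -[a0 b0].
  by rewrite Eq a0 b0 !scale0r addr0.
by rewrite Eq star_repoint // -Eq null_neq0.
Qed.

Lemma flag_indep p v a b : null p -> plane p v -> elation p v != 1%g ->
  a *: p + b *: v = 0 -> a = 0 /\ b = 0.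
Proof.
move=> np pv nt /eqP; rewrite addrC addr_eq0 oppx // => /eqP E.
have b0 : b = 0.
  apply/eqP; apply: contraT => b0.
  case: (@elation_nt _ Z F4 p v (b^-1 * a) np pv nt).
  by apply: (scalerI b0); rewrite E scalerA mulrA mulfV // mul1r.
split=> //; move/eqP: E; rewrite b0 scale0r eq_sym scaler_eq0.
by rewrite (negPf (null_neq0 np)) orbF => /eqP.
Qed.

(** The stars through [elation p v] are those of the five points <v> and <p + c v> of the line <p,
    v>. *)
Lemma card_stars_on x : x \in long_roots Z ->
  #|[set P in star_set | x \in P]| = 5%N.
Proof.
case/long_rootsP => p np /starP[v [pv -> nt]].
have nv := elation_neq0 F4 np pv nt.
have nc c : null (p + c *: v).
  have [|] := @elation_repoint _ Z F4 p v 1 c np pv nt; last by rewrite scale1r.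
  rewrite scale1r; apply/eqP => E.
  have [] := @flag_indep p v 1 c np pv nt; first by rewrite scale1r.
  by move/eqP; rewrite oner_eq0.
have inj : injective (fun c => star (p + c *: v)).
  move=> c d /(star_inj F4 (nc c) (nc d))[k]; rewrite scalerDr scalerA => E.
  have [] := @flag_indep p v (1 + k) (d + k * c) np pv nt.
    by rewrite !scalerDl scale1r addrACA E addxx.
  move/eqP; rewrite addr_eq0 F4_opp // => /eqP <-; rewrite mul1r.
  by move/eqP; rewrite addr_eq0 F4_opp // => /eqP.
rewrite (_ : [set P in _ | _] = star v |: [set star (p + c *: v) | c in F]).
  rewrite cardsU1 card_imset // F4 (_ : _ \notin _) //.
  apply/imsetP => -[c _ /(star_inj F4 nv (nc c))[k E]].
  have [] := @flag_indep p v 1 (c + k) np pv nt.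
    by rewrite scale1r scalerDl addrA E addxx.
  by move/eqP; rewrite oner_eq0.
apply/setP => P; rewrite !inE; apply/andP/orP => [[/imsetP[q + ->]] | ].
  rewrite inE => nq /(long_roots_line np pv nt nq)[[a b] /= ab0 Eq].
  have [a0 | a0] := eqVneq a 0.
    left; rewrite Eq a0 scale0r add0r starZ //.
    by apply: contraNneq ab0 => b0; rewrite a0 b0.
  right; apply/imsetP; exists (a^-1 * b) => //.
  by rewrite -(starZ F4 a0 (nc _)) scalerDr scalerA mulrA mulfV // mul1r -Eq.
case=> [/eqP -> | /imsetP[c _ ->]].
  split; first by apply: imset_f; rewrite inE.
  by apply/(long_roots_line np pv nt nv); exists (0, 1); rewrite ?scale0r ?scale1r ?add0r //=; apply/eqP => -[/eqP]; rewrite oner_eq0.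
split; first by apply: imset_f; rewrite inE.
apply/(long_roots_line np pv nt (nc c)); exists (1, c); rewrite ?scale1r //.
by apply/eqP => -[/eqP]; rewrite oner_eq0.
Qed.

(** There are 1365 stars of 15 elements and 5 stars through each element, hence 1365 * 15 / 5
    elements. The oddness of this number matters for centrality. *)
Lemma card_long_roots : #|long_roots Z| = 4095%N.
Proof.
have := @double_count _ _ (long_roots Z) star_set (fun x P => x \in P) 5 15.
rewrite card_star_set => H; apply/eqP; rewrite -(@eqn_pmul2r 5) // H //.
  exact: card_stars_on.
move=> P /imsetP[p]; rewrite inE => np ->; rewrite -(card_star np).
apply: eq_card => x; rewrite inE; apply: andb_idl => xp.
by apply/long_rootsP; exists p.
Qed.

End Counting.

(** * Identification of the central involutions *)

Section Central.
Variables (F : finFieldType) (Z : zorn_algebra F).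
Hypothesis F4 : #|F| = 4%N.
Implicit Types (p q r v w m : Z) (a b c d t : F) (s x y : {perm Z}).
Local Notation A := (zorn_aut_group Z).
Local Notation e1 := (oct Z 0 1 0 0 0 0 0 0).
Local Notation f2 := (oct Z 0 0 0 0 0 1 0 0).
Local Notation f3 := (oct Z 0 0 0 0 0 0 1 0).
Local Notation rt t := (oct Z 0 1 0 0 0 0 t 0).

Lemma long_rootsJ s x : s \in zorn_aut Z -> x \in long_roots Z ->
  (x ^ s)%g \in long_roots Z.
Proof.
move=> sA /long_rootsP[p np xp]; apply/long_rootsP; exists (s p).
  exact: aut_null.
exact: starJ.
Qed.

Lemma long_roots_sub x : x \in long_roots Z -> x \in zorn_aut Z.
Proof. by case/long_rootsP=> p np /starP[v [pv -> _]]; apply: elation_aut. Qed.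

Lemma long_roots_conj x : x \in long_roots Z -> (x ^: A)%g = long_roots Z.
Proof.
move=> xr; apply/setP => y; apply/imsetP/idP => [[s sA ->] | yr].
  exact: long_rootsJ.
have [s sA Es] := long_roots_class F4 xr; have [t tA Et] := long_roots_class F4 yr.
exists (s * t^-1)%g; first by rewrite groupM ?groupV.
by rewrite conjgM Es -Et conjgK.
Qed.

Lemma long_roots_order x : x \in long_roots Z -> #[x]%g = 2.
Proof.
case/long_rootsP => p np /starP[v [pv -> nt]]; apply: nt_prime_order => //.
by rewrite expgS expg1 elation_sqr.
Qed.

Lemma pgroup_joinr (gT : finGroupType) (H K : {group gT}) :
  2.-group%g H -> 2.-group%g K -> (K \subset 'N(H))%g -> 2.-group%g (H <*> K)%G.
Proof. by move=> gH gK nHK; rewrite /= norm_joinEr // pgroupM gH. Qed.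

(** The long root elements form one class, of odd size. Conversely, a 2-group acting on an odd class
    fixes some y in it; for the group generated by the star groups of four points of one line,
    [centralizes_line_stars] makes y an element of the root group of that line. *)
Lemma central_involutions_aut :
  central_involutions (zorn_aut_group Z) = long_roots Z.
Proof.
apply/setP => x; apply/central_involutionP/idP => [[xA x2 odd_x] | xr]; last first.
  split; [exact: long_roots_sub | exact: long_roots_order |].
  by rewrite long_roots_conj // card_long_roots.
have [[n1 _ _] _ _ n3] := null_units Z; have [t t0 t1] := F4_omega F4.
(* Each of these star groups normalises the join of the preceding ones, the four points being
   pairwise collinear; hence the join is a 2-group. *)
pose T0 : {group _} := (((star_group e1 <*> star_group f3) <*>
  star_group (rt 1%R)) <*> star_group (rt t))%G.
have [nr1 nrt] := (null_rt Z 1, null_rt Z t).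
have mul0 c d e : e1 ** rt c = 0 /\ f3 ** rt c = 0 /\ rt d ** rt e = 0.
  by rewrite !octE !zeros ?subrr -!oct0.
have [[m1 [m2 _]] [m3 [m4 m5]]] := (mul0 t 0 0, mul0 1 1 t).
have T0_2 : 2.-group%g T0.
  have e1f3 : e1 ** f3 = 0 by rewrite octM !zeros ?subrr -oct0.
  apply: pgroup_joinr; [apply: pgroup_joinr; [apply: pgroup_joinr | |] | |];
    try exact: star_group_2.
  - exact: star_group_norm.
  - by apply: normsY; apply: star_group_norm.
  by apply: normsY; [apply: normsY|]; apply: star_group_norm.
have T0A : T0 \subset A.
  by rewrite !join_subG !star_group_sub.
have acts : [acts T0, on (x ^: A)%g | 'J].
  by rewrite astabsJ (subset_trans T0A) // class_norm.
have := pgroup_fix_mod T0_2 acts; rewrite !modn2 odd_x.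
case: (set_0Vmem 'Fix_((x ^: A)%g | 'J)(T0)%g) => [-> | [y]].
  by rewrite cards0.
rewrite inE afixJ => /andP[/imsetP[s sA Ey] cy] _.
have yA : y \in zorn_aut Z by rewrite Ey groupJ.
have [H1 H2 H3 H4] : [/\ y \in 'C(star_group e1)%g, y \in 'C(star_group f3)%g,
   y \in 'C(star_group (rt 1%R))%g & y \in 'C(star_group (rt t))%g].
  by move: cy; rewrite /T0 /= !centY !inE -!andbA => /and4P[].
have [c Ec] := centralizes_line_stars F4 t0 t1 yA H1 H2 H3 H4.
have yr : y \in long_roots Z.
  apply/long_rootsP; exists e1 => //; apply/starP; exists (c *: f3); split=> //.
    by apply: planeZ; have [] := frame_e1 Z.
  have : #[y]%g = 2 by rewrite Ey orderJ.
  by apply: contra_eqN => /eqP->; rewrite order1.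
rewrite -(conjgK s x) -Ey; apply: long_rootsJ => //.
by rewrite groupV.
Qed.

End Central.

(** * Root groups, and the F_4-valued form on a star *)

Section Indices.
Variables (F : finFieldType) (Z : zorn_algebra F).
Hypothesis F4 : #|F| = 4%N.
Implicit Types (p q r v w m : Z) (a b c d t : F) (s x y : {perm Z}).
Local Notation A := (zorn_aut_group Z).
Local Notation e1 := (oct Z 0 1 0 0 0 0 0 0).
Local Notation f2 := (oct Z 0 0 0 0 0 1 0 0).
Local Notation f3 := (oct Z 0 0 0 0 0 0 1 0).

(** The root group of x, of order 4, written without a choice of p and v: the stars through x are
    those of the points of its line, and they have exactly the root group in common. *)
Definition root_line x : {set {perm Z}} :=
  1%g |: \bigcap_(P in star_set Z | x \in P) P.

Lemma star_in_set p : null p -> star p \in star_set Z.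
Proof. by move=> np; apply: imset_f; rewrite inE. Qed.

Lemma root_lineP p v y : null p -> plane p v -> elation p v != 1%g ->
  reflect (exists c, y = elation p (c *: v)) (y \in root_line (elation p v)).
Proof.
move=> np pv nt; have nv := elation_neq0 F4 np pv nt.
have [vp vC] : plane v p /\ elation p v = elation v p.
  by split; [have /andP[] := plane_sym np (null_neq0 nv) pv | exact: elationC].
rewrite in_setU1; apply: (iffP orP) => [[/eqP -> | /bigcapP yP] | [c ->]].
- by exists 0; rewrite scale0r elation1.
- have yp : y \in star p by apply: yP; rewrite star_in_set // elation_star.
  have yv : y \in star v.
    by apply: yP; rewrite star_in_set // vC elation_star // -vC.
  have [[c Ec] | [_ [c Ec]]] := star_meet F4 np nv yp yv; last by exists c.
  by case: (@elation_nt _ Z F4 p v c).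
have [-> | nt'] := eqVneq (elation p (c *: v)) 1%g; [by left | right].
apply/bigcapP => P /andP[/imsetP[q + ->]]; rewrite inE => nq.
move=> /(long_roots_line F4 np pv nt nq)[[a b] ab0 Eq].
have c0 : c != 0 by apply: contraNneq nt' => ->; rewrite scale0r elation1.
apply/long_roots_line; rewrite ?planeZ //; exists (a, b / c); last first.
  by rewrite /= scalerA divfK.
by apply: contraNneq ab0 => -[-> /eqP]; rewrite mulf_eq0 invr_eq0 (negPf c0) orbF => /eqP->.
Qed.

Lemma root_line_id x : x \in long_roots Z -> x \in root_line x.
Proof.
case/long_rootsP => p np /starP[v [pv -> nt]].
by apply/root_lineP => //; exists 1; rewrite scale1r.
Qed.

Lemma root_line_eq x y : x \in long_roots Z -> y \in root_line x -> y != 1%g ->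
  root_line y = root_line x /\ y \in long_roots Z.
Proof.
case/long_rootsP => p np /starP[v [pv -> nt]] /root_lineP[] // c -> nt'.
have c0 : c != 0 by apply: contraNneq nt' => ->; rewrite scale0r elation1.
split; last first.
  by apply/long_rootsP; exists p; rewrite ?elation_star ?planeZ.
apply/setP => z; apply/root_lineP/root_lineP; rewrite ?planeZ // => -[d ->].
  by exists (d * c); rewrite scalerA.
by exists (d / c); rewrite scalerA divfK.
Qed.

Lemma card_root_line x : x \in long_roots Z -> #|root_line x| = 4%N.
Proof.
case/long_rootsP => p np /starP[v [pv -> nt]].
rewrite -F4 -(card_imset (mem F) (_ : injective (fun c => elation p (c *: v)))).
  apply: eq_card => y; apply/root_lineP/imsetP => // -[c].
    by exists c.
  by move=> _ ->; exists c.
move=> c d /(elation_inj F4 np (planeZ c pv) (planeZ d pv))[k E].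
have [] := @flag_indep _ Z F4 p v k (c + d) np pv nt.
  by rewrite scalerDl E (addrA (c *: v)) addxx // add0r addxx.
by move=> _ /eqP; rewrite addr_eq0 F4_opp // => /eqP.
Qed.

Lemma root_line_roots x y : x \in long_roots Z ->
  (y \in long_roots Z) && (root_line y == root_line x) = (y \in root_line x :\ 1%g).
Proof.
move=> xr; rewrite in_setD1; apply/andP/andP => [[yr /eqP <-] | [y1 yx]].
  split; last exact: root_line_id.
  have := long_roots_order F4 yr.
  by apply: contra_eqN => /eqP->; rewrite order1.
by have [-> ->] := root_line_eq xr yx y1.
Qed.

Lemma card_root_lines : #|@root_line @: long_roots Z| = 1365%N.
Proof.
have := @card_fibres _ _ root_line (long_roots Z) 3; rewrite card_long_roots //.
move=> H; apply/eqP; rewrite -(@eqn_pmul2r 3) // -H // => {H} x xr.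
transitivity #|root_line x :\ 1%g|.
  by apply: eq_card => y; rewrite inE root_line_roots.
have := cardsD1 1%g (root_line x); rewrite card_root_line //.
by rewrite in_setU1 eqxx => -[].
Qed.

Lemma root_lineJ s x : s \in zorn_aut Z -> x \in long_roots Z ->
  (root_line x :^ s)%g = root_line (x ^ s)%g.
Proof.
move=> sA xr; apply/eqP; rewrite eqEcard cardJg !card_root_line ?long_rootsJ //.
rewrite leqnn andbT; apply/subsetP => y; rewrite mem_conjg.
rewrite -{2}(conjgKV s y); move: (y ^ s^-1)%g => {}y.
case/long_rootsP: xr => p np /starP[v [pv -> nt]] /root_lineP[] // c ->.
have [c' Ec] := aut_semilinear c sA.
have nt' : elation (s p) (s v) != 1%g by rewrite -elationJ // conjg_eq1.
rewrite !elationJ ?planeZ //; apply/root_lineP; rewrite ?aut_null ?aut_plane //.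
by exists c'; rewrite Ec.
Qed.

Lemma root_lines_conj x : x \in long_roots Z ->
  (root_line x :^: A)%g = @root_line @: long_roots Z.
Proof.
move=> xr; apply/setP => K; apply/imsetP/imsetP => [[s sA ->] | [y yr ->]].
  by exists (x ^ s)%g; rewrite ?long_rootsJ ?root_lineJ.
move: yr; rewrite -(long_roots_conj F4 xr) => /imsetP[s sA ->].
by exists s; rewrite // root_lineJ.
Qed.

(** The F_4-valued form on a star, as a relation. Passing from p to c p divides v and w by c and so
    d by c ^ 3 = 1, so the value is independent of the vector chosen for the point. *)
Definition pairing d x y := [exists p, exists v, exists w,
  [&& null p, plane p v, plane p w, x == elation p v, y == elation p w
    & v ** w == d *: p]].

Lemma pairingP d x y : reflect (exists p v w,
    [/\ null p, plane p v, plane p w & [/\ x = elation p v, y = elation p w &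
        v ** w = d *: p]]) (pairing d x y).
Proof.
apply: (iffP existsP) => [[p /existsP[v /existsP[w]]] | [p [v [w [np pv pw [-> -> E]]]]]].
  by case/and5P=> np pv pw /eqP-> /andP[/eqP-> /eqP E]; exists p, v, w.
by exists p; apply/existsP; exists v; apply/existsP; exists w; rewrite np pv pw E !eqxx.
Qed.

Lemma pairing_elation d p v w : null p -> plane p v -> plane p w ->
  v ** w = d *: p -> pairing d (elation p v) (elation p w).
Proof. by move=> np pv pw E; apply/pairingP; exists p, v, w. Qed.

Lemma pairing_nt d x y : d != 0 -> pairing d x y -> x != 1%g /\ y != 1%g.
Proof.
move=> d0 /pairingP[p [v [w [np pv pw [-> -> E]]]]].
have nz : v ** w != 0 by rewrite E scaler_eq0 negb_or d0 null_neq0.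
have [[pv0 _ tv] [pw0 _ _]] := (planeP pv, planeP pw).
split; apply: contraNneq nz => /eqP/elation_eq1.
  by move=> /(_ F4 np pv)[c ->]; rewrite omulZl pw0 scaler0.
move=> /(_ F4 np pw)[c ->]; rewrite omulZr (omulC0 (null_otr np) tv pv0).
by rewrite scaler0.
Qed.

(** If x and y lie in the stars of two different points, both are in the root group of the line
    joining these, where the form vanishes. For d != 0 the point is therefore unique, and only
    rescaling is left. *)
Lemma pairing_star d p x y : d != 0 -> pairing d x y -> null p ->
  x \in star p -> y \in star p -> exists v w,
  [/\ plane p v, plane p w, x = elation p v, y = elation p w & v ** w = d *: p].
Proof.
move=> d0 xy np xp yp; have [x1 y1] := pairing_nt d0 xy.
case/pairingP: xy => q [v [w [nq qv qw [Ex Ey E]]]].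
have xq : x \in star q by rewrite Ex elation_star // -Ex.
have yq : y \in star q by rewrite Ey elation_star // -Ey.
have [[c Ec] | [qp [c Ec]]] := star_meet F4 nq np xq xp.
  have c0 : c != 0 by apply: contraNneq (null_neq0 np) => c0; rewrite Ec c0 scale0r.
  exists (c^-1 *: v), (c^-1 *: w); rewrite Ec !(planeZl, planeZ) //.
  rewrite !elationZ ?planeZ // !scalerA mulfV // !scale1r; split=> //.
  rewrite omulZl omulZr E !scalerA; congr (_ *: _).
  apply: (mulfI c0); apply: (mulfI c0); rewrite mulrA.
  have := F4_cube F4 c0; rewrite !exprS expr0 mulr1 => c3.
  transitivity (d * (c * c^-1) * (c * c^-1)); first by ring.
  rewrite mulfV // !mulr1; transitivity (c * (c * c) * d); last by ring.
  by rewrite c3 mul1r.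
have [[c' Ec'] | [_ [c' Ec']]] := star_meet F4 nq np yq yp.
  rewrite Ec' in Ec; have: x == 1%g.
    have pcc : plane q (c *: (c' *: q)) by rewrite planeZ ?plane_pp.
    by rewrite Ec; apply/(elation_eq1 F4 nq pcc); exists (c * c'); rewrite scalerA.
  by rewrite (negPf x1).
have pl := null_planeE nq np qp.
have mod_q u k : plane q u -> elation q u = elation q (k *: p) ->
    exists l, u = k *: p + l *: q.
  by move=> qu Eu; apply/(elation_inj F4 nq (planeZ k pl) qu).
have [k Ev] : exists l, v = c *: p + l *: q by apply: mod_q; rewrite -?Ex.
have [k' Ew] : exists l, w = c' *: p + l *: q by apply: mod_q; rewrite -?Ey.
case/eqP: d0; apply: (scaler_null_inj nq); rewrite scale0r -E Ev Ew.
rewrite !(omulDl, omulDr) !(omulZl, omulZr) !null_sqr // qp.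
by rewrite (null_mulC nq np qp) !scaler0 !addr0.
Qed.

Lemma pairing_uniq d d' x y : d != 0 -> pairing d x y -> pairing d' x y -> d = d'.
Proof.
have aux c c' : c != 0 -> c' != 0 -> pairing c x y -> pairing c' x y -> c = c'.
  move=> c0 c'0 xy xy'; have [x1 y1] := pairing_nt c0 xy.
  have [p [v [w [np pv pw [Ex Ey E]]]]] := pairingP _ _ _ xy.
  have xp : x \in star p by rewrite Ex elation_star // -Ex.
  have yp : y \in star p by rewrite Ey elation_star // -Ey.
  have [v' [w' [pv' pw' Ex' Ey' E']]] := pairing_star c'0 xy' np xp yp.
  apply: (scaler_null_inj np); rewrite -E -E'.
  rewrite Ex in Ex'; rewrite Ey in Ey'.
  have [k ->] := (elation_inj F4 np pv pv').1 Ex'.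
  have [l ->] := (elation_inj F4 np pw pw').1 Ey'.
  have [[pv0 _ tv] [pw0 _ _]] := (planeP pv, planeP pw).
  rewrite !(omulDl, omulDr) !(omulZl, omulZr) null_sqr // pw0.
  by rewrite (omulC0 (null_otr np) tv pv0) !scaler0 !addr0.
move=> d0 xy xy'; have [d'0 | d'0] := eqVneq d' 0; last exact: aux.
rewrite d'0 in xy'; have [x1 y1] := pairing_nt d0 xy.
have [p [v [w [np pv pw [Ex Ey]]]]] := pairingP _ _ _ xy'.
rewrite scale0r => E.
have xp : x \in star p by rewrite Ex elation_star // -Ex.
have yp : y \in star p by rewrite Ey elation_star // -Ey.
have [v' [w' [pv' pw' Ex' Ey' E']]] := pairing_star d0 xy np xp yp.
case/eqP: d0; apply: (scaler_null_inj np); rewrite -E' scale0r -E.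
rewrite Ex in Ex'; rewrite Ey in Ey'.
have [k ->] := (elation_inj F4 np pv pv').1 Ex'.
have [l ->] := (elation_inj F4 np pw pw').1 Ey'.
have [[pv0 _ tv] [pw0 _ _]] := (planeP pv, planeP pw).
rewrite !(omulDl, omulDr) !(omulZl, omulZr) null_sqr // pw0.
by rewrite (omulC0 (null_otr np) tv pv0) !scaler0 !addr0.
Qed.

Lemma pairingC d x y : pairing d x y -> pairing d y x.
Proof.
case/pairingP=> p [v [w [np pv pw [-> -> E]]]]; apply: pairing_elation => //.
by rewrite (planeC F4 np).
Qed.

Lemma pairingM d x y : pairing d x y -> pairing d x (x * y)%g.
Proof.
case/pairingP=> p [v [w [np pv pw [-> -> E]]]]; rewrite elationD //.
apply: pairing_elation; rewrite ?plane_addP // omulDr E.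
by have [_ -> _] := planeP pv; rewrite add0r.
Qed.

Definition pairing_set d := [set z : {perm Z} * {perm Z} | pairing d z.1 z.2].

(** The 15 non-zero first vectors each leave an affine line of 4 second vectors. *)
Lemma card_det d : d != 0 ->
  #|[set z : (F * F) * (F * F) | z.1.1 * z.2.2 + z.1.2 * z.2.1 == d]| = 60%N.
Proof.
move=> d0; set D := [set z | _].
have fib (t : F * F) : t != (0, 0) -> #|[set z in D | z.1 == t]| = 4%N.
  case: t => a b t0; rewrite -F4 -cardsT.
  have [a0 | a0] := eqVneq a 0.
    have b0 : b != 0 by apply: contraNneq t0 => ->; rewrite a0.
    rewrite -(card_imset _ (_ : injective (fun c : F => ((a, b), (d / b, c))))).
      apply: eq_card => -[[x y] [z u]]; rewrite !inE /=.
      apply/andP/imsetP => [[/eqP E /eqP[Ex Ey]] | [c _ [-> -> -> ->]]].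
        exists u; rewrite // -E Ex Ey a0 mul0r add0r.
        by rewrite [b * z]mulrC mulfK.
      by rewrite a0 mul0r add0r mulrC divfK // !eqxx.
    by move=> c c' [].
  rewrite -(card_imset _ (_ : injective (fun c : F => ((a, b), (c, (d - b * c) / a))))).
    apply: eq_card => -[[x y] [z u]]; rewrite !inE /=.
    apply/andP/imsetP => [[/eqP E /eqP[Ex Ey]] | [c _ [-> -> -> ->]]].
      exists z; rewrite // -E Ex Ey addrK.
      by rewrite [a * u]mulrC mulfK.
    by rewrite mulrC divfK // subrK !eqxx.
  by move=> c c' [].
have img : (fun z => z.1) @: D = setT :\ (0, 0).
  apply/setP => t; rewrite in_setD1 inE andbT; apply/imsetP/idP => [[z] | t0].
    rewrite inE => E ->; apply: contraTneq E => ->.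
    by rewrite !mul0r addr0 eq_sym.
  have : #|[set z in D | z.1 == t]| != 0%N by rewrite fib.
  by rewrite cards_eq0 => /set0Pn[z]; rewrite inE => /andP[zD /eqP <-]; exists z.
rewrite (@card_fibres _ _ (fun z => z.1) D 4) ?img => [|z zD].
  have := cardsD1 (0 : F, 0 : F) setT; rewrite cardsT card_prod F4 inE => E.
  suff -> : #|setT :\ (0 : F, 0 : F)| = 15%N by [].
  by apply/eqP; rewrite -(eqn_add2l true) -E.
apply: fib; have : z.1 \in (fun z => z.1) @: D by apply: imset_f.
by rewrite img !inE andbT.
Qed.

Lemma card_star_pairings d p : d != 0 -> null p ->
  #|[set z in pairing_set d | (z.1 \in star p) && (z.2 \in star p)]| = 60%N.
Proof.
move=> d0 np; have [v [w fr]] := frame_exists F4 np; rewrite -(card_det d0).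
pose h (z : (F * F) * (F * F)) := (frame_elation v w p z.1, frame_elation v w p z.2).
rewrite -[RHS](card_imset _ (_ : injective h)); last first.
  by case=> t t' [u u'] [/(frame_elation_inj F4 np fr)-> /(frame_elation_inj F4 np fr)->].
have inv (t t' : F * F) : pairing d (frame_elation v w p t) (frame_elation v w p t') =
    (t.1 * t'.2 + t.2 * t'.1 == d).
  have E : pairing (t.1 * t'.2 + t.2 * t'.1)
             (frame_elation v w p t) (frame_elation v w p t').
    apply: pairing_elation => //; try exact: frame_plane.
    exact: frame_mul0.
  by apply/idP/eqP => [E'|<- //]; apply/esym; apply: pairing_uniq E' E.
apply: eq_card => -[x y]; rewrite inE /= [_ \in pairing_set d]inE /=.
apply/andP/imsetP => [[xy /andP[xp yp]] | [[t t']]].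
  have xg : x \in star_group p := mem_gen xp.
  have yg : y \in star_group p := mem_gen yp.
  have [t Et] := frame_elation_onto F4 x np fr xg.
  have [t' Et'] := frame_elation_onto F4 y np fr yg.
  exists (t, t'); last by rewrite Et Et'.
  by rewrite inE /= -inv -Et -Et'.
rewrite inE /= -inv => xy [-> ->]; split=> //.
have [x1 y1] := pairing_nt d0 xy.
by rewrite /frame_elation !elation_star ?x1 ?y1 //; apply: (frame_plane F4).
Qed.

(** A pair with non-zero value lies in exactly one star, so the 60 pairs of each star are counted
    once. *)
Lemma card_pairing_set d : d != 0 -> #|pairing_set d| = (1365 * 60)%N.
Proof.
move=> d0; have := @double_count _ _ (star_set Z) (pairing_set d)
  (fun P z => (z.1 \in P) && (z.2 \in P)) 60 1.
rewrite muln1 card_star_set // => <- //.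
  move=> P /imsetP[p]; rewrite inE => np ->; exact: card_star_pairings.
move=> [x y]; rewrite inE /= => xy; have [x1 y1] := pairing_nt d0 xy.
have [p [v [w [np pv pw [Ex Ey E]]]]] := pairingP _ _ _ xy.
rewrite -(cards1 (star p)); apply: eq_card => P; rewrite !inE.
apply/andP/eqP => [[/imsetP[q + ->]] | ->]; last first.
  by rewrite star_in_set // Ex Ey !elation_star // -Ex -Ey x1 y1.
rewrite inE => nq /andP[xq yq].
have xp : x \in star p by rewrite Ex elation_star // -Ex.
have yp : y \in star p by rewrite Ey elation_star // -Ey.
have [[c Ec] | [pq [c Ec]]] := star_meet F4 np nq xp xq.
  by rewrite Ec starZ //; apply: contraNneq (null_neq0 nq) => c0; rewrite Ec c0 scale0r.
have [[c' Ec'] | [_ [c' Ec']]] := star_meet F4 np nq yp yq.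
  by rewrite Ec' starZ //; apply: contraNneq (null_neq0 nq) => c0; rewrite Ec' c0 scale0r.
have pl := null_planeE np nq pq; have p0 : pairing 0 x y.
  rewrite Ec Ec'; apply: pairing_elation; rewrite ?planeZ //.
  by rewrite omulZl omulZr null_sqr // !scaler0 scale0r.
by case/eqP: (d0); apply: pairing_uniq p0.
Qed.

End Indices.

(** * The four-groups <x, y> and the lengths of their orbits *)

Section Klein.
Variables (gT : finGroupType) (x y : gT).
Hypotheses (xx : (x * x = 1)%g) (yy : (y * y = 1)%g) (xy : commute x y).

Definition klein (x y : gT) : {set gT} := [set 1; x; y; x * y]%g.

Lemma klein_group_set : group_set (klein x y).
Proof.
apply/group_setP; split; first by rewrite !inE eqxx.
have E : (x * y * x = y)%g by rewrite xy -mulgA xx mulg1.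
move=> u v; rewrite !inE -!orbA.
by do 2![case/or4P => /eqP->];
   rewrite ?(mul1g, mulg1, xx, yy, E, mulgA) ?(xx, yy, mul1g, mulg1, eqxx, orbT) //;
   rewrite ?[(y * x)%g]esym ?E ?yy -?xy -?mulgA ?yy ?xx ?mulg1 ?eqxx ?orbT //.
Qed.

Lemma gen_klein : <<[set x; y]>>%g = klein x y.
Proof.
apply/eqP; rewrite eqEsubset; apply/andP; split.
  rewrite (_ : klein x y = Group klein_group_set) // gen_subG.
  by apply/subsetP => z; rewrite !inE => /orP[] /eqP->; rewrite eqxx ?orbT.
apply/subsetP => z; have xK : x \in <<[set x; y]>>%g by rewrite mem_gen // !inE eqxx.
have yK : y \in <<[set x; y]>>%g by rewrite mem_gen // !inE eqxx orbT.
by rewrite !inE -!orbA => /or4P[] /eqP->; rewrite ?group1 ?groupM.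
Qed.

End Klein.

Lemma in_klein (gT : finGroupType) (x y z : gT) :
  (z \in klein x y) = [|| z == 1, z == x, z == y | z == x * y]%g.
Proof. by rewrite !inE -!orbA. Qed.

Lemma kleinJ (gT : finGroupType) (x y s : gT) :
  (klein x y :^ s = klein (x ^ s) (y ^ s))%g.
Proof. by rewrite /klein !conjUg !conjg_set1 conj1g conjMg. Qed.

Section Index.
Variables (F : finFieldType) (Z : zorn_algebra F).
Hypothesis F4 : #|F| = 4%N.
Implicit Types (p q r v w m : Z) (a b c d t : F) (s x y : {perm Z}).
Local Notation A := (zorn_aut_group Z).
Local Notation e1 := (oct Z 0 1 0 0 0 0 0 0).
Local Notation f2 := (oct Z 0 0 0 0 0 1 0 0).
Local Notation f3 := (oct Z 0 0 0 0 0 0 1 0).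

Lemma long_roots_sqr x : x \in long_roots Z -> (x * x = 1)%g.
Proof. by case/long_rootsP=> p np /starP[v [pv -> _]]; apply: elation_sqr. Qed.

Lemma pairing_roots d x y : d != 0 -> pairing d x y ->
  [/\ x \in long_roots Z, y \in long_roots Z & commute x y].
Proof.
move=> d0 xy; have [x1 y1] := pairing_nt F4 d0 xy.
have [p [v [w [np pv pw [Ex Ey _]]]]] := pairingP _ _ _ xy.
split; last by rewrite Ex Ey; apply: elation_comm.
  by apply/long_rootsP; exists p; rewrite // Ex elation_star -?Ex.
by apply/long_rootsP; exists p; rewrite // Ey elation_star -?Ey.
Qed.

Lemma pairing_neq d x y : d != 0 -> pairing d x y -> x != y.
Proof.
move=> d0 xy; apply: contraTneq (d0) => Exy; rewrite -Exy in xy.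
have [p [v [w [np pv pw [Ex _ _]]]]] := pairingP _ _ _ xy.
have p0 : pairing 0 x x.
  by rewrite Ex; apply: pairing_elation => //; rewrite scale0r; have [_ ->] := planeP pv.
by rewrite negbK (pairing_uniq F4 d0 xy p0).
Qed.

Lemma klein_pairs d d' x y x' y' : d != 0 -> d' != 0 -> pairing d x y -> pairing d' x' y' ->
  (klein x' y' == klein x y) = ((x', y') \in
    [:: (x, y); (y, x); (x, x * y)%g; ((x * y)%g, x); (y, x * y)%g; ((x * y)%g, y)]).
Proof.
move=> d0 d'0 xy xy'; have [x1 y1] := pairing_nt F4 d0 xy.
have [x'1 y'1] := pairing_nt F4 d'0 xy'; have xy'n := pairing_neq d'0 xy'.
have [xr yr cxy] := pairing_roots d0 xy.
have [xx yy] := (long_roots_sqr xr, long_roots_sqr yr).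
apply/eqP/idP => [E | ].
  have : x' \in klein x y by rewrite -E !inE eqxx !orbT.
  have : y' \in klein x y by rewrite -E !inE eqxx !orbT.
  rewrite !inE -!orbA (negPf x'1) (negPf y'1) /= !xpair_eqE.
  by move=> /or3P[] /eqP Ey /or3P[] /eqP Ex; move: xy'n;
     rewrite Ex Ey ?eqxx ?orbT ?andbT //= ?orbT.
have xyx : (x * (x * y) = y)%g by rewrite mulgA xx mul1g.
have xyy : (x * y * y = x)%g by rewrite -mulgA yy mulg1.
have yxy : (y * (x * y) = x)%g by rewrite mulgA -cxy xyy.
have xyx' : (x * y * x = y)%g by rewrite cxy -mulgA xx mulg1.
rewrite !inE !xpair_eqE.
case/or4P=> [||| /or3P[]] /andP[/eqP-> /eqP->] //; apply/setP => z;
  rewrite /klein ?xyx ?xyy ?yxy ?xyx' -?cxy !inE -!orbA.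
- by case: (z == 1%g); rewrite //= orbCA.
- by case: (z == 1%g); case: (z == x); rewrite //= orbC.
- by case: (z == 1%g); case: (z == x); case: (z == y); rewrite ?orbT //= orbF.
- by case: (z == 1%g); case: (z == x); case: (z == y); rewrite ?orbT //= ?orbF.
by case: (z == 1%g); case: (z == x); case: (z == y); rewrite ?orbT //= ?orbF.
Qed.

Lemma pairing_klein d x y x' y' : d != 0 -> pairing d x y ->
  (x', y') \in
    [:: (x, y); (y, x); (x, x * y)%g; ((x * y)%g, x); (y, x * y)%g; ((x * y)%g, y)] ->
  pairing d x' y'.
Proof.
move=> d0 xy; have [_ _ cxy] := pairing_roots d0 xy.
have xyM := pairingM F4 xy; have yxM := pairingM F4 (pairingC F4 xy).
rewrite -cxy in yxM; rewrite !inE !xpair_eqE.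
by case/or4P=> [||| /or3P[]] /andP[/eqP-> /eqP->] //; apply: pairingC.
Qed.

Definition kleins d : {set {set {perm Z}}} :=
  (fun z => klein z.1 z.2) @: pairing_set Z d.

(** A four-group has 6 ordered pairs of distinct involutions, and all of them have the same value d;
    hence 1365 * 60 / 6 groups. *)
Lemma card_kleins d : d != 0 -> #|kleins d| = 13650%N.
Proof.
move=> d0; have := @card_fibres _ _ (fun z => klein z.1 z.2) (pairing_set Z d) 6.
rewrite card_pairing_set // -/(kleins d) => H.
have -> : (13650 = 1365 * 10)%N by [].
apply/eqP; rewrite -(@eqn_pmul2r 6) // -H ?mulnA // => {H} -[x y].
rewrite inE /= => xy; have [x1 y1] := pairing_nt F4 d0 xy.
have xny := pairing_neq d0 xy; have [xr yr cxy] := pairing_roots d0 xy.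
pose L := [:: (x, y); (y, x); (x, x * y)%g; ((x * y)%g, x); (y, x * y)%g; ((x * y)%g, y)].
have uL : uniq L.
  have n1 : (x == x * y)%g = false by rewrite -{1}[x]mulg1 (inj_eq (mulgI x)) eq_sym (negPf y1).
  have n2 : (y == x * y)%g = false by rewrite -{1}[y]mul1g (inj_eq (mulIg y)) eq_sym (negPf x1).
  rewrite /L /= !inE !xpair_eqE !(eq_sym (x * y)%g) !n1 !n2 (eq_sym y x) (negPf xny).
  by rewrite ?andbF ?eqxx.
transitivity #|L|; last by rewrite (card_uniqP uL).
apply: eq_card => -[x' y']; rewrite !inE /=.
apply/andP/idP => [[xy' +] | zL].
  by rewrite (klein_pairs d0 d0 xy xy') => H; rewrite /L !inE in H *.
have xy' : pairing d x' y' by apply: (pairing_klein d0 xy); rewrite !inE.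
by rewrite xy' (klein_pairs d0 d0 xy xy') !inE.
Qed.

Lemma pairingJ1 s x y : s \in zorn_aut Z -> pairing 1 x y ->
  pairing 1 (x ^ s)%g (y ^ s)%g.
Proof.
move=> sA /pairingP[p [v [w [np pv pw [-> -> E]]]]]; rewrite !elationJ //.
apply: pairing_elation; rewrite ?aut_null ?aut_plane //.
by rewrite -autM // E !scale1r.
Qed.

(** After dividing w by d, [frame_transitive] applies. Since s is only semilinear, d is replaced by
    its image c under a field automorphism, which respects the value 1. *)
Lemma pairing_normal d x y : d != 0 -> pairing d x y ->
  exists2 s, s \in zorn_aut Z & exists c, [/\ c != 0,
    (c == 1) = (d == 1), (x ^ s)%g = elation e1 f3 & (y ^ s)%g = elation e1 (c *: f2)].
Proof.
move=> d0 xy; have [x1 y1] := pairing_nt F4 d0 xy.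
have [p [v [w [np pv pw [Ex Ey E]]]]] := pairingP _ _ _ xy.
have [|s [sA sp [k sv] [l sw]]] := @frame_transitive _ Z F4 p v (d^-1 *: w) np pv
  (planeZ _ pw) (_ : v ** (d^-1 *: w) = p).
  by rewrite omulZr E scalerA mulVf // scale1r.
exists s => //; have [c Ec] := aut_semilinear d sA; exists c.
have [pf3 pf2 f32 _] := frame_e1 Z; have [[n1 _ _] _ _ _] := null_units Z.
have Exs : (x ^ s)%g = elation e1 f3.
  rewrite Ex elationJ // sp sv; apply/esym/elation_inj => //; last by exists k.
  by apply: plane_addP => //; apply: plane_pp.
have Eys : (y ^ s)%g = elation e1 (c *: f2).
  have -> : y = elation p (d *: (d^-1 *: w)) by rewrite scalerA mulfV // scale1r.
  rewrite elationJ // ?planeZ // sp Ec sw scalerDr scalerA.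
  have pcf : plane e1 (c *: f2) by apply: planeZ.
  apply/esym/elation_inj => //; last by exists (c * l).
  by apply: plane_addP => //; apply: plane_pp.
have c0 : c != 0.
  apply: contraNneq y1 => c0; rewrite -(conjg_eq1 y s) Eys c0 scale0r.
  by rewrite elation1.
have xyc : pairing c (x ^ s)%g (y ^ s)%g.
  rewrite Exs Eys; apply: pairing_elation; rewrite ?planeZ //.
  by rewrite omulZr f32.
split=> //; apply/eqP/eqP => E1.
  have sVA : (s^-1)%g \in zorn_aut Z by rewrite groupV.
  rewrite E1 in xyc; have := pairingJ1 sVA xyc; rewrite !conjgK => xy1.
  exact: pairing_uniq xy xy1.
rewrite E1 in xy; apply: pairing_uniq xyc _ => //; exact: pairingJ1.
Qed.

Lemma kleins_conj1 x y : pairing 1 x y -> (klein x y :^: A)%g = kleins 1.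
Proof.
move=> xy; apply/setP => K; apply/imsetP/imsetP => [[s sA ->] | [[x' y']]].
  by exists (x ^ s, y ^ s)%g; rewrite ?kleinJ // inE /= pairingJ1.
rewrite inE /= => xy' ->.
have one0 : 1 != 0 :> F by apply: oner_neq0.
have [s sA [c [_ + Ex Ey]]] := pairing_normal one0 xy.
rewrite eqxx => /eqP c1.
have [s' sA' [c' [_ + Ex' Ey']]] := pairing_normal one0 xy'.
rewrite eqxx => /eqP c'1.
exists (s * s'^-1)%g; first by rewrite groupM ?groupV.
rewrite c1 in Ey; rewrite c'1 in Ey'.
by rewrite conjsgM kleinJ Ex Ey -Ex' -Ey' -kleinJ conjsgK.
Qed.

Lemma F4_cases c d : c != 0 -> c != 1 -> d != 0 -> d != 1 -> d = c \/ d = c ^+ 2.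
Proof.
move=> c0 c1 d0 d1; have u : uniq [:: 0; 1; c; c ^+ 2].
  rewrite /= !inE !negb_or andbT eq_sym oner_eq0 eq_sym c0 eq_sym sqrf_eq0 c0.
  rewrite eq_sym c1 /=; apply/andP; split.
    apply/eqP => E; have := F4_cube F4 c0; rewrite exprS -E mulr1 => /eqP.
    by rewrite (negPf c1).
  by rewrite expr2 -{1}[c]mulr1 (inj_eq (mulfI c0)) eq_sym.
have /subset_cardP : #|[:: 0; 1; c; c ^+ 2]| = #|F| by rewrite (card_uniqP u) F4.
move=> /(_ (subset_predT _)) /(_ d).
by rewrite !inE (negPf d0) (negPf d1) /= => /orP[] /eqP; [left | right].
Qed.

(** The field automorphism exchanges the two values outside F_2, so the orbit contains two disjoint
    families of 13650 groups. This bound suffices to exclude the indices 1365 and 13650. *)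
Lemma kleins_conj2 d x y : d != 0 -> d != 1 -> pairing d x y ->
  (27300 <= #|(klein x y :^: A)%g|)%N.
Proof.
move=> d0 d1 xy; have [s sA [c [c0 + Ex Ey]]] := pairing_normal d0 xy.
rewrite (negPf d1) => /negbT c1.
have [fr frA frE] := frobenius_aut Z F4.
have [pf3 pf2 _ _] := frame_e1 Z; have [[n1 _ _] _ _ _] := null_units Z.
have fr3 : (elation e1 f3 ^ fr)%g = elation e1 f3.
  by rewrite elationJ // !frE !(expr0n, expr1n).
have fr2 : (elation e1 (c *: f2)%R ^ fr)%g = elation e1 (c ^+ 2 *: f2)%R.
  by rewrite elationJ ?planeZ // !octZ !mulr0 !frE !(expr0n, expr1n, mulr1).
have sub d' : d' != 0 -> d' != 1 -> kleins d' \subset (klein x y :^: A)%g.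
  move=> d'0 d'1; apply/subsetP => K /imsetP[[x' y']]; rewrite inE /= => xy' ->.
  have [s' sA' [c' [c'0 + Ex' Ey']]] := pairing_normal d'0 xy'.
  rewrite (negPf d'1) => /negbT c'1.
  have [Ec | Ec] := F4_cases c0 c1 c'0 c'1.
    apply/imsetP; exists (s * s'^-1)%g; first by rewrite groupM ?groupV.
    by rewrite conjsgM kleinJ Ex Ey -Ec -Ex' -Ey' -kleinJ conjsgK.
  apply/imsetP; exists (s * fr * s'^-1)%g; first by rewrite !(groupM, groupV).
  by rewrite !conjsgM !kleinJ Ex Ey fr3 fr2 -Ec -Ex' -Ey' !conjgK.
have c20 : c ^+ 2 != 0 by rewrite sqrf_eq0.
have c21 : c ^+ 2 != 1.
  apply: contraNneq c1 => E; have := F4_cube F4 c0; rewrite exprS E mulr1.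
  by move=> ->.
have dis : [disjoint kleins c & kleins (c ^+ 2)].
  apply/pred0P => K /=; apply/negP => /andP[/imsetP[[u v] + ->] /imsetP[[u' v']]].
  rewrite !inE /= => uv uv' E.
  move/esym/eqP: E; rewrite (klein_pairs c0 c20 uv uv').
  move/(pairing_klein c0 uv)/(pairing_uniq F4 c0) => /(_ _ uv') E.
  by case/eqP: c1; apply: (mulfI c0); rewrite mulr1 -expr2 -E.
have -> : 27300%N = (13650 + 13650)%N by [].
rewrite -{1}(card_kleins c0) -(card_kleins c20) -cardsUI disjoint_setI0 // cards0 addn0.
by apply: subset_leq_card; rewrite subUset !sub.
Qed.

End Index.

(** * The stars of the octonions *)

Section RootStars.
Variables (F : finFieldType) (Z : zorn_algebra F).
Hypothesis F4 : #|F| = 4%N.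
Implicit Types (p q r u v w m : Z) (a b c d t : F) (s x y z : {perm Z}).

(** The values 0 and 1 are those of trace 0 over F_2: this is orthogonality for the trace of the
    F_4-valued form. *)
Definition root_perp x y := pairing 0 x y || pairing 1 x y.

Definition prime_part d := (d == 0) || (d == 1).

Lemma prime_partE d : prime_part d = (d ^+ 2 + d == 0).
Proof.
have -> : d ^+ 2 + d = d * (d + 1) by ring.
by rewrite mulf_eq0 addr_eq0 F4_opp.
Qed.

(** The expression b ^ 2 + b is the trace from F_4 to F_2, and its additivity makes [root_perp]
    bilinear. *)
Lemma prime_partD c d : prime_part (c + d) = (prime_part c == prime_part d).
Proof.
have sq b : b ^+ 2 + b = 0 \/ b ^+ 2 + b = 1.
  have [|nz] := eqVneq (b ^+ 2 + b) 0; first by left.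
  right; apply: (mulfI nz); rewrite mulr1 -expr2 sqrrD mulr2n F4_addxx //.
  by rewrite addr0 -exprM F4_pow4 // addrC.
rewrite !prime_partE sqrrD mulr2n F4_addxx // addr0 addrACA.
by case: (sq c) => ->; case: (sq d) => ->;
   rewrite ?addr0 ?add0r ?F4_addxx ?eqxx ?oner_eq0.
Qed.

Lemma perp_elation p v w d : null p -> plane p v -> plane p w -> v ** w = d *: p ->
  root_perp (elation p v) (elation p w) = prime_part d.
Proof.
move=> np pv pw E; have pd := pairing_elation np pv pw E.
rewrite /root_perp /prime_part; have [d0 | d0] := eqVneq d 0.
  by rewrite -d0 pd.
apply/orP/eqP => [[p0|p1] | d1].
- by case/eqP: (d0); apply: pairing_uniq pd p0.
- exact: pairing_uniq pd p1.
by right; rewrite -d1.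
Qed.

Lemma plane_span p u v (y : Z) : null p -> plane p u -> plane p v -> u ** v = p ->
  plane p y -> exists a b c, [/\ y = c *: p + a *: u + b *: v,
     u ** y = b *: p & v ** y = a *: p].
Proof.
move=> np pu pv uv py; have vu : v ** u = p by rewrite (planeC F4 np).
have [b Eb] := plane_mul F4 np pu py; have [a Ea] := plane_mul F4 np pv py.
pose y' := y + (a *: u + b *: v).
have py' : plane p y' by rewrite !plane_addP ?planeZ.
have [[_ uu _] [_ vv _]] := (planeP pu, planeP pv).
have uy' : u ** y' = 0.
  by rewrite !omulDr !omulZr Eb uu uv scaler0 add0r addxx.
have vy' : v ** y' = 0.
  by rewrite !omulDr !omulZr Ea vv vu scaler0 addr0 addxx.
have [[c Ec] | [c [d Ec]]] := plane_dep F4 np pu py' uy'.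
  have [+ _ tv] := planeP pv; move/(omulC0 (null_otr np) tv) => vp.
  by have := null_neq0 np; rewrite -vu Ec omulZr vp scaler0 eqxx.
have d0 : d = 0.
  apply: (scaler_null_inj np); rewrite scale0r -vy' Ec omulDr !omulZr vu.
  have [+ _ tv] := planeP pv; move/(omulC0 (null_otr np) tv) => ->.
  by rewrite scaler0 add0r.
exists a, b, c; split=> //.
by rewrite -addrA -[c *: p]addr0 -(scale0r u) -d0 -Ec /y' addxK.
Qed.

Lemma star_meets p q : null p -> null q -> meets (star p) (star q) -> p ** q = 0.
Proof.
move=> np nq /set0Pn[x /setIP[xp xq]].
have [[c ->] | [] //] := star_meet F4 np nq xp xq.
by rewrite omulZr null_sqr // scaler0.
Qed.

Lemma meets_star p q : null p -> null q -> p ** q = 0 -> meets (star p) (star q).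
Proof.
move=> np nq pq; have pl := null_planeE np nq pq; apply/set0Pn.
have [E | nt] := eqVneq (elation p q) 1%g.
  have /(elation_eq1 F4 np pl)[c Ec] : elation p q == 1%g by rewrite E.
  have c0 : c != 0 by apply: contraNneq (null_neq0 nq) => c0; rewrite Ec c0 scale0r.
  have [v [w fr]] := frame_exists F4 np; have [ntv _] := frame_nt F4 np fr.
  by exists (elation p v); rewrite Ec starZ // setIid elation_star; case: fr.
exists (elation p q); rewrite inE elation_star // nt /=.
by have [] := @star_line _ Z F4 p q 1 np nq pq; rewrite ?scale1r.
Qed.

Lemma star_neq p q c : null p -> null q -> star p != star q -> q <> c *: p.
Proof.
move=> np nq /eqP ne Eq; apply: ne; rewrite Eq starZ //.
by apply: contraNneq (null_neq0 nq) => c0; rewrite Eq c0 scale0r.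
Qed.

Lemma star_meetE p q x : null p -> null q -> star p != star q ->
  x \in star p -> x \in star q -> star p :&: star q = root_line x :\ 1%g.
Proof.
move=> np nq ne xp xq.
have [[c Ec] | [pq [c Ex]]] := star_meet F4 np nq xp xq.
  by case: (star_neq np nq ne Ec).
have pl := null_planeE np nq pq; have [_ [_ _ x1]] := starP _ _ xp.
rewrite Ex in x1.
have c0 : c != 0 by apply: contraNneq x1 => ->; rewrite scale0r elation1.
apply/setP => y; rewrite in_setI in_setD1; apply/andP/andP => [[yp yq] | [y1 yL]].
  have [_ [_ _ y1]] := starP _ _ yp; split=> //.
  have [[d Ed] | [_ [d Ey]]] := star_meet F4 np nq yp yq.
    by case: (star_neq np nq ne Ed).
  rewrite Ex; apply/root_lineP; rewrite ?planeZ //; exists (d / c).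
  by rewrite scalerA divfK.
move: yL; rewrite in_setU1 (negPf y1) => /bigcapP yL.
by split; apply: yL; rewrite ?xp ?xq ?star_in_set.
Qed.

(** Seen in the star of r2, x and y are the elations along c1 r1 and c2 r3, with form value c1 c2 d.
    It is not 0, so perpendicularity leaves only the value 1. *)
Lemma path_pairing r1 r2 r3 c1 c2 d x y : null r1 -> null r2 -> null r3 ->
  r1 ** r2 = 0 -> r2 ** r3 = 0 -> r1 ** r3 = d *: r2 -> d != 0 -> c1 != 0 -> c2 != 0 ->
  x = elation r1 (c1 *: r2) -> y = elation r2 (c2 *: r3) -> root_perp x y ->
  c1 * c2 * d = 1.
Proof.
move=> n1 n2 n3 r12 r23 E d0 c10 c20 -> ->.
have pl12 := null_planeE n1 n2 r12; have r21 := null_mulC n1 n2 r12.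
have pl21 := null_planeE n2 n1 r21; have pl23 := null_planeE n2 n3 r23.
have -> : elation r1 (c1 *: r2) = elation r2 (c1 *: r1).
  rewrite -elationZ // (elationC F4) ?nullZ //; last by rewrite planeZl.
rewrite (@perp_elation r2 _ _ (c1 * c2 * d)) ?planeZ //; last first.
  by rewrite omulZl omulZr E !scalerA.
by case/orP => /eqP //; move/eqP; rewrite !mulf_eq0 (negPf c10) (negPf c20) (negPf d0).
Qed.

Lemma meet_elation p q x : null p -> null q -> p ** q = 0 -> star p != star q ->
  x \in star p :&: star q -> exists2 c, c != 0 & x = elation p (c *: q).
Proof.
move=> np nq pq ne /setIP[xp xq].
have [[c Ec] | [_ [c Ex]]] := star_meet F4 np nq xp xq.
  by case: (star_neq np nq ne Ec).
exists c => //; have [_ [_ _]] := starP _ _ xp; apply: contraNneq => c0.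
by rewrite Ex c0 scale0r elation1.
Qed.

Lemma meets_mul p q : null p -> null q -> ~~ meets (star p) (star q) -> p ** q != 0.
Proof. by move=> np nq; apply: contraNneq => /(meets_star np nq). Qed.

Lemma mul_neq p q r : p ** q = 0 -> r ** q != 0 -> null q ->
  null p -> null r -> star p != star r.
Proof.
move=> pq rq nq np nr; apply: contraNneq rq => E.
by have [c ->] := star_inj F4 np nr E; rewrite omulZl pq scaler0.
Qed.

End RootStars.

Section RootStarSystem.
Variables (F : finFieldType) (Z : zorn_algebra F).
Hypothesis F4 : #|F| = 4%N.
Implicit Types (p q r u v w m : Z) (a b c d t : F) (x y z : {perm Z}).

Lemma star_setP (P : {set {perm Z}}) :
  reflect (exists2 p, null p & P = star p) (P \in star_set Z).
Proof.
apply: (iffP imsetP) => [[p + ->] | [p np ->]]; last by exists p; rewrite ?inE.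
by rewrite inE; exists p.
Qed.

Lemma star_pair p x y : null p -> x \in star p -> y \in star p ->
  exists u v d, [/\ plane p u, plane p v, u ** v = d *: p,
    x = elation p u & y = elation p v].
Proof.
move=> np /starP[u [pu -> _]] /starP[v [pv -> _]].
by have [d E] := plane_mul F4 np pu pv; exists u, v, d.
Qed.

Lemma root_perp_mul p x y z : null p -> x \in star p -> y \in star p ->
  z \in star p -> root_perp z (x * y)%g = (root_perp z x == root_perp z y).
Proof.
move=> np /starP[u [pu -> _]] /starP[v [pv -> _]] /starP[w [pw -> _]].
have [c Ec] := plane_mul F4 np pw pu; have [d Ed] := plane_mul F4 np pw pv.
rewrite elationD // (perp_elation F4 np pw pu Ec) (perp_elation F4 np pw pv Ed).
rewrite (@perp_elation _ Z F4 p w (u + v) (c + d)) ?plane_addP //.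
  exact: prime_partD.
by rewrite omulDr Ec Ed scalerDl.
Qed.

Lemma F4_sqr b : ~~ prime_part b -> b ^+ 2 = 1 + b.
Proof.
rewrite prime_partE // => nz; suff E : b ^+ 2 + b = 1.
  by rewrite -E -addrA F4_addxx // addr0.
apply: (mulfI nz); rewrite mulr1 -expr2 sqrrD mulr2n F4_addxx //.
by rewrite addr0 -exprM F4_pow4 // addrC.
Qed.

Lemma root_perp_nondeg p x : null p -> x \in star p ->
  exists2 y, y \in star p & ~~ root_perp x y.
Proof.
move=> np /starP[u [pu -> nt]]; have [v pv uv] := plane_complement F4 np pu nt.
have [t t0 t1] := F4_omega F4; have E : u ** (t *: v) = t *: p by rewrite omulZr uv.
have nE : ~~ root_perp (elation p u) (elation p (t *: v)).
  by rewrite (perp_elation F4 np pu (planeZ t pv) E) /prime_part negb_or t0.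
exists (elation p (t *: v)) => //; rewrite elation_star ?planeZ //.
apply: contraNneq nE => ->; rewrite -(elation1 F4 np).
rewrite (@perp_elation _ Z F4 p u 0 0) //.
- by rewrite /prime_part eqxx.
- by rewrite /plane !omul0r eqxx.
by rewrite omul0r scale0r.
Qed.

(** Totally isotropic subspaces of a symplectic 4-space over F_2 have at most three non-zero
    vectors. If u ** v = p, then w has coordinates in F_2 on u and v, and only u + v is left. If u
    ** v = 0, then v = b u and w = e u modulo p with b and e outside F_2, distinct, so that e = b ^
    2 = 1 + b. *)
Lemma root_perp_max p x y z : null p -> x \in star p -> y \in star p ->
  z \in star p -> x != y -> x != z -> y != z ->
  root_perp x y -> root_perp x z -> root_perp y z -> z = (x * y)%g.
Proof.
move=> np xp yp zp; have [u [v [d [pu pv E Ex Ey]]]] := star_pair np xp yp.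
have [w [pw Ez z1]] := starP _ _ zp.
have [c Ec] := plane_mul F4 np pu pw; have [c' Ec'] := plane_mul F4 np pv pw.
have [[_ [_ _ x1]] [_ [_ _ y1]]] := (starP _ _ xp, starP _ _ yp).
rewrite Ex Ey Ez in x1 y1 z1 *.
rewrite (perp_elation F4 np pu pv E) (perp_elation F4 np pu pw Ec).
rewrite (perp_elation F4 np pv pw Ec') => xy xz yz Pd Pc Pc'.
rewrite elationD //.
have [pu0 uu tu] := planeP pu; have up := omulC0 (null_otr np) tu pu0.
have [d0 | d0] := eqVneq d 0; last first.
  have d1 : d = 1 by apply/eqP; move: Pd; rewrite /prime_part (negPf d0).
  rewrite d1 scale1r in E.
  have [a [b [e [Ew uw vw]]]] := plane_span F4 np pu pv E pw.
  have Eb : b = c by apply: (scaler_null_inj np); rewrite -uw.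
  have Ea : a = c' by apply: (scaler_null_inj np); rewrite -vw.
  move: Pc Pc'; rewrite -Eb -Ea => /orP[] /eqP b01 /orP[] /eqP a01;
    rewrite a01 b01 ?scale0r ?scale1r ?addr0 in Ew.
  - case/eqP: z1; rewrite -(elation1 F4 np).
    apply/elation_inj => //; first by rewrite /plane !omul0r eqxx.
    by exists e; rewrite Ew addxx.
  - by case/eqP: xz; apply/elation_inj => //; exists e; rewrite Ew addrC.
  - by case/eqP: yz; apply/elation_inj => //; exists e; rewrite Ew addrC.
  apply/elation_inj; rewrite ?plane_addP //.
  by exists e; rewrite Ew [RHS]addrC -[e *: p + u + v]addrA [RHS]addrA addxx // add0r.
rewrite d0 scale0r in E.
have [[k Ek] | [k [b Ev]]] := plane_dep F4 np pu pv E.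
  by case: (@elation_nt _ Z F4 p u k).
have b01 : ~~ prime_part b.
  rewrite /prime_part negb_or; apply/andP; split; apply/eqP => b01.
    rewrite b01 scale0r addr0 in Ev.
    by case: (@elation_nt _ Z F4 p v k).
  rewrite b01 scale1r addrC in Ev; case/eqP: xy; apply/elation_inj => //.
  by exists k.
have c0 : c = 0.
  have Ec2 : c' = b * c.
    apply: (scaler_null_inj np); rewrite -Ec' Ev omulDl !omulZl Ec scalerA.
    by have [-> _ _] := planeP pw; rewrite scaler0 add0r.
  case/orP: Pc => /eqP // c1; move: Pc'; rewrite Ec2 c1 mulr1.
  by rewrite (negPf b01).
rewrite c0 scale0r in Ec.
have [[l El] | [l [e Ew]]] := plane_dep F4 np pu pw Ec.
  by case: (@elation_nt _ Z F4 p u l).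
have e0 : e != 0.
  apply/eqP => e0; rewrite e0 scale0r addr0 in Ew.
  by case: (@elation_nt _ Z F4 p w l).
have e1 : e != 1.
  apply/eqP => e1; case/eqP: xz; apply/elation_inj => //; exists l.
  by rewrite Ew e1 scale1r addrC.
have [b0 b1] : b != 0 /\ b != 1 by apply/andP; rewrite -negb_or.
have [Eeb | Eeb] := F4_cases F4 b0 b1 e0 e1.
  case/eqP: yz; apply/elation_inj => //; exists (l + k).
  rewrite Ew Ev Eeb scalerDl (addrC (k *: p)) (addrC (l *: p) (k *: p)).
  by rewrite [RHS]addrA addxK // addrC.
have Eb2 : e = 1 + b by rewrite Eeb F4_sqr.
apply/elation_inj; rewrite ?plane_addP //; exists (k + l).
have AC (h i j o : Z) : i + (j + o) = (h + (i + o)) + (j + h).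
  by rewrite (addrC h) (addrC j h) [RHS]addrA addxK // (addrC j) addrA.
by rewrite Ev Ew Eb2 !scalerDl scale1r; apply: AC.
Qed.

Lemma star_basis p : null p -> exists x1 y1 x2 y2,
  [/\ [/\ x1 \in star p, y1 \in star p, x2 \in star p & y2 \in star p],
      ~~ root_perp x1 y1, ~~ root_perp x2 y2,
      root_perp x1 x2 && root_perp x1 y2 & root_perp y1 x2 && root_perp y1 y2].
Proof.
move=> np; have [v [w fr]] := frame_exists F4 np; have [t t0 t1] := F4_omega F4.
have Pt : ~~ prime_part t by rewrite /prime_part negb_or t0.
have t2 := F4_sqr Pt.
have [P0 P1] : prime_part (0 : F) /\ prime_part (1 : F).
  by split; rewrite /prime_part eqxx ?orbT.
have perpE (x y : (F * F)%type) : root_perp (frame_elation v w p x) (frame_elation v w p y)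
    = prime_part (x.1 * y.2 + x.2 * y.1).
  apply: perp_elation => //; try exact: (frame_plane F4).
  exact: (frame_mul0 F4).
have inS (x : (F * F)%type) : x != (0, 0) -> frame_elation v w p x \in star p.
  move=> x0; rewrite /frame_elation elation_star; last exact: (frame_plane F4).
  apply: contraNneq x0 => E; apply/eqP/(frame_elation_inj F4 np fr).
  by rewrite /frame_elation E /= !scale0r addr0 elation1.
have nz (a b : F) : (a != 0) || (b != 0) -> (a, b) != (0, 0).
  by apply: contraTN => /eqP[-> ->]; rewrite !eqxx.
(* In coordinates: 1 and t pair to t, and t * t ^ 2 = 1. *)
exists (frame_elation v w p (1, 0)), (frame_elation v w p (0, t)),
  (frame_elation v w p (t ^+ 2, 0)), (frame_elation v w p (0, 1)).
have t3 : t * t ^+ 2 = 1 by rewrite -exprS F4_cube.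
split; rewrite ?perpE /= ?(mulr0, mul0r, mulr1, mul1r, addr0, add0r) ?t3 ?P0 ?P1 //.
  by split; apply: inS; apply: nz; rewrite ?sqrf_eq0 ?t0 ?oner_eq0 ?orbT.
by rewrite t2 prime_partD // P1 (negPf Pt).
Qed.

(** Triangles are settled by [plane_dep], quadrangles by the two expressions for r1 ** r3 from
    [path_mul], pentagons by the contradiction between [opposite_otr] and [path_mul], and the last
    axiom by [hexagon_holonomy]. *)
Theorem root_star_system : star_system (star_set Z) (@root_perp F Z).
Proof.
split.
- move=> P x /star_setP[p np ->] /starP[v [pv -> nt]].
  by split=> //; apply: elation_sqr.
- move=> P x y /star_setP[p np ->] /starP[v [pv -> _]] /starP[w [pw -> _]].
  exact: elation_comm.
- move=> P x y /star_setP[p np ->] /starP[v [pv -> _]] /starP[w [pw -> _]] ne.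
  rewrite elationD // elation_star ?plane_addP // -elationD //.
  apply: contraNneq ne => E.
  by rewrite -{1}(elationV F4 np pv) eq_invg_mul E.
- move=> P x /star_setP[p np ->] /starP[v [pv -> _]].
  rewrite (@perp_elation _ Z F4 p v v 0) /prime_part ?eqxx //.
  by have [_ -> _] := planeP pv; rewrite scale0r.
- move=> P x y /star_setP[p np ->] xp yp.
  have [u [v [d [pu pv E -> ->]]]] := star_pair np xp yp.
  rewrite (perp_elation F4 np pu pv E) (perp_elation F4 np pv pu (d := d)) //.
  by rewrite (planeC F4 np).
- move=> P x y z /star_setP[p np ->] xp yp zp _; exact: root_perp_mul xp yp zp.
- move=> P x /star_setP[p np ->]; exact: root_perp_nondeg.
- move=> P x y z /star_setP[p np ->]; exact: root_perp_max.
- move=> P /star_setP[p np ->]; exact: star_basis.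
- move=> P /star_setP[p np ->]; exact: card_star.
- move=> P Q x y /star_setP[p np ->] /star_setP[q nq ->] ne.
  move=> /setIP[xp xq] /setIP[yp yq].
  have [[c Ec] | [pq [c Ex]]] := star_meet F4 np nq xp xq.
    by case: (star_neq F4 np nq ne Ec).
  have [[c' Ec] | [_ [c' Ey]]] := star_meet F4 np nq yp yq.
    by case: (star_neq F4 np nq ne Ec).
  have pl := null_planeE np nq pq.
  rewrite Ex Ey (@perp_elation _ Z F4 p _ _ 0) ?planeZ // /prime_part ?eqxx //.
  by rewrite omulZl omulZr null_sqr // !scaler0 scale0r.
- move=> P Q /star_setP[p np ->] /star_setP[q nq ->] ne /set0Pn[x /setIP[xp xq]].
  rewrite (star_meetE F4 np nq ne xp xq).
  have xr : x \in long_roots Z by apply/long_rootsP; exists p.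
  have := cardsD1 1%g (root_line x); rewrite card_root_line //.
  by rewrite in_setU1 eqxx => -[].
- move=> P Q R x /star_setP[p np ->] /star_setP[q nq ->] /star_setP[r nr ->].
  move=> pq pr xp xq xr; rewrite (star_meetE F4 np nq pq xp xq).
  by rewrite (star_meetE F4 np nr pr xp xr).
- move=> P Q R /star_setP[p np ->] /star_setP[q nq ->] /star_setP[r nr ->].
  move=> nPQ nQR nPR /(star_meets F4 np nq) pq /(star_meets F4 nq nr) qr.
  move=> /(star_meets F4 np nr) pr; have pl := null_planeE np nq pq.
  have [[c Ec] | [a [b Er]]] := plane_dep F4 np pl (null_planeE np nr pr) qr.
    by case: (star_neq F4 np nq nPQ Ec).
  have nt : elation p q != 1%g.
    apply/negP => /(elation_eq1 F4 np pl)[c Ec].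
    by case: (star_neq F4 np nq nPQ Ec).
  exists (elation p q); have [|+ +] := @star_line _ Z F4 p q 1 np nq pq.
    by rewrite scale1r.
  rewrite scale1r => -> ->; split=> //.
  by rewrite Er star_repoint // -Er null_neq0.
- move=> P1 P2 P3 P4 [/star_setP[r1 n1 ->] /star_setP[r2 n2 ->]].
  move=> /star_setP[r3 n3 ->] /star_setP[r4 n4 ->].
  case=> /(star_meets F4 n1 n2) r12 /(star_meets F4 n2 n3) r23.
  move=> /(star_meets F4 n3 n4) r34 /(star_meets F4 n4 n1) r41.
  have [d Ed] := path_mul F4 n1 n2 n3 r12 r23.
  have [d' Ed'] := path_mul F4 n1 n4 n3 (null_mulC n4 n1 r41) (null_mulC n3 n4 r34).
  have [d0 | d0] := eqVneq d 0.
    by right; apply: meets_star => //; rewrite Ed d0 scale0r.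
  left; have E : r2 = (d^-1 * d') *: r4.
    by rewrite -scalerA -Ed' Ed scalerA mulVf // scale1r.
  rewrite E starZ //; apply: contraNneq (null_neq0 n2) => E0.
  by rewrite E E0 scale0r.
- move=> P1 P2 P3 P4 P5 [/star_setP[r1 n1 ->] /star_setP[r2 n2 ->]].
  move=> /star_setP[r3 n3 ->] /star_setP[r4 n4 ->] /star_setP[r5 n5 ->].
  case=> /(star_meets F4 n1 n2) r12 /(star_meets F4 n2 n3) r23.
  move=> /(star_meets F4 n3 n4) r34 /(star_meets F4 n4 n5) r45.
  move=> /(star_meets F4 n5 n1) r51.
  have [E | r13] := eqVneq (r1 ** r3) 0; first by left; apply: meets_star.
  have [E | r24] := eqVneq (r2 ** r4) 0; first by right; apply: meets_star.
  have := opposite_otr F4 n1 n2 n3 n4 r12 r23 r34 r13 r24.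
  have [d ->] := path_mul F4 n1 n5 n4 (null_mulC n5 n1 r51) (null_mulC n4 n5 r45).
  by rewrite otrZ null_otr // mulr0 eqxx.
move=> P1 P2 P3 P4 P5 P6 [/star_setP[r1 n1 ->] /star_setP[r2 n2 ->]].
move=> /star_setP[r3 n3 ->] [/star_setP[r4 n4 ->] /star_setP[r5 n5 ->]].
move=> /star_setP[r6 n6 ->] [+ + +] [+ + +].
move=> /(meets_mul F4 n1 n3) m13 /(meets_mul F4 n2 n4) m24 /(meets_mul F4 n3 n5) m35.
move=> /(meets_mul F4 n4 n6) m46 /(meets_mul F4 n5 n1) m51 /(meets_mul F4 n6 n2) m62.
move=> x1 x2 x3 x4 x4' x5 x6 [i1 i2 i3 i4] [i6 i5 i4'].
move=> [x12 x23 x34] [x16 x65 x54'].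
have mt (p q : Z) (x0 : {perm Z}) : null p -> null q -> x0 \in star p :&: star q -> p ** q = 0.
  by move=> np nq xx; apply: star_meets => //; apply/set0Pn; exists x0.
have [r12 r23 r34] : [/\ r1 ** r2 = 0, r2 ** r3 = 0 & r3 ** r4 = 0].
  by split; [exact: mt n1 n2 i1 | exact: mt n2 n3 i2 | exact: mt n3 n4 i3].
have [r45 r56 r61] : [/\ r4 ** r5 = 0, r5 ** r6 = 0 & r6 ** r1 = 0].
  by split; [exact: mt n4 n5 i4 | exact: mt n5 n6 i5 | exact: mt n6 n1 i6].
have [d1 E1] := path_mul F4 n6 n1 n2 r61 r12.
have [d2 E2] := path_mul F4 n1 n2 n3 r12 r23.
have [d3 E3] := path_mul F4 n2 n3 n4 r23 r34.
have [d4 E4] := path_mul F4 n3 n4 n5 r34 r45.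
have [d5 E5] := path_mul F4 n4 n5 n6 r45 r56.
have [d6 E6] := path_mul F4 n5 n6 n1 r56 r61.
have nzd (p q r : Z) d : p ** q != 0 -> p ** q = d *: r -> d != 0.
  by move=> pq E; apply: contraNneq pq => d0; rewrite E d0 scale0r.
have [[d10 d20] d30] := (nzd _ _ _ _ m62 E1, nzd _ _ _ _ m13 E2, nzd _ _ _ _ m24 E3).
have [[d40 d50] d60] := (nzd _ _ _ _ m35 E4, nzd _ _ _ _ m46 E5, nzd _ _ _ _ m51 E6).
have ne (p q r : Z) : null p -> null q -> null r -> q ** r = 0 -> p ** r != 0 ->
    star p != star q.
  by move=> np nq nr qr pr; rewrite eq_sym; apply: (mul_neq F4 qr pr).
have [c1 c10 X1] := meet_elation F4 n1 n2 r12 (ne _ _ _ n1 n2 n3 r23 m13) i1.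
have [c2 c20 X2] := meet_elation F4 n2 n3 r23 (ne _ _ _ n2 n3 n4 r34 m24) i2.
have [c3 c30 X3] := meet_elation F4 n3 n4 r34 (ne _ _ _ n3 n4 n5 r45 m35) i3.
have [c4 c40 X4] := meet_elation F4 n4 n5 r45 (ne _ _ _ n4 n5 n6 r56 m46) i4.
have [c4' c4'0 X4'] := meet_elation F4 n4 n5 r45 (ne _ _ _ n4 n5 n6 r56 m46) i4'.
have [c5 c50 X5] := meet_elation F4 n5 n6 r56 (ne _ _ _ n5 n6 n1 r61 m51) i5.
have [c6 c60 X6] := meet_elation F4 n6 n1 r61 (ne _ _ _ n6 n1 n2 r12 m62) i6.
have psym x y : root_perp x y -> root_perp y x.
  by case/orP=> /(pairingC F4) xy; rewrite /root_perp xy ?orbT.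
have C12 := path_pairing F4 n1 n2 n3 r12 r23 E2 d20 c10 c20 X1 X2 x12.
have C23 := path_pairing F4 n2 n3 n4 r23 r34 E3 d30 c20 c30 X2 X3 x23.
have C34 := path_pairing F4 n3 n4 n5 r34 r45 E4 d40 c30 c40 X3 X4 x34.
have C61 := path_pairing F4 n6 n1 n2 r61 r12 E1 d10 c60 c10 X6 X1 (psym _ _ x16).
have C56 := path_pairing F4 n5 n6 n1 r56 r61 E6 d60 c50 c60 X5 X6 (psym _ _ x65).
have C45 := path_pairing F4 n4 n5 n6 r45 r56 E5 d50 c4'0 c50 X4' X5 (psym _ _ x54').
have hol := hexagon_holonomy F4 n1 n2 n3 n4 n5 n6 (And3 r12 r23 r34)
  (And3 r45 r56 r61) (And3 E1 E2 E3) (And3 E4 E5 E6) (And3 d10 d20 d30)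
  (And3 d40 d50 d60).
rewrite X4 X4'; congr (elation _ (_ *: _)).
(* c1 d2 d4 c4 = d3 and c1 d1 d5 c4' = d6, so the holonomy identity applies. *)
have H4 : c1 * d2 * d4 * c4 = d3.
  transitivity (c1 * d2 * d4 * c4 * (c2 * c3 * d3)); first by rewrite C23 mulr1.
  transitivity ((c1 * c2 * d2) * (c3 * c4 * d4) * d3); first by ring.
  by rewrite C12 C34 !mul1r.
have H4' : c1 * d1 * d5 * c4' = d6.
  transitivity (c1 * d1 * d5 * c4' * (c5 * c6 * d6)); first by rewrite C56 mulr1.
  transitivity ((c6 * c1 * d1) * (c4' * c5 * d5) * d6); first by ring.
  by rewrite C61 C45 !mul1r.
have nz : c1 * (d2 * d4 * d6) != 0 by rewrite !mulf_neq0.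
apply: (mulfI nz); transitivity (d3 * d6); first by rewrite -H4; ring.
by rewrite -hol -H4'; ring.
Qed.

End RootStarSystem.

(** * The normaliser index in terms of the form *)

Section IndexCases.
Variables (F : finFieldType) (Z : zorn_algebra F).
Hypothesis F4 : #|F| = 4%N.
Implicit Types (p q r u v w m : Z) (a b c d t : F) (x y z : {perm Z}).
Local Notation A := (zorn_aut_group Z).

Lemma root_lineN1 x : x \in long_roots Z -> 1%g \in root_line x.
Proof. by move=> _; rewrite in_setU1 eqxx. Qed.

Lemma klein_root_line x y : x \in long_roots Z -> y \in root_line x ->
  x != y -> y != 1%g -> klein x y = root_line x.
Proof.
move=> xr yx ne y1; have [p np /starP[v [pv Ex x1]]] := long_rootsP _ xr.
apply/eqP; rewrite eqEcard card_root_line //; apply/andP; split.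
  have xx := root_line_id F4 xr; apply/subsetP => z.
  rewrite in_klein => /or4P[] /eqP ->; rewrite ?root_lineN1 //.
    move: yx; rewrite Ex in x1 * => /(root_lineP F4 _ np pv x1)[c Ey].
  rewrite Ey elationD ?planeZ //; apply/(root_lineP F4 _ np pv x1).
  by exists (1 + c); rewrite scalerDl scale1r.
rewrite /klein -setUA -setUA !cardsU1 cards1 !inE.
have n1 : (x == x * y)%g = false.
  by rewrite -{1}[x]mulg1 (inj_eq (mulgI x)) eq_sym (negPf y1).
have n2 : (y == x * y)%g = false.
  by rewrite -{1}[y]mul1g (inj_eq (mulIg y)) eq_sym (negPf x1).
have n3 : (1 == x * y)%g = false.
  apply/eqP => E; case/eqP: ne.
  by rewrite -[x]mulg1 E mulgA long_roots_sqr ?mul1g.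
by rewrite n1 n2 n3 (negPf ne) !(eq_sym 1%g) (negPf x1) (negPf y1).
Qed.

Lemma index_klein x y : x \in long_roots Z -> y \in long_roots Z -> commute x y ->
  #|A : 'N_A(<<[set x; y]>>)|%g = #|(klein x y :^: A)%g|.
Proof.
move=> xr yr xy; rewrite card_conjugates gen_klein //; exact: long_roots_sqr.
Qed.

(** A common star exists by [commuting_concurrent]; the cases are d = 0, d = 1 and d outside F_2,
    with the orbit lengths computed above. *)
Lemma index_cases x y : x \in long_roots Z -> y \in long_roots Z -> x != y ->
  commute x y ->
  let n := #|A : 'N_A(<<[set x; y]>>)|%g in
  [\/ y \in root_line x /\ n = 1365%N, pairing 1 x y /\ n = 13650%N |
      [/\ y \notin root_line x, ~~ root_perp x y & (27300 <= n)%N]].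
Proof.
move=> xr yr ne xy n; rewrite /n index_klein //.
have [p [np xp yp]] := commuting_concurrent F4 xr yr xy.
have [u [v [d [pu pv E Ex Ey]]]] := star_pair F4 np xp yp.
have [[_ [_ _ x1]] [_ [_ _ y1]]] := (starP _ _ xp, starP _ _ yp).
have perpE := perp_elation F4 np pu pv E; rewrite -Ex -Ey in perpE.
have pxy : pairing d x y by rewrite Ex Ey; apply: pairing_elation.
have [d0 | d0] := eqVneq d 0.
  have yx : y \in root_line x.
    rewrite d0 scale0r in E; rewrite Ex in x1 *.
    have [[k Ek] | [k [b Ev]]] := plane_dep F4 np pu pv E.
      by case: (@elation_nt _ Z F4 p u k).
    apply/(root_lineP F4 _ np pu x1); exists b; rewrite Ey.
    apply/elation_inj; rewrite ?planeZ //; exists k.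
    by rewrite Ev (addrC (k *: p)) addxK.
  by apply: Or31; rewrite (klein_root_line xr) // root_lines_conj // card_root_lines.
have ynx : y \notin root_line x.
  apply/negP; rewrite Ex in x1 *; move=> /(root_lineP F4 _ np pu x1)[c Ec].
  have p0 : pairing 0 x y.
    rewrite Ex Ec; apply: pairing_elation; rewrite ?planeZ // omulZr.
    by have [_ -> _] := planeP pu; rewrite scaler0 scale0r.
  by case/eqP: (d0); apply: pairing_uniq p0.
have [d1 | d1] := eqVneq d 1.
  rewrite d1 in pxy; apply: Or32; split=> //.
  by rewrite kleins_conj1 // card_kleins // oner_neq0.
apply: Or33; split=> //; last exact: kleins_conj2 pxy.
by rewrite perpE /prime_part negb_or d0.
Qed.

Lemma root_line_perp x y : x \in long_roots Z -> y \in root_line x -> y != 1%g ->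
  exists p, [/\ null p, x \in star p, y \in star p & root_perp x y].
Proof.
move=> /long_rootsP[p np xp] yx y1; have [v [pv Ex x1]] := starP _ _ xp.
rewrite Ex in x1 yx *; have [c Ey] := root_lineP F4 _ np pv x1 yx.
exists p; rewrite Ey elation_star // elation_star ?planeZ // -Ey.
split=> //; rewrite Ey (@perp_elation _ Z F4 p _ _ 0) ?planeZ // /prime_part ?eqxx //.
by rewrite omulZr; have [_ -> _] := planeP pv; rewrite scaler0 scale0r.
Qed.

Lemma index_1365 x y : x \in long_roots Z -> y \in long_roots Z -> x != y ->
  commute x y ->
  (#|A : 'N_A(<<[set x; y]>>)|%g == 1365%N) = (y \in root_line x).
Proof.
move=> xr yr ne xy; have [[-> ->]|[p1 ->]|[/negPf-> _ n]] := index_cases xr yr ne xy.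
- exact: eqxx.
- apply/esym/negbTE/negP => yx; have y1 := pairing_nt F4 (oner_neq0 _) p1.
  have [p [np xp yp _]] := root_line_perp xr yx (proj2 y1).
  have [v [pv Ex x1]] := starP _ _ xp; rewrite Ex in x1 yx.
  have [c Ey] := root_lineP F4 _ np pv x1 yx.
  have p0 : pairing 0 x y.
    rewrite Ex Ey; apply: pairing_elation; rewrite ?planeZ // omulZr.
    by have [_ -> _] := planeP pv; rewrite scaler0 scale0r.
  by have /eqP := pairing_uniq F4 (oner_neq0 _) p1 p0; rewrite oner_eq0.
by apply: contraTF n => /eqP->.
Qed.

Lemma index_perp x y : x \in long_roots Z -> y \in long_roots Z -> x != y ->
  commute x y ->
  pred2 1365%N 13650%N #|A : 'N_A(<<[set x; y]>>)|%g = root_perp x y.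
Proof.
move=> xr yr ne xy; have [[yx ->]|[p1 ->]|[_ /negPf-> n]] := index_cases xr yr ne xy.
- have y1 : y != 1%g.
    have := long_roots_order F4 yr.
    by apply: contra_eqN => /eqP->; rewrite order1.
  by have [p [_ _ _ ->]] := root_line_perp xr yx y1; rewrite /= ?eqxx.
- by rewrite /root_perp p1 orbT.
by apply: contraTF n => /orP[] /eqP->.
Qed.

End IndexCases.

Local Close Scope ring_scope.
Local Open Scope group_scope.

(** * Transport of star systems along an injective morphism, as G is given only up to isomorphism *)

Section Transport.
Variables (aT gT : finGroupType) (A : {group aT}) (f : {morphism A >-> gT}).
Hypothesis injf : 'injm f.
Variables (Pts : {set {set aT}}) (perp : rel aT).
Hypothesis sub : forall P, P \in Pts -> P \subset A.
Hypothesis sys : star_system Pts perp.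

Definition image_stars : {set {set gT}} := [set f @: (P : {set aT}) | P in Pts].
Definition image_perp : rel gT := fun x y => perp (invm injf x) (invm injf y).

Lemma mem_image_star (P : {set aT}) x : P \in Pts -> x \in A ->
  (f x \in f @: P) = (x \in P).
Proof.
move=> PP xA; apply/imsetP/idP => [[y yP E] | xP]; last by exists x.
have yA := subsetP (sub PP) y yP.
by rewrite (injmP injf _ _ xA yA E).
Qed.

Lemma image_meet (P Q : {set aT}) : P \in Pts -> Q \in Pts ->
  f @: P :&: f @: Q = f @: (P :&: Q).
Proof.
move=> PP QP; apply/setP => x; rewrite in_setI; apply/andP/imsetP => [[]|[y]].
  case/imsetP=> y yP ->; rewrite mem_image_star ?(subsetP (sub PP)) // => yQ.
  by exists y; rewrite // inE yP.
by case/setIP=> yP yQ ->; rewrite !imset_f.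
Qed.

Lemma image_meets (P Q : {set aT}) : P \in Pts -> Q \in Pts ->
  meets (f @: P) (f @: Q) = meets P Q.
Proof. by move=> PP QP; rewrite /meets image_meet // imset_eq0. Qed.

Lemma image_perpE P Q x y : P \in Pts -> Q \in Pts -> x \in P -> y \in Q ->
  image_perp (f x) (f y) = perp x y.
Proof.
move=> PP QP xP yP; rewrite /image_perp.
by rewrite !invmE ?(subsetP (sub PP) x) ?(subsetP (sub QP) y).
Qed.

Lemma image_neq (P : {set aT}) x y : P \in Pts -> x \in P -> y \in P -> (f x == f y) = (x == y).
Proof.
move=> PP xP yP; apply/eqP/eqP => [E|-> //].
have [xA yA] := (subsetP (sub PP) x xP, subsetP (sub PP) y yP).
exact: (injmP injf _ _ xA yA E).
Qed.

Lemma image_star_neq (P Q : {set aT}) : f @: P != f @: Q -> P != Q.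
Proof. by apply: contraNneq => ->. Qed.

Lemma image_starM P x y : P \in Pts -> x \in P -> y \in P -> f x * f y = f (x * y).
Proof. by move=> PP xP yP; rewrite morphM // (subsetP (sub PP)). Qed.

Lemma image_meetP (P Q : {set aT}) x : P \in Pts -> Q \in Pts ->
  x \in f @: P :&: f @: Q -> exists2 y, y \in P :&: Q & x = f y.
Proof. by move=> PP QP; rewrite image_meet // => /imsetP[y]; exists y. Qed.

Lemma image_star_system : star_system image_stars image_perp.
Proof.
have inA P x : P \in Pts -> x \in P -> x \in A by move=> /sub/subsetP; apply.
have pE P x y (PP : P \in Pts) (xP : x \in P) (yP : y \in P) :=
  image_perpE PP PP xP yP.
split.
- move=> _ _ /imsetP[P PP ->] /imsetP[x xP ->].
  have [x1 xx] := star_inv sys PP xP.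
  rewrite (image_starM PP) // xx morph1; split=> //.
  by rewrite morph_injm_eq1 // (inA P).
- move=> _ _ _ /imsetP[P PP ->] /imsetP[x xP ->] /imsetP[y yP ->].
  by rewrite !(image_starM PP) // (star_mulC sys PP xP yP).
- move=> _ _ _ /imsetP[P PP ->] /imsetP[x xP ->] /imsetP[y yP ->].
  by rewrite (image_neq PP) // (image_starM PP) // => ne; rewrite imset_f ?(star_mul sys).
- move=> _ _ /imsetP[P PP ->] /imsetP[x xP ->].
  by rewrite (pE P) // (perp_refl sys PP).
- move=> _ _ _ /imsetP[P PP ->] /imsetP[x xP ->] /imsetP[y yP ->].
  by rewrite !(pE P) // (perp_sym sys PP).
- move=> _ _ _ _ /imsetP[P PP ->] /imsetP[x xP ->] /imsetP[y yP ->] /imsetP[z zP ->].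
  rewrite (image_neq PP) // (image_starM PP) // => ne.
  by rewrite !(pE P) ?(star_mul sys) // (perp_mul sys PP).
- move=> _ _ /imsetP[P PP ->] /imsetP[x xP ->].
  have [y yP xy] := perp_nondeg sys PP xP; exists (f y); first exact: imset_f.
  by rewrite (pE P).
- move=> _ _ _ _ /imsetP[P PP ->] /imsetP[x xP ->] /imsetP[y yP ->] /imsetP[z zP ->].
  rewrite !(image_neq PP) // !(pE P) // (image_starM PP) // => *.
  by congr (f _); apply: (perp_max sys PP).
- move=> _ /imsetP[P PP ->]; have [a [c [b [d [[aP cP bP dP] ac bd ab cd]]]]] :=
    symplectic_basis sys PP.
  by exists (f a), (f c), (f b), (f d); rewrite !imset_f ?(pE P).
- move=> _ /imsetP[P PP ->]; rewrite card_in_imset ?(card_star15 sys) //.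
  by move=> x y xP yP E; apply/eqP; rewrite -(image_neq PP) // E.
- move=> _ _ x y /imsetP[P PP ->] /imsetP[Q QP ->] /image_star_neq ne.
  move=> /(image_meetP PP QP)[u uPQ ->] /(image_meetP PP QP)[v vPQ ->].
  have [[uP uQ] [vP vQ]] := (setIP uPQ, setIP vPQ).
  by rewrite (pE P) // (meet_perp sys PP QP ne).
- move=> _ _ /imsetP[P PP ->] /imsetP[Q QP ->] /image_star_neq ne.
  rewrite image_meets // => m; rewrite image_meet // card_in_imset ?(card_meet sys) //.
  move=> x y /setIP[xP _] /setIP[yP _] E; apply/eqP.
  by rewrite -(image_neq PP) // E.
- move=> _ _ _ x /imsetP[P PP ->] /imsetP[Q QP ->] /imsetP[R RP ->].
  move=> /image_star_neq pq /image_star_neq pr /imsetP[u uP ->].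
  rewrite !mem_image_star ?(inA P) // => uQ uR.
  by rewrite !image_meet // (meet_eq sys PP QP RP pq pr uP uQ uR).
- move=> _ _ _ /imsetP[P PP ->] /imsetP[Q QP ->] /imsetP[R RP ->].
  move=> /image_star_neq pq /image_star_neq qr /image_star_neq pr.
  rewrite !image_meets // => mpq mqr mpr.
  have [x [xP xQ xR]] := no_triangle sys PP QP RP pq qr pr mpq mqr mpr.
  by exists (f x); rewrite !imset_f.
- move=> ? ? ? ? [/imsetP[P PP ->] /imsetP[Q QP ->] /imsetP[R RP ->] /imsetP[S SP ->]].
  rewrite !image_meets // => ms.
  by have [->|] := no_quadrangle sys (And4 PP QP RP SP) ms; [left | right].
- move=> ? ? ? ? ? [/imsetP[P PP ->] /imsetP[Q QP ->] /imsetP[R RP ->]].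
  move=> /imsetP[S SP ->] /imsetP[T TP ->]; rewrite !image_meets // => ms.
  by have := no_pentagon sys (And5 PP QP RP SP TP) ms.
move=> ? ? ? ? ? ? [/imsetP[P1 PP1 ->] /imsetP[P2 PP2 ->] /imsetP[P3 PP3 ->]].
move=> [/imsetP[P4 PP4 ->] /imsetP[P5 PP5 ->] /imsetP[P6 PP6 ->]].
rewrite !image_meets // => m1 m2 x1 x2 x3 x4 x4' x5 x6.
move=> [/(image_meetP PP1 PP2)[y1 Y1 ->] /(image_meetP PP2 PP3)[y2 Y2 ->]].
move=> /(image_meetP PP3 PP4)[y3 Y3 ->] /(image_meetP PP4 PP5)[y4 Y4 ->].
move=> [/(image_meetP PP6 PP1)[y6 Y6 ->] /(image_meetP PP5 PP6)[y5 Y5 ->]].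
move=> /(image_meetP PP4 PP5)[y4' Y4' ->].
have [[y11 _] [y22 _] [y33 _]] := And3 (setIP Y1) (setIP Y2) (setIP Y3).
have [[y44 _] [y44' _] [y55 _]] := And3 (setIP Y4) (setIP Y4') (setIP Y5).
have [y66 _] := setIP Y6.
rewrite (image_perpE PP1 PP2 y11 y22) (image_perpE PP2 PP3 y22 y33).
rewrite (image_perpE PP3 PP4 y33 y44) (image_perpE PP1 PP6 y11 y66).
rewrite (image_perpE PP6 PP5 y66 y55) (image_perpE PP5 PP4 y55 y44') => p1 p2.
by rewrite (holonomy sys (And3 PP1 PP2 PP3) (And3 PP4 PP5 PP6) m1 m2
  (And4 Y1 Y2 Y3 Y4) (And3 Y6 Y5 Y4') p1 p2).
Qed.

End Transport.

(** * Points and lines of the octagon of G in terms of stars *)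

Section OctagonStars.
Variables (F : finFieldType) (Z : zorn_algebra F).
Hypothesis F4 : #|F| = 4.
Variables (gT : finGroupType) (G : {group gT}).
Variable f : {morphism zorn_aut_group Z >-> gT}.
Hypotheses (injf : 'injm f) (fG : f @* zorn_aut_group Z = G).
Local Notation A := (zorn_aut_group Z).
Local Notation Pts := (image_stars f (star_set Z)).
Local Notation perp := (image_perp injf (@root_perp F Z)).

Lemma star_sub P : P \in star_set Z -> P \subset A.
Proof.
case/star_setP=> p np ->; apply: subset_trans (star_group_sub F4 np).
exact: sub_gen.
Qed.

Lemma octagon_star_system : star_system Pts perp.
Proof. exact: image_star_system star_sub (root_star_system Z F4). Qed.

Lemma central_involutions_image : central_involutions G = f @: long_roots Z.
Proof.
have clf x : x \in A -> #|f x ^: G| = #|x ^: A|.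
  move=> xA; rewrite -fG -morphim_class // card_injm ?class_subG //.
apply/setP => y; apply/central_involutionP/imsetP => [[] | [x xr ->]].
  rewrite -{1}fG => /morphimP[x _ xA ->] o2 odd_x; exists x => //.
  rewrite -(central_involutions_aut Z F4); apply/central_involutionP.
  by rewrite -clf // -(order_injm injf xA).
have xA := long_roots_sub F4 xr.
have /central_involutionP[_ o2 odd_x] : x \in central_involutions A.
  by rewrite central_involutions_aut.
by rewrite clf // order_injm // -fG mem_morphim.
Qed.

Lemma cover_stars : f @: long_roots Z = cover Pts.
Proof.
apply/setP => y; apply/imsetP/bigcupP => [[x /long_rootsP[p np xp] ->] | ].
  by exists (f @: star p); rewrite imset_f // star_in_set.
case=> _ /imsetP[P /star_setP[p np ->] ->] /imsetP[x xp ->].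
by exists x => //; apply/long_rootsP; exists p.
Qed.

Lemma involution_linesP (D : pred nat) l :
  l \in involution_lines G D <-> exists x y,
    [/\ x \in long_roots Z, y \in long_roots Z, x != y, commute x y &
       l = [set f x; f y; f (x * y)] /\ D #|A : 'N_A(<<[set x; y]>>)|].
Proof.
have idx x y : x \in A -> y \in A ->
    #|G : 'N_G(<<[set f x; f y]>>)| = #|A : 'N_A(<<[set x; y]>>)|.
  move=> xA yA; have sA : [set x; y] \subset A.
    by apply/subsetP => z; rewrite in_set2 => /orP[] /eqP->.
  have -> : [set f x; f y] = f @* [set x; y].
    by rewrite morphimEsub // imsetU !imset_set1.
  rewrite -morphim_gen // -fG -injm_subnorm ?gen_subG //.
  by rewrite index_injm ?subsetIl.
rewrite inE central_involutions_image; split.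
  case/exists_inP=> _ /imsetP[x xr ->] /exists_inP[_ /imsetP[y yr ->]].
  have [xA yA] := (long_roots_sub F4 xr, long_roots_sub F4 yr).
  case/and4P=> ne /eqP xy /eqP El; rewrite idx // => Dxy; exists x, y; split=> //.
  - by apply: contraNneq ne => ->.
  - apply: (injmP injf); rewrite ?groupM // !morphM //.
  by rewrite El morphM.
case=> x [y [xr yr ne xy [El Dxy]]].
have [xA yA] := (long_roots_sub F4 xr, long_roots_sub F4 yr).
apply/exists_inP; exists (f x); first exact: imset_f.
apply/exists_inP; exists (f y); first exact: imset_f.
rewrite idx // Dxy andbT El -!morphM // xy !eqxx !andbT.
by apply: contraNneq ne => E; apply/eqP/(injmP injf).
Qed.

Lemma octagon_linesP l : l \in octagon_lines G <-> exists P x y,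
  [/\ P \in Pts, x \in P, y \in P, x != y & perp x y /\ l = [set x; y; x * y]].
Proof.
split=> [/involution_linesP[x [y [xr yr ne xy [El]]]] | ].
  rewrite index_perp // => pxy.
  have [p [np xp yp]] := commuting_concurrent F4 xr yr xy.
  have [xA yA] := (long_roots_sub F4 xr, long_roots_sub F4 yr).
  have sp := star_in_set np; exists (f @: star p), (f x), (f y).
  rewrite (imset_f _ sp) !imset_f // (image_neq injf star_sub sp) //.
  by rewrite (image_perpE injf (@root_perp F Z) star_sub sp sp) // El morphM.
case=> _ [_ [_ [/imsetP[P PP ->] /imsetP[x xp ->] /imsetP[y yp ->]]]].
rewrite (image_neq injf star_sub PP) // (image_perpE injf (@root_perp F Z) star_sub PP PP) //.
move=> ne [pxy ->]; apply/involution_linesP; exists x, y.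
have [p np EP] := star_setP _ PP; rewrite EP in xp yp.
have xr : x \in long_roots Z by apply/long_rootsP; exists p.
have yr : y \in long_roots Z by apply/long_rootsP; exists p.
have [xA yA] := (long_roots_sub F4 xr, long_roots_sub F4 yr).
have cxy : commute x y.
  by apply: (star_mulC (root_star_system Z F4) (star_in_set np)).
by rewrite morphM // index_perp.
Qed.

(** Index 1365 means that the line is a root group without 1, and by [star_meetE] these are the
    intersections of two stars. For x the elation of (p, v), the second star is that of v. *)
Lemma SstarP l : l \in Sstar G <-> exists P Q,
  [/\ P \in Pts, Q \in Pts, P != Q, meets P Q & l = P :&: Q].
Proof.
have root_neq1 x : x \in long_roots Z -> x != 1.
  move=> /(long_roots_order F4).
  by apply: contra_eqN => /eqP->; rewrite order1.
have lineE x y : x \in long_roots Z -> y \in root_line x -> x != y -> y != 1 ->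
    [set f x; f y; f (x * y)] = f @: (root_line x :\ 1).
  move=> xr yx ne y1; rewrite -(klein_root_line F4 xr yx ne y1).
  have [_ yr] := root_line_eq F4 xr yx y1.
  have -> : klein x y :\ 1 = [set x; y; x * y].
    apply/setP => z; rewrite in_setD1 in_klein 2!in_setU !in_set1 -orbA.
    case: eqP => [-> /= | //]; rewrite !(eq_sym 1) (negPf (root_neq1 x xr)) (negPf y1).
    apply/esym/eqP => E; case/eqP: ne; apply: (mulIg y).
    by rewrite E (long_roots_sqr F4).
  by rewrite !imsetU !imset_set1.
split=> [/involution_linesP[x [y [xr yr ne xy [El]]]] | ].
  rewrite /= index_1365 // => yx; have [p np xp] := long_rootsP _ xr.
  have [v [pv Ex x1]] := starP _ _ xp; rewrite Ex in x1.
  have nv := elation_neq0 F4 np pv x1.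
  have xv : x \in star v.
    have /andP[_ vp] := plane_sym np (null_neq0 nv) pv.
    by rewrite Ex (elationC F4 np nv pv) elation_star // -(elationC F4 np nv pv).
  have npv : star p != star v.
    apply/eqP => /(star_inj F4 np nv)[c Ec].
    by case: (@elation_nt _ Z F4 p v c).
  have [sp sv] := (star_in_set np, star_in_set nv).
  exists (f @: star p), (f @: star v); rewrite (imset_f _ sp) (imset_f _ sv).
  rewrite (image_meets injf star_sub) // (image_meet injf star_sub) //.
  rewrite (star_meetE F4 np nv npv xp xv) -(lineE x y) ?root_neq1 //.
  split=> //; last by apply/set0Pn; exists x; rewrite inE xp.
  have xA := long_roots_sub F4 xr.
  apply: contraNneq npv => E; rewrite eqEcard !card_star // leqnn andbT.
  apply/subsetP => z zp; rewrite -(mem_image_star injf star_sub sv) -?E ?imset_f //.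
  exact: subsetP (star_sub sp) z zp.
case=> _ [_ [/imsetP[P PP ->] /imsetP[Q QP ->] /image_star_neq ne]].
rewrite (image_meets injf star_sub) // => m ->.
have [[p np EP] [q nq EQ]] := (star_setP _ PP, star_setP _ QP).
have [x /setIP[xP xQ]] := set0Pn _ m; rewrite EP EQ in ne xP xQ.
rewrite (image_meet injf star_sub) // EP EQ (star_meetE F4 np nq ne xP xQ).
have xr : x \in long_roots Z by apply/long_rootsP; exists p.
have : 1 < #|root_line x :\ 1|.
  by have := cardsD1 1 (root_line x); rewrite card_root_line // root_lineN1 // => E;
    rewrite -(ltn_add2l true) -E.
rewrite (cardsD1 x) in_setD1 root_neq1 // root_line_id // ltnS.
case/card_gt0P => y; rewrite !in_setD1 => /and3P[yx y1 yL].
have [_ yr] := root_line_eq F4 xr yL y1.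
apply/involution_linesP; exists x, y.
have cxy : commute x y.
  have [p' [np' xp' yp' _]] := root_line_perp F4 xr yL y1.
  exact: (star_mulC (root_star_system Z F4) (star_in_set np')).
by rewrite eq_sym yx /= index_1365 1?eq_sym // lineE // eq_sym.
Qed.

End OctagonStars.

(** * The near octagon and its quads *)

Section Octagon.
Variables (gT : finGroupType) (G : {group gT}).
Variables (Pts : {set {set gT}}) (perp : rel gT).
Hypothesis sys : star_system Pts perp.
Hypothesis Gpoints : central_involutions G = cover Pts.
Hypothesis Glines : forall l, l \in octagon_lines G <-> exists P x y,
  [/\ P \in Pts, x \in P, y \in P, x != y & perp x y /\ l = [set x; y; x * y]].
Local Notation X := (octagon G).
Local Notation coll := (collinear (octagon G)).
Implicit Types (x y z u v w : gT) (P Q R A l n : {set gT}).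

Definition tri x y : {set gT} := [set x; y; x * y].

Lemma in_tri x y z : (z \in tri x y) = [|| z == x, z == y | z == x * y].
Proof. by rewrite !inE -orbA. Qed.

Lemma pointsE x : (x \in points X) = [exists P in Pts, x \in P].
Proof.
rewrite /= Gpoints; apply/bigcupP/exists_inP => -[P PP xP]; exists P => //.
Qed.

Lemma star_points P : P \in Pts -> P \subset points X.
Proof.
by move=> PP; apply/subsetP => x xP; rewrite pointsE; apply/exists_inP; exists P.
Qed.

Lemma tri_rot P x y : P \in Pts -> x \in P -> y \in P -> tri x y = tri x (x * y).
Proof.
move=> PP xP yP; have [_ xx] := star_inv sys PP xP; apply/setP => z.
by rewrite !in_tri mulgA xx mul1g; congr (_ || _); rewrite orbC.
Qed.

Lemma tri_sym P x y : P \in Pts -> x \in P -> y \in P -> tri x y = tri y x.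
Proof.
move=> PP xP yP; apply/setP => z; rewrite !in_tri (star_mulC sys PP xP yP).
by rewrite orbCA.
Qed.

Lemma tri_star P x y z : P \in Pts -> x \in P -> y \in P -> x != y -> perp x y ->
  z \in tri x y -> z \in P /\ perp x z.
Proof.
move=> PP xP yP ne xy; rewrite in_tri => /or3P[] /eqP ->; split=> //.
- exact: (perp_refl sys PP xP).
- exact: (star_mul sys PP xP yP ne).
by rewrite (perp_mul sys PP xP yP xP ne) xy (perp_refl sys PP xP).
Qed.

Lemma tri_eq P u v x y : P \in Pts -> u \in P -> v \in P -> u != v -> perp u v ->
  x \in tri u v -> y \in tri u v -> x != y ->
  [/\ tri u v = tri x y, x \in P, y \in P & perp x y].
Proof.
move=> PP uP vP ne uv xt yt nxy.
have [xP ux] := tri_star PP uP vP ne uv xt; have [yP uy] := tri_star PP uP vP ne uv yt.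
have uvP := star_mul sys PP uP vP ne.
have vu : perp v u by rewrite -(perp_sym sys PP uP vP).
have pxy : perp x y.
  have up w : w \in tri u v -> perp v w.
    rewrite (tri_sym PP uP vP) => wt.
    by have [|//] := tri_star PP vP uP _ vu wt; rewrite eq_sym.
  move: xt; rewrite in_tri => /or3P[] /eqP Ex; rewrite Ex //; first exact: up.
  rewrite (perp_sym sys PP uvP yP) (perp_mul sys PP uP vP yP ne).
  rewrite (perp_sym sys PP yP uP) uy (perp_sym sys PP yP vP).
  by rewrite up.
split=> //; move: xt yt nxy; rewrite !in_tri => xt yt nxy.
have R1 := tri_rot PP uP vP; have R2 := tri_sym PP uP vP.
have R3 := tri_rot PP vP uP; have R4 := tri_sym PP uP uvP.
have R5 := tri_sym PP vP uvP; have C := star_mulC sys PP uP vP.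
rewrite -C in R3.
by case/or3P: xt nxy => /eqP->; case/or3P: yt => /eqP->; rewrite ?eqxx // => _;
   rewrite -?R4 -?R5 -?R1 // -?R2 // R2 R3.
Qed.

Lemma line_tri P x y : P \in Pts -> x \in P -> y \in P -> x != y -> perp x y ->
  tri x y \in lines X.
Proof. by move=> PP xP yP ne xy; apply/Glines; exists P, x, y. Qed.

Lemma linesP l : l \in lines X -> exists P x y,
  [/\ P \in Pts, x \in P, y \in P, x != y & perp x y /\ l = tri x y].
Proof. by move/Glines. Qed.

Lemma line_points_octagon l : l \in lines X -> line_points X l = l.
Proof.
move=> /linesP[P [x [y [PP xP yP ne [xy ->]]]]]; apply/setP => z; rewrite inE.
apply: andb_idl => zt; have [zP _] := tri_star PP xP yP ne xy zt.
exact: subsetP (star_points PP) z zP.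
Qed.

Lemma card_tri P x y : P \in Pts -> x \in P -> y \in P -> x != y -> #|tri x y| = 3.
Proof.
move=> PP xP yP ne; have [[x1 _] [y1 _]] := (star_inv sys PP xP, star_inv sys PP yP).
have n1 : (x == x * y) = false by rewrite -{1}[x]mulg1 (inj_eq (mulgI x)) eq_sym (negPf y1).
have n2 : (y == x * y) = false by rewrite -{1}[y]mul1g (inj_eq (mulIg y)) eq_sym (negPf x1).
by rewrite /tri -setUA !cardsU1 cards1 !inE n1 n2 (negPf ne).
Qed.

Lemma line_eq l x y : l \in lines X -> x \in l -> y \in l -> x != y ->
  l = tri x y /\ exists P, [/\ P \in Pts, x \in P, y \in P & perp x y].
Proof.
move=> /linesP[P [u [v [PP uP vP ne [uv ->]]]]] xl yl nxy.
by have [-> xP yP xy] := tri_eq PP uP vP ne uv xl yl nxy; split=> //; exists P.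
Qed.

Lemma collP x y : reflect (x != y /\ exists P, [/\ P \in Pts, x \in P, y \in P & perp x y])
  (coll x y).
Proof.
apply: (iffP and4P) => [[_ _ ne /exists_inP[l lX /andP[xl yl]]] | [ne [P [PP xP yP xy]]]].
  by split=> //; have [_] := line_eq lX xl yl ne.
split; rewrite ?(subsetP (star_points PP)) //; apply/exists_inP; exists (tri x y).
  exact: line_tri PP xP yP ne xy.
by rewrite /= !in_tri !eqxx orbT.
Qed.

Lemma coll_sym x y : coll x y = coll y x.
Proof.
by apply/collP/collP => -[ne [P [PP xP yP xy]]]; rewrite eq_sym; split=> //;
   exists P; rewrite (perp_sym sys PP).
Qed.

Lemma coll_line l x y : l \in lines X -> x \in l -> y \in l -> x != y -> coll x y.
Proof. by move=> lX xl yl ne; apply/collP; have [_] := line_eq lX xl yl ne. Qed.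

(** Distinct stars that meet pairwise have a common point by [no_triangle]; then [meet_eq] makes
    their intersections the same root line. *)
Lemma share3 P Q R x y z : P \in Pts -> Q \in Pts -> R \in Pts ->
  x \in P -> y \in P -> y \in Q -> z \in Q -> z \in R -> x \in R ->
  [\/ z \in P, x \in Q | y \in R].
Proof.
move=> PP QP RP xP yP yQ zQ zR xR.
have [E | PQ] := eqVneq P Q; first by apply: Or32; rewrite -E.
have [E | QR] := eqVneq Q R; first by apply: Or32; rewrite E.
have [E | PR] := eqVneq P R; first by apply: Or31; rewrite E.
have [t [tP tQ tR]] : exists t, [/\ t \in P, t \in Q & t \in R].
  by apply: (no_triangle sys) => //; apply/set0Pn; [exists y | exists z | exists x];
     rewrite inE ?xP ?yP ?yQ ?zQ.
apply: Or32; have : x \in P :&: R by rewrite inE xP.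
by rewrite (meet_eq sys PP RP QP PR PQ tP tR tQ) => /setIP[].
Qed.

Lemma coll_triangle x y z : coll x y -> coll y z -> coll x z -> z \in tri x y.
Proof.
case/collP=> nxy [P [PP xP yP xy]] /collP[nyz [Q [QP yQ zQ yz]]].
case/collP=> nxz [R [RP xR zR xz]].
have [S [SP xS yS zS]] : exists S, [/\ S \in Pts, x \in S, y \in S & z \in S].
  by have [H|H|H] := share3 PP QP RP xP yP yQ zQ zR xR; [exists P|exists Q|exists R].
by rewrite (perp_max sys SP xS yS zS nxy nxz nyz xy xz yz) in_tri eqxx !orbT.
Qed.

(** The stars of xz and zy together with P fall under [share3], and two different stars have only
    perpendicular points in common, so a star containing both x and y is P. *)
Lemma star_convex P x y z : P \in Pts -> x \in P -> y \in P -> ~~ perp x y ->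
  coll x z -> coll z y -> z \in P.
Proof.
move=> PP xP yP nxy /collP[_ [Q [QP xQ zQ xz]]] /collP[_ [R [RP zR yR zy]]].
have [//|xR|yQ] := share3 PP RP QP xP yP yR zR zQ xQ.
  by have [-> //|PR] := eqVneq P R; rewrite (meet_perp sys PP RP PR) ?inE ?xP ?yP in nxy.
by have [-> //|PQ] := eqVneq P Q; rewrite (meet_perp sys PP QP PQ) ?inE ?xP ?yP in nxy.
Qed.

Lemma line_proj P z u v : P \in Pts -> z \in P -> u \in P -> v \in P -> u != v ->
  exists2 w, w \in tri u v & perp z w.
Proof.
move=> PP zP uP vP ne.
have [zu | zu] := boolP (perp z u); first by exists u; rewrite // in_tri eqxx.
have [zv | zv] := boolP (perp z v); first by exists v; rewrite // in_tri eqxx orbT.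
exists (u * v); first by rewrite in_tri eqxx !orbT.
by rewrite (perp_mul sys PP uP vP zP ne) (negPf zu) (negPf zv).
Qed.

Lemma line_proj_uniq P z u v w w' : P \in Pts -> z \in P -> u \in P -> v \in P ->
  u != v -> perp u v -> z \notin tri u v -> w \in tri u v -> w' \in tri u v ->
  perp z w -> perp z w' -> w = w'.
Proof.
move=> PP zP uP vP ne uv nz wt w't zw zw'; apply/eqP; apply: contraNT nz => nww'.
have [E wP w'P ww'] := tri_eq PP uP vP ne uv wt w't nww'.
rewrite E in_tri.
have [-> // | nzw] := eqVneq z w; have [-> // | nzw'] := eqVneq z w'.
rewrite (perp_max sys PP wP w'P zP) ?eqxx // 1?eq_sym //.
  by rewrite (perp_sym sys PP wP zP).
by rewrite (perp_sym sys PP w'P zP).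
Qed.

Lemma perp_exists P x : P \in Pts -> x \in P ->
  exists y, [/\ y \in P, x != y & perp x y].
Proof.
move=> PP xP; have [y yP nxy] := perp_nondeg sys PP xP.
have ne : x != y by apply: contraNneq nxy => <-; apply: (perp_refl sys PP).
have /subsetPn[z zP] : ~~ (P \subset tri x y).
  apply/negP => /subset_leq_card.
  by rewrite (card_star15 sys PP) (card_tri PP xP yP ne).
rewrite in_tri => /norP[zx /norP[zy zxy]].
have [xz | nxz] := boolP (perp x z); first by exists z; rewrite eq_sym.
have yz : y != z by rewrite eq_sym.
exists (y * z); split; first exact: (star_mul sys PP yP zP yz).
  apply: contraNneq zxy => ->; have [_ yy] := star_inv sys PP yP.
  by rewrite (star_mulC sys PP yP zP) -mulgA yy mulg1.
by rewrite (perp_mul sys PP yP zP xP yz) (negPf nxy) (negPf nxz).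
Qed.

Lemma common_neighbour P x y : P \in Pts -> x \in P -> y \in P -> ~~ perp x y ->
  exists z, [/\ z \in P, coll x z & coll z y].
Proof.
move=> PP xP yP nxy; have [u [uP nxu xu]] := perp_exists PP xP.
have [w wt yw] := line_proj PP yP xP uP nxu.
have [wP xw] := tri_star PP xP uP nxu xu wt.
exists w; split=> //; apply/collP; (split; last exists P); rewrite ?wP //.
- by apply: contraNneq nxy => ->; rewrite (perp_sym sys PP).
- by apply: contraNneq nxy => <-.
by rewrite (perp_sym sys PP wP yP).
Qed.

End Octagon.

Section Quads.
Variables (gT : finGroupType) (G : {group gT}).
Variables (Pts : {set {set gT}}) (perp : rel gT).
Hypothesis sys : star_system Pts perp.
Hypothesis Gpoints : central_involutions G = cover Pts.
Hypothesis Glines : forall l, l \in octagon_lines G <-> exists P x y,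
  [/\ P \in Pts, x \in P, y \in P, x != y & perp x y /\ l = [set x; y; x * y]].
Local Notation X := (octagon G).
Local Notation coll := (collinear (octagon G)).
Local Notation lines_P := (linesP Glines).
Implicit Types (x y z u v w a : gT) (P Q R A l n k : {set gT}).

Lemma star_coll P x y : P \in Pts -> x \in P -> y \in P ->
  coll x y = (x != y) && perp x y.
Proof.
move=> PP xP yP; apply/(collP sys Gpoints Glines)/andP => -[ne]; last by split=> //; exists P.
by case=> Q [].
Qed.

Lemma line_meet l n x y : l \in lines X -> n \in lines X -> x != y ->
  x \in l -> y \in l -> x \in n -> y \in n -> l = n.
Proof.
move=> lX nX ne xl yl xn yn.
by have [-> _] := line_eq sys Glines lX xl yl ne; have [<- _] := line_eq sys Glines nX xn yn ne.
Qed.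

Lemma line_card l : l \in lines X -> #|l| = 3.
Proof. by move/lines_P=> [P [x [y [PP xP yP ne [_ ->]]]]]; apply: (card_tri sys PP). Qed.

Lemma line_other l x : l \in lines X -> exists2 y, y \in l & y != x.
Proof.
move=> lX; have /subsetPn[y yl] : ~~ (l \subset [set x]).
  by apply/negP => /subset_leq_card; rewrite line_card // cards1.
by rewrite inE; exists y.
Qed.

Lemma line_sub P l x y : P \in Pts -> l \in lines X -> x \in l -> y \in l -> x != y ->
  x \in P -> y \in P -> l \subset P.
Proof.
move=> PP lX xl yl ne xP yP; have [-> _] := line_eq sys Glines lX xl yl ne.
by apply/subsetP => z; rewrite in_tri => /or3P[] /eqP -> //; apply: (star_mul sys PP).
Qed.

Lemma star_isotropic P l : P \in Pts -> l \in lines X -> l \subset P ->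
  exists x y, [/\ x \in P, y \in P, x != y, perp x y & l = tri x y].
Proof.
move=> PP lX lP; have /card_gt0P[x xl] : 0 < #|l| by rewrite line_card.
have [y yl] := line_other x lX; rewrite eq_sym => xy.
have [E [_ [_ _ _ pxy]]] := line_eq sys Glines lX xl yl xy.
by exists x, y; rewrite !(subsetP lP).
Qed.

Lemma line_coll_uniq l x u v : l \in lines X -> x \notin l -> u \in l -> v \in l ->
  coll x u -> coll x v -> u = v.
Proof.
move=> lX xl ul vl xu xv; apply/eqP; apply: contraNT xl => ne.
have uv := coll_line sys Gpoints Glines lX ul vl ne.
have [-> _] := line_eq sys Glines lX ul vl ne.
apply: (coll_triangle sys Gpoints Glines uv) => //;
  by rewrite (coll_sym sys Gpoints Glines).
Qed.

Lemma line_star_proj P l x : P \in Pts -> l \in lines X -> l \subset P -> x \in P ->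
  x \notin l -> exists2 y, y \in l & coll x y.
Proof.
move=> PP lX lP xP nx; have [u [v [uP vP ne uv El]]] := star_isotropic PP lX lP.
have [w wt xw] := line_proj sys PP xP uP vP ne; rewrite -El in wt.
have xw' : x != w by apply: contraNneq nx => ->.
by exists w; rewrite // (star_coll PP) ?xw' // (subsetP lP).
Qed.

Lemma star_line_miss P x : P \in Pts -> x \in P ->
  exists l, [/\ l \in lines X, l \subset P & x \notin l].
Proof.
move=> PP xP; have [y yP nxy] := perp_nondeg sys PP xP.
have [z [zP nyz yz]] := perp_exists sys PP yP; exists (tri y z); split.
- exact: (line_tri Glines PP).
- by apply/subsetP => t /(tri_star sys PP yP zP nyz yz)[].
apply: contra nxy => /(tri_star sys PP yP zP nyz yz)[_].
by rewrite (perp_sym sys PP yP xP).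
Qed.

Lemma induced_lines A l : (l \in lines (induced X A)) = (l \in lines X) && (l \subset A).
Proof.
rewrite [l \in lines (induced _ _)]in_set; case: (boolP (l \in lines X)) => //= lX.
by rewrite (line_points_octagon sys Gpoints Glines lX).
Qed.

Lemma induced_line_points A l : l \in lines X -> l \subset A ->
  line_points (induced X A) l = l.
Proof.
move=> lX lA; apply/setP => x; rewrite in_set in_setI.
apply: andb_idl => xl; rewrite (subsetP lA) // andbT.
by move: xl; rewrite -{1}(line_points_octagon sys Gpoints Glines lX) => /setIdP[].
Qed.

Lemma induced_coll A x y : collinear (induced X A) x y = coll x y && (tri x y \subset A).
Proof.
apply/idP/andP.
  case/and4P; rewrite inE /= => /andP[xX xA] /setIP[yX yA] ne /exists_inP[l].
  rewrite induced_lines => /andP[lX lA] /andP[xl yl].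
  have [E _] := line_eq sys Glines lX xl yl ne; rewrite -E; split=> //.
  exact: (coll_line sys Gpoints Glines lX).
case=> xy tA; have [xX yX ne _] := and4P xy.
have [xt yt] : x \in tri x y /\ y \in tri x y by rewrite !in_tri !eqxx orbT.
apply/and4P; split=> //; [by rewrite in_setI xX (subsetP tA) | by rewrite in_setI yX (subsetP tA) | ].
apply/exists_inP; exists (tri x y); last by rewrite /= xt yt.
rewrite induced_lines tA andbT.
by have [_ [P [PP xP yP pxy]]] := collP sys Gpoints Glines _ _ xy; apply: (line_tri Glines PP).
Qed.

Lemma induced_pls A : partial_linear_space (induced X A).
Proof.
apply/andP; split.
  apply/forall_inP => l; rewrite induced_lines => /andP[lX lA].
  by rewrite induced_line_points // line_card.
apply/forall_inP => x _; apply/forall_inP => y _; apply/implyP => ne.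
apply/card_le1_eqP => l n /setIP[/setIdP[lX xl] /setIdP[_ yl]].
case/setIP=> /setIdP[nX xn] /setIdP[_ yn].
rewrite !induced_lines in lX nX; case/andP: lX => lX _; case/andP: nX => nX _.
exact: (line_meet nX lX ne).
Qed.

Lemma star_dist P x y : P \in Pts -> x \in P -> y \in P ->
  connect coll x y /\ dist coll x y = (if x == y then 0 else if perp x y then 1 else 2)%N.
Proof.
move=> PP xP yP; have [<- | ne] := eqVneq x y; first by rewrite dist0.
have E := star_coll PP xP yP; rewrite ne /= in E.
have [xy | nxy] := boolP (perp x y).
  rewrite xy in E; by rewrite (dist1 E) // connect1.
have [z [zP xz zy]] := common_neighbour sys Gpoints Glines PP xP yP nxy.
rewrite (dist2 xz zy) ?E //; split=> //.
exact: connect_trans (connect1 xz) (connect1 zy).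
Qed.

Lemma star_is_convex P : P \in Pts -> convex X P.
Proof.
move=> PP; apply/forall_inP => x xP; apply/forall_inP => y yP.
have [_ E] := star_dist PP xP yP.
apply/forallP => p; apply/implyP => /andP[xp /eqP Ey]; apply/allP => z zp /=.
have := etrans (size_tuple p) E; case: (tval p) xp Ey zp => [|u [|v [|w s]]] //=; rewrite ?inE.
- by move=> _ -> /eqP->.
- have [// | ne] := eqVneq x y; have [// | nxy] := boolP (perp x y).
  case/and3P=> xu uv _ Ev; rewrite Ev in uv *.
  by case/orP=> /eqP -> // _; apply: (star_convex sys Gpoints Glines PP xP yP nxy xu).
by move=> _ _ _; case: ifP => // _; case: ifP.
Qed.

Lemma star_diameter P : P \in Pts -> diameter coll P = 2%N.
Proof.
move=> PP; apply/eqP; rewrite eqn_leq; apply/andP; split.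
  apply/bigmax_leqP => x xP; apply/bigmax_leqP => y yP.
  by have [_ ->] := star_dist PP xP yP; case: ifP => //; case: ifP.
have /card_gt0P[x xP] : 0 < #|P| by rewrite (card_star15 sys).
have [y yP nxy] := perp_nondeg sys PP xP.
apply: (leq_trans _ (leq_bigmax_cond _ xP)); apply: (leq_trans _ (leq_bigmax_cond _ yP)).
have [_ ->] := star_dist PP xP yP; rewrite (negPf nxy).
by case: eqP nxy => // <-; rewrite (perp_refl sys PP).
Qed.

Lemma star_quad P : P \in Pts -> P \in quads X.
Proof.
move=> PP; rewrite inE star_is_convex // star_diameter // eqxx (star_points Gpoints PP) /=.
apply/andP; split; first (apply/andP; split; first exact: induced_pls).
  apply/forall_inP => x /setIP[_ xP]; apply/forall_inP => l.
  rewrite induced_lines => /andP[lX lP]; apply/implyP => nx.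
  rewrite induced_line_points //.
  have [y yl xy] := line_star_proj PP lX lP xP nx.
  apply/cards1P; exists y; apply/setP => z; rewrite !inE induced_coll.
  apply/andP/eqP => [[zl /andP[xz _]] | ->]; first exact: (line_coll_uniq lX nx).
  split=> //; rewrite xy; have yP := subsetP lP y yl.
  move: xy; rewrite (star_coll PP) // => /andP[ne xy].
  by apply/subsetP => t /(tri_star sys PP xP yP ne xy)[].
apply/forall_inP => x /setIP[_ xP].
have [l [lX lP nx]] := star_line_miss PP xP.
by apply/exists_inP; exists l; rewrite // induced_lines lX.
Qed.

(** The four sides lie in stars P1, ..., P4, and [no_quadrangle] gives P2 = P4 or a common point of
    P1 and P3. In both cases [share3] and [meet_eq] put three consecutive vertices into one star,
    and [star_convex] adds the fourth. *)
Lemma quadrangle_star a b c d : coll a b -> coll b c -> coll c d -> coll d a ->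
  a != c -> ~~ coll a c -> b != d -> ~~ coll b d ->
  exists P, [/\ P \in Pts, a \in P, b \in P, c \in P & d \in P].
Proof.
move=> ab bc cd da nac cac nbd cbd.
have four x y z t P : coll y z -> coll z t -> coll t x -> x != z -> ~~ coll x z ->
    P \in Pts -> x \in P -> y \in P -> z \in P ->
    [/\ P \in Pts, x \in P, y \in P, z \in P & t \in P].
  move=> _ zt tx nxz cxz PP xP yP zP; split=> //.
  rewrite (star_coll PP) // nxz /= in cxz.
  by apply: (star_convex sys Gpoints Glines PP xP zP cxz); rewrite (coll_sym sys Gpoints Glines).
have [_ [P1 [PP1 a1 b1 _]]] := collP sys Gpoints Glines _ _ ab.
have [_ [P2 [PP2 b2 c2 _]]] := collP sys Gpoints Glines _ _ bc.
have [_ [P3 [PP3 c3 d3 _]]] := collP sys Gpoints Glines _ _ cd.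
have [_ [P4 [PP4 d4 a4 _]]] := collP sys Gpoints Glines _ _ da.
have nca : c != a by rewrite eq_sym.
have cca : ~~ coll c a by rewrite (coll_sym sys Gpoints Glines).
have ndb : d != b by rewrite eq_sym.
have cdb : ~~ coll d b by rewrite (coll_sym sys Gpoints Glines).
have abc P : P \in Pts -> a \in P -> b \in P -> c \in P ->
    exists P, [/\ P \in Pts, a \in P, b \in P, c \in P & d \in P].
  by move=> *; exists P; have [] := four a b c d P.
have bcd P : P \in Pts -> b \in P -> c \in P -> d \in P ->
    exists P, [/\ P \in Pts, a \in P, b \in P, c \in P & d \in P].
  by move=> *; exists P; have [] := four b c d a P.
have cda P : P \in Pts -> c \in P -> d \in P -> a \in P ->
    exists P, [/\ P \in Pts, a \in P, b \in P, c \in P & d \in P].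
  by move=> *; exists P; have [] := four c d a b P.
have dab P : P \in Pts -> d \in P -> a \in P -> b \in P ->
    exists P, [/\ P \in Pts, a \in P, b \in P, c \in P & d \in P].
  by move=> *; exists P; have [] := four d a b c P.
have mt P Q x : x \in P -> x \in Q -> meets P Q by move=> *; apply/set0Pn; exists x; rewrite inE; apply/andP.
have [E|] : P2 = P4 \/ meets P1 P3.
  by apply: (no_quadrangle sys) => //; split;
     [apply: (mt _ _ b)|apply: (mt _ _ c)|apply: (mt _ _ d)|apply: (mt _ _ a)].
  by apply: (abc P2); rewrite // E.
case/set0Pn=> e /setIP[e1 e3].
have [nc1|e2|b3] := share3 sys PP1 PP2 PP3 e1 b1 b2 c2 c3 e3.
- exact: (abc P1).
- have [d1|e4|a3] := share3 sys PP1 PP4 PP3 e1 a1 a4 d4 d3 e3.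
  + exact: (dab P1).
  + have [E|ne12] := eqVneq P1 P2; first by apply: (abc P1); rewrite // E.
    have [E|ne14] := eqVneq P1 P4; first by apply: (dab P1); rewrite // E.
    have : b \in P1 :&: P2 by rewrite inE b1.
    rewrite (meet_eq sys PP1 PP2 PP4 ne12 ne14 e1 e2 e4) => /setIP[_ b4].
    exact: (dab P4).
  exact: (cda P3).
exact: (bcd P3).
Qed.

(** Nondegeneracy yields two disjoint lines k and n of the quad. They carry an ordinary quadrangle,
    hence lie in a single star P by [quadrangle_star]; the collinearities with two lines then show
    that P and A contain each other. *)
Lemma quad_star A : A \in quads X -> A \in Pts.
Proof.
rewrite inE => /and5P[AX cvx /eqP diam /andP[_ /forall_inP gqA] /forall_inP ndA].
have inA x : x \in A -> x \in points (induced X A).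
  by move=> xA; rewrite in_setI xA (subsetP AX).
have ndeg x : x \in A -> exists l, [/\ l \in lines X, l \subset A & x \notin l].
  move=> /inA /ndA /exists_inP[l]; rewrite induced_lines => /andP[lX lA] nx.
  by exists l.
have gq x l : x \in A -> l \in lines X -> l \subset A -> x \notin l ->
    exists y, [/\ y \in l, coll x y & tri x y \subset A].
  move=> /inA /gqA /forall_inP/(_ l) + lX lA nx.
  rewrite induced_lines lX lA nx => /(_ isT) /cards1P[y /setP/(_ y)].
  rewrite set11 inE induced_line_points // induced_coll => /and3P[yl xy tA].
  by exists y.
have conv x y z : x \in A -> y \in A -> x != y -> ~~ coll x y -> coll x z -> coll z y ->
    z \in A.
  move=> xA yA ne nxy xz zy; have d2 := dist2 xz zy ne nxy.
  have /forall_inP/(_ y yA) := forall_inP cvx x xA; rewrite d2 => /forallP/(_ [tuple z; y]).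
  by rewrite /= xz zy eqxx /= => /andP[].
have sy := coll_sym sys Gpoints Glines.
have [x xA] : exists x, x \in A.
  apply/set0Pn; apply: contra_eq_neq diam => ->.
  by rewrite /diameter big_set0.
have [l [lX lA xl]] := ndeg x xA; have [y [yl xy xyA]] := gq x l xA lX lA xl.
have yA := subsetP lA y yl; have [n [nX nA yn]] := ndeg y yA.
have mX : tri x y \in lines X.
  by have [ne [P [PP xP yP pxy]]] := collP sys Gpoints Glines _ _ xy; apply: (line_tri Glines PP).
have [xm ym] : x \in tri x y /\ y \in tri x y by rewrite !in_tri !eqxx orbT.
(* Of the two lines l and xy through y at least one misses n: otherwise their points on n would both
   be collinear with y, hence equal, and the two lines would coincide. *)
have [k [kX kA yk dkn]] : exists k, [/\ k \in lines X, k \subset A, y \in k & [disjoint k & n]].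
  have [dl|/pred0Pn[p /andP[/= pl pn]]] := boolP [disjoint l & n]; first by exists l.
  have [dm|/pred0Pn[q /andP[/= qm qn]]] := boolP [disjoint tri x y & n]; first by exists (tri x y).
  have yp : y != p by apply: contraNneq yn => ->.
  have yq : y != q by apply: contraNneq yn => ->.
  have Epq : p = q.
    by apply: (line_coll_uniq nX yn) => //; [apply: (coll_line sys Gpoints Glines lX)
        | apply: (coll_line sys Gpoints Glines mX)].
  rewrite -Epq in qm; rewrite (line_meet lX mX yp) // in xl.
  by rewrite xm in xl.
have [z [zn yz _]] := gq y n yA nX nA yn.
have [b bk byn] := line_other y kX.
have nz u : u \in k -> u \in n -> False by move=> uk; rewrite (disjointFr dkn).
have nbn : b \notin n by apply/negP; apply: nz.
have [c [cn bc _]] := gq b n (subsetP kA b bk) nX nA nbn.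
have yb' : y != b by rewrite eq_sym.
have yb : coll y b by apply: (coll_line sys Gpoints Glines kX).
have sep u : u \in n -> coll y u -> coll b u -> False.
  move=> un yu bu; apply: (nz u) => //.
  have [->  _] := line_eq sys Glines kX yk bk yb'.
  by apply: (coll_triangle sys Gpoints Glines).
have nzc : z != c by apply/eqP => E; apply: (sep z); rewrite // E.
have zc : coll z c by apply: (coll_line sys Gpoints Glines nX).
have [||||||P [PP yP bP cP zP]] := @quadrangle_star y b c z yb bc.
- by rewrite sy.
- by rewrite sy.
- by apply: contraNneq yn => ->.
- by apply/negP => yc; apply: (sep c).
- by apply: contraNneq nbn => ->.
- by apply/negP => bz; apply: (sep z).
have kP : k \subset P by apply: (line_sub PP kX yk bk); rewrite // eq_sym.
have nP : n \subset P by apply: (line_sub PP nX zn cn).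
(* A point w of P is collinear with some u on k and some v on n. If u and v are not collinear, w is
   in A by convexity; if they are, w is on the line uv, which the quadrangle axiom puts in A. *)
have PA : P \subset A.
  apply/subsetP => w wP; apply: contraT => wA.
  have wk : w \notin k by apply: contra wA; apply: (subsetP kA).
  have wn : w \notin n by apply: contra wA; apply: (subsetP nA).
  have [u uk wu] := line_star_proj PP kX kP wP wk.
  have [v vn wv] := line_star_proj PP nX nP wP wn.
  have uv : u != v by apply/eqP => E; apply: (nz u); rewrite // E.
  have [uP vP] := (subsetP kP u uk, subsetP nP v vn).
  have [uA vA] := (subsetP kA u uk, subsetP nA v vn).
  have [cuv|nuv] := boolP (coll u v); last first.
    by rewrite (conv u v w) // sy in wA.
  have un : u \notin n by apply/negP; apply: nz.
  have [v' [v'n uv' tA]] := gq u n uA nX nA un.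
  have Ev : v' = v by apply: (line_coll_uniq nX un).
  rewrite Ev in tA; rewrite (subsetP tA) // in wA.
  by apply: (coll_triangle sys Gpoints Glines) => //; rewrite sy.
suff -> : A = P by [].
apply/eqP; rewrite eqEsubset PA andbT; apply/subsetP => w wA.
apply: contraT => wP; have wk : w \notin k by apply: contra wP; apply: (subsetP kP).
have [u [uk wu _]] := gq w k wA kX kA wk; have uP := subsetP kP u uk.
(* A line of P that avoids u provides a second neighbour v of w in P, so that w is on the line uv or
   is a common neighbour of non-collinear points of P. *)
have [m [mX' mP um]] := star_line_miss PP uP.
have wm : w \notin m by apply: contra wP; apply: (subsetP mP).
have [v [vm wv _]] := gq w m wA mX' (subset_trans mP PA) wm.
have vP := subsetP mP v vm.
have uv : u != v by apply: contraNneq um => ->.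
have uw : coll u w by rewrite sy.
rewrite -(negbTE wP); have [puv|npuv] := boolP (perp u v); last first.
  exact: (star_convex sys Gpoints Glines PP uP vP npuv).
have [|//] := tri_star sys PP uP vP uv puv (z := w).
apply: (coll_triangle sys Gpoints Glines) => //; last by rewrite sy.
by rewrite (star_coll PP) // uv.
Qed.

Lemma quads_stars : Qstar G = Pts.
Proof. by apply/setP => A; apply/idP/idP; [apply: quad_star | apply: star_quad]. Qed.

End Quads.

(** * The suboctagon of a subhexagon of order (4, 1) *)

Section Projection.
Variables (gT : finGroupType) (G : {group gT}).
Variables (Pts : {set {set gT}}) (perp : rel gT).
Hypothesis sys : star_system Pts perp.
Hypothesis Gpoints : central_involutions G = cover Pts.
Hypothesis Glines : forall l, l \in octagon_lines G <-> exists P x y,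
  [/\ P \in Pts, x \in P, y \in P, x != y & perp x y /\ l = [set x; y; x * y]].
Variable Q : {set {set gT}}.
Hypothesis QP : Q \subset Pts.
(** All that the subhexagon of order (4, 1) contributes: exactly two of its stars pass through each
    of its points, and a star is reached from a point by a chain of at most three stars. *)
Hypothesis two_stars : forall q x, q \in Q -> x \in q -> exists q',
  [/\ q' \in Q, q' != q, x \in q' & forall p, p \in Q -> x \in p -> p = q \/ p = q'].
Hypothesis near_stars : forall q0 x q, q0 \in Q -> x \in q0 -> q \in Q ->
  [\/ x \in q, exists q1, [/\ q1 \in Q, x \in q1 & meets q1 q] |
      exists q1 q2, [/\ q1 \in Q, q2 \in Q, x \in q1, meets q1 q2 & meets q2 q]].
Implicit Types (x y z u v w : gT) (p q l : {set gT}) (k n m : nat).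

Let inP q : q \in Q -> q \in Pts. Proof. exact: subsetP. Qed.

Lemma meetsI (p q : {set gT}) x : x \in p -> x \in q -> meets p q.
Proof. by move=> xp xq; apply/set0Pn; exists x; rewrite inE xp. Qed.

Lemma meets_sym p q : meets p q = meets q p.
Proof. by rewrite /meets setIC. Qed.

Lemma meet_tri p q : p \in Pts -> q \in Pts -> p != q -> meets p q ->
  exists u v, [/\ u \in p, v \in p, u != v, perp u v & p :&: q = tri u v].
Proof.
move=> pP qP ne pq; have c3 := card_meet sys pP qP ne pq.
have [u um] := set0Pn _ pq.
have /subsetPn[v vm] : ~~ (p :&: q \subset [set u]).
  by apply/negP => /subset_leq_card; rewrite c3 cards1.
rewrite inE eq_sym => uv; have [[up uq] [vp vq]] := (setIP um, setIP vm).
exists u, v; split=> //; first exact: (meet_perp sys pP qP ne).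
apply/eqP; rewrite eq_sym eqEcard c3 (card_tri sys pP) // andbT.
by apply/subsetP => z; rewrite in_tri => /or3P[] /eqP->; rewrite // inE !(star_mul sys).
Qed.

Lemma meet_proj p q x : p \in Pts -> q \in Pts -> p != q -> meets p q -> x \in p ->
  exists z, [/\ z \in p, z \in q & perp x z].
Proof.
move=> pP qP ne pq xp; have [u [v [up vp uv puv E]]] := meet_tri pP qP ne pq.
have [w wt xw] := line_proj sys pP xp up vp uv; exists w.
by move: wt; rewrite -E => /setIP[].
Qed.

Lemma meet_proj_uniq p q x z w : p \in Pts -> q \in Pts -> x \in p -> x \notin q ->
  z \in p -> z \in q -> perp x z -> w \in p -> w \in q -> perp x w -> z = w.
Proof.
move=> pP qP xp xq zp zq xz wp wq xw.
have ne : p != q by apply: contraNneq xq => <-.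
have [u [v [up vp uv puv E]]] := meet_tri pP qP ne (meetsI zp zq).
apply: (line_proj_uniq sys pP xp up vp uv puv) => //; rewrite -E inE.
- by rewrite (negPf xq) andbF.
- by rewrite zp.
by rewrite wp.
Qed.

Let three p q r x : p \in Q -> q \in Q -> r \in Q -> p != q -> q != r -> p != r ->
  x \in p -> x \in q -> x \in r -> False.
Proof.
move=> pQ qQ rQ /eqP pq /eqP qr /eqP pr xp xq xr.
have [p' [_ _ _ only]] := two_stars pQ xp.
have [E|Eq] := only q qQ xq; first by rewrite E in pq.
by have [E|Er] := only r rQ xr; [rewrite E in pr | rewrite Eq Er in qr].
Qed.

(** Three such stars would have a common point by [no_triangle], while only two stars of Q pass
    through a point. *)
Let triangle p q r : p \in Q -> q \in Q -> r \in Q -> p != q -> q != r -> p != r ->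
  meets p q -> meets q r -> meets p r -> False.
Proof.
move=> pQ qQ rQ pq qr pr mpq mqr mpr.
have [x [xp xq xr]] := no_triangle sys (inP pQ) (inP qQ) (inP rQ) pq qr pr mpq mqr mpr.
exact: (three pQ qQ rQ pq qr pr xp xq xr).
Qed.

(* [proj x q k z]: the star q is at distance k from x, and z is the point of q
   nearest to x. *)
Inductive proj x q : nat -> gT -> Prop :=
| Proj0 : x \in q -> proj x q 0 x
| Proj1 q1 z : x \notin q -> q1 \in Q -> x \in q1 -> z \in q1 -> z \in q ->
    perp x z -> proj x q 1 z
| Proj2 q1 q2 z1 z : (forall p, p \in Q -> x \in p -> ~~ meets p q) ->
    q1 \in Q -> q2 \in Q -> x \in q1 -> z1 \in q1 -> z1 \in q2 -> perp x z1 ->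
    z \in q2 -> z \in q -> perp z1 z -> proj x q 2 z.

Lemma proj_mem x q k z : proj x q k z -> z \in q.
Proof. by case. Qed.

Lemma proj_exists q0 x q : q0 \in Q -> x \in q0 -> q \in Q ->
  exists k z, proj x q k z.
Proof.
move=> q0Q xq0 qQ; have [xq|nxq] := boolP (x \in q); first by exists 0%N, x; apply: Proj0.
have lev1 q1 : q1 \in Q -> x \in q1 -> meets q1 q -> exists k z, proj x q k z.
  move=> q1Q xq1 m1; have ne : q1 != q by apply: contraNneq nxq => <-.
  have [z [zq1 zq xz]] := meet_proj (inP q1Q) (inP qQ) ne m1 xq1.
  by exists 1%N, z; apply: (Proj1 nxq q1Q).
have [|[q1 [q1Q xq1 m1]]|[q1 [q2 [q1Q q2Q xq1 m12 m2]]]] := near_stars q0Q xq0 qQ.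
- by rewrite (negPf nxq).
- exact: (lev1 q1).
have [/exists_inP[p pQ /andP[xp mp]]|none] := boolP [exists p in Q, (x \in p) && meets p q].
  exact: (lev1 p).
have far p : p \in Q -> x \in p -> ~~ meets p q.
  by move=> pQ xp; apply: contraNN none => mp; apply/exists_inP; exists p; rewrite ?xp.
have ne12 : q1 != q2 by apply: contraTneq m2 => <-; apply: far.
have ne2 : q2 != q by apply: contraTneq m12 => ->; apply: far.
have [z1 [z11 z12 xz1]] := meet_proj (inP q1Q) (inP q2Q) ne12 m12 xq1.
have [z [z2 zq zz]] := meet_proj (inP q2Q) (inP qQ) ne2 m2 z12.
by exists 2%N, z; apply: (Proj2 far q1Q q2Q xq1 z11 z12).
Qed.

(** Two different chains from x to q would close up to a triangle, a quadrangle or a pentagon of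
    stars. Along a fixed chain every projection is unique, since the point projected is not on the
    next star. *)
Lemma proj_uniq x q k z k' z' : q \in Q -> proj x q k z -> proj x q k' z' ->
  k = k' /\ z = z'.
Proof.
move=> qQ; case=> [xq|q1 {}z nxq q1Q xq1 zq1 zq xz|q1 q2 z1 {}z far q1Q q2Q xq1 z11 z12 xz1 z2 zq zz].
- case=> [//|q1 {}z'|q1 q2 z1 {}z' far]; first by rewrite xq.
  by have := far q qQ xq; rewrite (meetsI xq xq).
- case=> [xq|q1' {}z' _ q1'Q xq1' zq1' z'q xz'|q1' q2 z1 {}z' far].
  + by rewrite xq in nxq.
  + split=> //; have [E|ne] := eqVneq q1 q1'.
      rewrite -E in zq1'.
      exact: (meet_proj_uniq (inP q1Q) (inP qQ) xq1 nxq).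
    have n1 : q1 != q by apply: contraNneq nxq => <-.
    have n1' : q1' != q by apply: contraNneq nxq => <-.
    by case: (triangle q1Q q1'Q qQ ne n1' n1 (meetsI xq1 xq1') (meetsI zq1' z'q) (meetsI zq1 zq)).
  by have := far q1 q1Q xq1; rewrite (meetsI zq1 zq).
case=> [xq|q1' {}z' _ q1'Q xq1' zq1' z'q xz'|q1' q2' z1' {}z' _ q1'Q q2'Q xq1' z11' z12' xz1' z2' z'q zz'].
- by have := far q qQ xq; rewrite (meetsI xq xq).
- by have := far q1' q1'Q xq1'; rewrite (meetsI zq1' z'q).
split=> //; have f1 := far q1 q1Q xq1; have f1' := far q1' q1'Q xq1'.
have n12 : q1 != q2 by apply: contraNneq f1 => ->; apply: meetsI z2 zq.
have n12' : q1' != q2' by apply: contraNneq f1' => ->; apply: meetsI z2' z'q.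
have n2 : q2 != q by apply: contraNneq f1 => <-; apply: meetsI z11 z12.
have n2' : q2' != q by apply: contraNneq f1' => <-; apply: meetsI z11' z12'.
have E1 : q1 = q1'.
  apply/eqP; apply: contraT => ne.
  have ne22 : q2 != q2'.
    apply/eqP => E; case: (triangle q1Q q2Q q1'Q) => //.
    - by rewrite E eq_sym.
    - exact: meetsI z11 z12.
    - by rewrite E; apply: meetsI z12' z11'.
    exact: meetsI xq1 xq1'.
  have [m|m] : meets q1 q \/ meets q2 q2'.
    apply: (@no_pentagon _ _ _ sys q1 q2 q q2' q1'); first by split; apply: inP.
    split; [exact: meetsI z11 z12 | exact: meetsI z2 zq | exact: meetsI z'q z2'
      | exact: meetsI z12' z11' | exact: meetsI xq1' xq1].
    by rewrite m in f1.
  case: (triangle q2Q qQ q2'Q) => //; first by rewrite eq_sym.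
    exact: meetsI z2 zq.
  exact: meetsI z'q z2'.
rewrite -E1 in z11' n12' => {q1' q1'Q xq1' f1' E1}.
have E2 : q2 = q2'.
  have [//|m] : q2 = q2' \/ meets q1 q.
    apply: (@no_quadrangle _ _ _ sys q1 q2 q q2'); first by split; apply: inP.
    split; [exact: meetsI z11 z12 | exact: meetsI z2 zq | exact: meetsI z'q z2'
      | exact: meetsI z12' z11'].
  by rewrite m in f1.
rewrite -E2 in z2' z12' => {q2' q2'Q n12' n2' E2}.
have Ez : z1 = z1'.
  apply: (meet_proj_uniq (inP q1Q) (inP q2Q) xq1) => //.
  by apply/negP => xq2; have := far q2 q2Q xq2; rewrite (meetsI z2 zq).
rewrite -Ez in zz'; apply: (meet_proj_uniq (inP q2Q) (inP qQ) z12) => //.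
by apply/negP => z1q; rewrite (meetsI z11 z1q) in f1.
Qed.

Definition star_distance z y := (if z == y then 0 else if perp z y then 1 else 2)%N.

(** The line of p and q is totally isotropic and w is its only point perpendicular to z, so every
    other y on it is adjacent to w and at distance 2 from z. *)
Lemma star_distance_step p q z w y : p \in Pts -> q \in Pts -> z \in p -> z \notin q ->
  w \in p -> w \in q -> perp z w -> y \in p -> y \in q ->
  star_distance z y = (star_distance w y).+1.
Proof.
move=> pP qP zp zq wp wq zw yp yq; rewrite /star_distance.
have pq : p != q by apply: contraNneq zq => <-.
have -> : (z == y) = false by apply: contraNF zq => /eqP->.
have [<-|ne] := eqVneq w y; first by rewrite zw.
have -> : perp w y by apply: (meet_perp sys pP qP pq); rewrite inE ?wp ?yp.
by case: ifP => // zy; case/eqP: ne; apply: (meet_proj_uniq pP qP zp zq).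
Qed.

(** Let k <= k'. If k' = k + 1, the chain to q followed by q' is the chain to q', and
    [star_distance_step] compares the distances. A larger gap is impossible because q meets q', and
    k = k' = 1 would close a triangle or quadrangle. For k = k' = 2 both sides are compared with the
    projection on the line of q and q'. *)
Lemma proj_distance x q q' k k' z z' y : q \in Q -> q' \in Q -> y \in q -> y \in q' ->
  proj x q k z -> proj x q' k' z' ->
  (k + star_distance z y = k' + star_distance z' y)%N.
Proof.
move=> qQ q'Q yq yq'; have [<- pz pz'|ne] := eqVneq q q'.
  by have [-> ->] := proj_uniq qQ pz pz'.
have m := meetsI yq yq'; have m' : meets q' q by rewrite meets_sym.
have ne' : q' != q by rewrite eq_sym.
wlog: q q' k k' z z' qQ q'Q yq yq' ne ne' m m' / (k <= k')%N.
  move=> W pz pz'; have [le|/ltnW le] := leqP k k'; first exact: (W q q').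
  by apply/esym; apply: (W q' q).
move=> le pz pz'; case: pz pz' le => [xq|q1 {}z nxq q1Q xq1 zq1 zq xz|q1 q2 z1 {}z far q1Q q2Q xq1 z11 z12 xz1 z2 zq zz].
- case=> [//|q1 {}z' nxq' q1Q xq1 zq1 zq' xz|q1 q2 z1 {}z' far] _.
    have E : q1 = q.
      apply/eqP; apply: contraT => n1; case: (triangle q1Q qQ q'Q) => //.
      - by apply: contraNneq nxq' => <-.
      - exact: meetsI xq1 xq.
      exact: meetsI zq1 zq'.
    rewrite E in zq1; exact: (star_distance_step (inP qQ) (inP q'Q)).
  by have := far q qQ xq; rewrite m.
- case=> [//|q1' {}z' nxq' q1'Q xq1' zq1' zq' xz'|q1' q2' z1' {}z' far q1'Q q2'Q xq1' z11' z12' xz1' z2' z'q' zz'] _.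
    have n1 : q1 != q by apply: contraNneq nxq => <-.
    have n1' : q1' != q' by apply: contraNneq nxq' => <-.
    have nq' : q1 != q' by apply: contraNneq nxq' => <-.
    have nq : q1' != q by apply: contraNneq nxq => <-.
    have [E|n11] := eqVneq q1 q1'.
      rewrite -E in zq1'; case: (triangle q1Q qQ q'Q) => //.
        exact: meetsI zq1 zq.
      exact: meetsI zq1' zq'.
    have [E|mm] : q = q1' \/ meets q1 q'.
      apply: (@no_quadrangle _ _ _ sys q1 q q' q1'); first by split; apply: inP.
      by split=> //; [exact: meetsI zq1 zq | exact: meetsI zq' zq1' | exact: meetsI xq1' xq1].
      by rewrite E eqxx in nq.
    case: (triangle q1Q qQ q'Q) => //; exact: meetsI zq1 zq.
  have [w [wq wq' zw]] := meet_proj (inP qQ) (inP q'Q) ne m zq.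
  have pw : proj x q' 2 w by apply: (Proj2 far q1Q qQ xq1 zq1 zq xz).
  have pz' : proj x q' 2 z' by apply: (Proj2 far q1'Q q2'Q xq1' z11' z12').
  have [_ <-] := proj_uniq q'Q pw pz'; rewrite add1n add2n; congr _.+1.
  apply: (star_distance_step (inP qQ) (inP q'Q)) => //.
  by apply/negP => zq'; have := far q1 q1Q xq1; rewrite (meetsI zq1 zq').
case=> [//|//|q1' q2' z1' {}z' far' q1'Q q2'Q xq1' z11' z12' xz1' z2' z'q' zz'] _.
have f1 := far q1 q1Q xq1; have f1' := far q1' q1'Q xq1'.
have g1 := far' q1 q1Q xq1; have g1' := far' q1' q1'Q xq1'.
have m1 := meetsI z11 z12; have m1' := meetsI z11' z12'.
have m2 := meetsI z2 zq; have m2' := meetsI z2' z'q'.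
have n12 : q1 != q2 by apply: contraNneq f1 => ->.
have n12' : q1' != q2' by apply: contraNneq g1' => ->.
have n2 : q2 != q by apply: contraNneq f1 => <-.
have n2' : q2' != q' by apply: contraNneq g1' => <-.
have nx : q2 != q' by apply: contraNneq g1 => <-.
have nx' : q2' != q by apply: contraNneq f1' => <-.
have mx : ~~ meets q2 q' by apply/negP => mx; apply: (triangle q2Q qQ q'Q).
have mx' : ~~ meets q2' q by apply/negP => mx'; apply: (triangle q2'Q q'Q qQ).
have n11 : q1 != q1'.
  apply/eqP => E; rewrite -E in m1'.
  have [a|a] : meets q1 q \/ meets q2 q'.
    apply: (@no_pentagon _ _ _ sys q1 q2 q q' q2'); first by split; apply: inP.
    by split=> //; rewrite meets_sym.
    by rewrite a in f1.
  by rewrite a in mx.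
have m11 := meetsI xq1 xq1'; have m11' := meetsI xq1' xq1.
have n11' : q1' != q1 by rewrite eq_sym.
have n21' : q2 != q1' by apply: contraNneq f1' => <-.
have n2'1 : q2' != q1 by apply: contraNneq g1 => <-.
have [w [wq wq' zw]] := meet_proj (inP qQ) (inP q'Q) ne m zq.
have [w' [w'q' w'q zw']] := meet_proj (inP q'Q) (inP qQ) ne' m' z'q'.
(* The hexagon is q1', q1, q2, q, q', q2'. From x, on the line of q1' and q1, the two ways round
   lead to w and w' on the opposite line, that of q and q'. *)
have Ew : w = w'.
  apply: (@holonomy _ _ _ sys q1' q1 q2 q q' q2' _ _ _ _ x z1 z w w' z' z1').
  - by split; apply: inP.
  - by split; apply: inP.
  - split=> //; rewrite meets_sym; apply/negP => a; apply: (triangle q1Q q2Q q1'Q) => //.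
  - split; first by rewrite meets_sym.
      by rewrite meets_sym.
    by apply/negP => a; apply: (triangle q1'Q q2'Q q1Q).
  - by rewrite !inE xq1' xq1 z11 z12 z2 zq wq wq'.
  - by rewrite !inE z12' z11' z'q' z2' w'q w'q'.
  - by [].
  by [].
have nz : z \notin q' by apply: contra mx => zq'; apply: meetsI z2 zq'.
have nz' : z' \notin q by apply: contra mx' => z'q; apply: meetsI z2' z'q.
rewrite (star_distance_step (inP qQ) (inP q'Q) zq nz wq wq' zw yq yq').
by rewrite (star_distance_step (inP q'Q) (inP qQ) z'q' nz' w'q' w'q zw' yq' yq) Ew.
Qed.

(** The geometry of the theorem with its point set written as [cover Q]; [subhexagon_points]
    identifies the two forms. *)
Definition suboctagon : geometry gT {set gT} :=
  Geometry (cover Q) [set l in octagon_lines G | [exists q in Q, l \subset q]]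
    (fun x l => x \in l).
Local Notation X := (octagon G).
Local Notation Y := suboctagon.
Local Notation coll := (collinear suboctagon).

Lemma sub_linesP l : l \in lines Y <-> l \in lines X /\ exists2 q, q \in Q & l \subset q.
Proof. by rewrite in_set; split=> [/andP[? /exists_inP]|[? /exists_inP ?]]; last apply/andP. Qed.

Lemma sub_pointsP x : x \in points Y <-> exists2 q, q \in Q & x \in q.
Proof. by split=> /bigcupP. Qed.

Lemma sub_line_points l : l \in lines Y -> line_points Y l = l.
Proof.
move=> /sub_linesP[_ [q qQ lq]]; apply/setP => x; rewrite in_set; apply: andb_idl => xl.
by apply/sub_pointsP; exists q => //; apply: (subsetP lq).
Qed.

Lemma sub_collP x y :
  coll x y <-> x != y /\ exists q, [/\ q \in Q, x \in q, y \in q & perp x y].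
Proof.
split=> [/and4P[_ _ ne /exists_inP[l /sub_linesP[lX [q qQ lq]] /andP[xl yl]]]|].
  split=> //; exists q; rewrite !(subsetP lq) //.
  by have [_ [P []]] := line_eq sys Glines lX xl yl ne.
case=> ne [q [qQ xq yq xy]]; apply/and4P; split=> //; try by apply/sub_pointsP; exists q.
apply/exists_inP; exists (tri x y); last by rewrite /= !in_tri !eqxx orbT.
apply/sub_linesP; split; first exact: (line_tri Glines (inP qQ)).
by exists q => //; apply/subsetP => z /(tri_star sys (inP qQ) xq yq ne xy)[].
Qed.

Lemma star_distanceS q z y w : q \in Pts -> z \in q -> y \in q -> perp y w ->
  (star_distance z w <= (star_distance z y).+1)%N.
Proof.
move=> qP zq yq yw; rewrite /star_distance; have [-> //|] := eqVneq z w.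
case: (boolP (perp z w)) => // zw _.
by case: eqP zw => [->|_]; rewrite ?yw //; case: ifP.
Qed.

Let tri_distance x y n := exists q k z,
  [/\ q \in Q, y \in q, proj x q k z & n = (k + star_distance z y)%N].

(** This is [dist_rel] for [tri_distance], which is single-valued by [proj_distance]. Adjacent
    points share a star of Q, which bounds the increase; the descent goes towards the projection z
    inside the star and, once at z, back along the chain. *)
Lemma suboctagon_dist q0 x q k z y : q0 \in Q -> x \in q0 -> q \in Q -> proj x q k z ->
  y \in q -> connect coll x y /\ dist coll x y = (k + star_distance z y)%N.
Proof.
move=> q0Q xq0 qQ pz yq.
suff D n : tri_distance x y n -> connect coll x y /\ dist coll x y = n.
  by apply: D; exists q, k, z.
move: y n {qQ pz yq}; apply: dist_rel.
- by exists q0, 0%N, x; rewrite /star_distance eqxx; split=> //; apply: Proj0.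
- move=> y n m [p [i [u [pQ yp pu ->]]]] [p' [j [v [p'Q yp' pv ->]]]].
  exact: (proj_distance pQ p'Q yp yp' pu pv).
- move=> y n [p [i [u [pQ yp pu ->]]]] ne; have up := proj_mem pu.
  have Du : tri_distance x u i.
    by exists p, i, u; rewrite /star_distance eqxx addn0.
  have [Eu|nuy] := eqVneq u y; last first.
    have [uy|nuy'] := boolP (perp u y).
      exists u, i; split=> //; last by rewrite /star_distance (negPf nuy) uy addn1.
      by apply/sub_collP; split=> //; exists p.
    have [t [tp]] := common_neighbour sys Gpoints Glines (inP pQ) up yp nuy'.
    rewrite !(star_coll sys Gpoints Glines (inP pQ)) // => /andP[nut ut] /andP[nty ty].
    exists t, i.+1; split.
    - by exists p, i, u; rewrite /star_distance (negPf nut) ut addn1.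
    - by apply/sub_collP; split=> //; exists p.
    by rewrite /star_distance (negPf nuy) (negPf nuy') addn2.
  rewrite -Eu /star_distance eqxx addn0 in ne *.
  case: pu ne {Du Eu up} => [_|q1 {}u _ q1Q xq1 uq1 _ xu ne|q1 q2 z1 {}u far q1Q q2Q xq1 z11 z12 xz1 u2 up z1u ne].
  + by rewrite eqxx.
  + exists x, 0%N; split=> //.
      by exists q1, 0%N, x; rewrite /star_distance eqxx; split=> //; apply: Proj0.
    by apply/sub_collP; split; [rewrite eq_sym | exists q1].
  have nx1 : x != z1.
    apply/eqP => E; have := far q2 q2Q; rewrite E z12 => /(_ isT).
    by rewrite (meetsI u2 up).
  exists z1, 1%N; split=> //.
    exists q1, 0%N, x; rewrite /star_distance (negPf nx1) xz1; split=> //.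
    exact: Proj0.
  apply/sub_collP; split; last by exists q2.
  apply: contraNneq (far q1 q1Q xq1) => E; apply: meetsI z11 _.
  by rewrite E.
move=> y n w [p [i [u [pQ yp pu ->]]]] /sub_collP[ne [p' [p'Q yp' wp' yw]]].
have [j [v pv]] := proj_exists q0Q xq0 p'Q.
exists (j + star_distance v w)%N; first by exists p', j, v.
rewrite (proj_distance pQ p'Q yp yp' pu pv) -addnS leq_add2l.
exact: (star_distanceS (inP p'Q) (proj_mem pv) yp' yw).
Qed.

Lemma suboctagon_dist_exists x q : x \in points Y -> q \in Q ->
  exists k z, [/\ proj x q k z, z \in q & {in q, forall y,
    connect coll x y /\ dist coll x y = (k + star_distance z y)%N}].
Proof.
case/sub_pointsP=> q0 q0Q xq0 qQ; have [k [z pz]] := proj_exists q0Q xq0 qQ.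
exists k, z; split=> //; first exact: proj_mem pz.
by move=> y; apply: (suboctagon_dist q0Q xq0 qQ pz).
Qed.

Lemma star_not_sub p q : p \in Pts -> q \in Pts -> p != q -> exists2 x, x \in p & x \notin q.
Proof.
move=> pP qP ne; apply/subsetPn/negP => pq.
have m : meets p q.
  rewrite /meets (setIidPl pq); apply/eqP => p0.
  by have := card_star15 sys pP; rewrite p0 cards0.
by have := card_meet sys pP qP ne m; rewrite (setIidPl pq) (card_star15 sys pP).
Qed.

(** A chain q1', q1, q2, q3 without shortcuts is built. For x on q1' and q1, the only two stars of Q
    through x miss q3, so q3 is at distance 2 from x. *)
Lemma far_star q1 : q1 \in Q ->
  exists x q z, [/\ x \in points Y, q \in Q & proj x q 2 z].
Proof.
move=> q1Q; have /card_gt0P[x xq1] : 0 < #|q1| by rewrite (card_star15 sys (inP q1Q)).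
have [q1' [q1'Q ne1 xq1' only]] := two_stars q1Q xq1.
have ne1' : q1 != q1' by rewrite eq_sym.
have [y yq1 yq1'] := star_not_sub (inP q1Q) (inP q1'Q) ne1'.
have [q2 [q2Q ne2 yq2 _]] := two_stars q1Q yq1.
have [w wq2 wq1] := star_not_sub (inP q2Q) (inP q1Q) ne2.
have [q3 [q3Q ne3 wq3 _]] := two_stars q2Q wq2.
have ne2' : q2 != q1' by apply: contraNneq yq1' => <-.
have n12 : q1 != q2 by rewrite eq_sym.
have n13 : q1 != q3 by apply: contraNneq wq1 => ->.
have n23 : q2 != q3 by rewrite eq_sym.
have m12 := meetsI yq1 yq2; have m23 := meetsI wq2 wq3; have m11 := meetsI xq1 xq1'.
have m1'2 : ~~ meets q1' q2.
  by apply/negP => a; apply: (triangle q1'Q q2Q q1Q) => //; [rewrite eq_sym|rewrite meets_sym|rewrite meets_sym].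
have m13 : ~~ meets q1 q3 by apply/negP => a; apply: (triangle q1Q q2Q q3Q).
have m1'3 : ~~ meets q1' q3.
  apply/negP => a; have [E|b] : q1 = q3 \/ meets q1' q2.
  - apply: (@no_quadrangle _ _ _ sys q1' q1 q2 q3); first by split; apply: inP.
    by split=> //; rewrite meets_sym.
  - by rewrite E eqxx in n13.
  by rewrite b in m1'2.
have none p : p \in Q -> x \in p -> ~~ meets p q3 by move=> pQ /(only p pQ)[]->.
have [k [z pz]] := proj_exists q1Q xq1 q3Q.
exists x, q3, z; split=> //; first by apply/sub_pointsP; exists q1.
case: pz => [xq3|p {}z _ pQ xp zp zq3 _|p p' z1 {}z]; last exact: Proj2.
  by have := none q3 q3Q xq3; rewrite (meetsI xq3 xq3).
by have := none p pQ xp; rewrite (meetsI zp zq3).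
Qed.

Lemma suboctagon_near : Q != set0 -> near_2d_gon 4 Y.
Proof.
move=> Q0; split.
- apply/andP; split.
    apply/forall_inP => l lY; rewrite sub_line_points //.
    by have [lX _] := (sub_linesP l).1 lY; rewrite (line_card sys Glines lX).
  apply/forall_inP => x _; apply/forall_inP => y _; apply/implyP => ne.
  apply/card_le1_eqP => l n /setIP[/setIdP[/sub_linesP[lX _] xl] /setIdP[_ yl]].
  case/setIP=> /setIdP[/sub_linesP[nX _] xn] /setIdP[_ yn].
  exact: (line_meet sys Glines nX lX ne).
- move=> x y xY /sub_pointsP[q qQ yq].
  have [k [z [_ _ D]]] := suboctagon_dist_exists xY qQ.
  by have [] := D y yq.
- apply/eqP; rewrite eqn_leq; apply/andP; split.
    apply/bigmax_leqP => x xY; apply/bigmax_leqP => y /sub_pointsP[q qQ yq].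
    have [k [z [pz _ D]]] := suboctagon_dist_exists xY qQ; have [_ ->] := D y yq.
    have k2 : k <= 2 by case: pz.
    have d2 : star_distance z y <= 2 by rewrite /star_distance; case: ifP => //; case: ifP.
    exact: leq_add k2 d2.
  (* The bound 2 + 2 is attained at a point that is not perpendicular to the projection on a star at
     distance 2. *)
  have [q0 q0Q] := set0Pn _ Q0; have [x [q [z [xY qQ pz]]]] := far_star q0Q.
  have zq := proj_mem pz; have [y yq nzy] := perp_nondeg sys (inP qQ) zq.
  have [q1 q1Q xq1] := (sub_pointsP x).1 xY.
  apply: (leq_trans _ (leq_bigmax_cond _ xY)).
  have yY : y \in points Y by apply/sub_pointsP; exists q.
  apply: (leq_trans _ (leq_bigmax_cond _ yY)).
  have [_ ->] := suboctagon_dist q1Q xq1 qQ pz yq.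
  rewrite /star_distance (negPf nzy); case: eqP nzy => // ->.
  by rewrite (perp_refl sys (inP qQ) yq).
move=> x l xY lY; rewrite sub_line_points //.
have [lX [q qQ lq]] := (sub_linesP l).1 lY.
have [k [z [_ zq D]]] := suboctagon_dist_exists xY qQ.
have Dl y : y \in l -> dist coll x y = (k + star_distance z y)%N.
  by move=> /(subsetP lq)/D[].
have [zl|nzl] := boolP (z \in l).
  exists z; split; first by split=> // y yl; rewrite !Dl // leq_add2l /star_distance eqxx.
  move=> y [yl /(_ z zl)]; rewrite !Dl // leq_add2l /star_distance eqxx.
  by case: eqP => //; case: ifP.
have [w wl zw] := line_star_proj sys Gpoints Glines (inP qQ) lX lq zq nzl.
have dw : star_distance z w = 1%N.
  move: zw; rewrite (star_coll sys Gpoints Glines (inP qQ)) ?zq ?(subsetP lq) //.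
  by case/andP=> /negPf nzw pzw; rewrite /star_distance nzw pzw.
exists w; split.
  split=> // y yl; rewrite !Dl // leq_add2l dw /star_distance.
  by case: eqP => [E|_]; [rewrite E yl in nzl | case: ifP].
move=> y [yl /(_ w wl)]; rewrite !Dl // leq_add2l dw /star_distance.
case: eqP => [E|/eqP nzy]; first by rewrite E yl in nzl.
case: ifP => // zy _; apply: (line_coll_uniq sys Gpoints Glines lX nzl) => //.
by rewrite (star_coll sys Gpoints Glines (inP qQ)) ?zq ?(subsetP lq) // nzy.
Qed.

(** Together with 1, the orthogonal of x is a hyperplane of order 8 in the group of order 16. This
    is seen by translating with some a not perpendicular to x, and 1 and x are then discarded. *)
Lemma card_perp q x : q \in Pts -> x \in q -> #|[set y in q | (y != x) && perp x y]| = 6.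
Proof.
move=> qP xq; have [a aq nxa] := perp_nondeg sys qP xq.
have aa : a * a = 1 by have [] := star_inv sys qP aq.
pose N := [set y in q | ~~ perp x y]; pose H := [set y in q | perp x y].
have NH : #|N| + #|H| = 15.
  rewrite -(card_star15 sys qP) -(cardsID H q) addnC; congr (_ + _).
    by apply: eq_card => y; rewrite !inE andbA andbb.
  by apply: eq_card => y; rewrite !inE; case: (y \in q); rewrite ?andbF ?andbT.
have aN : a \in N by rewrite inE aq.
have EH : H = (fun y => a * y) @: (N :\ a).
  apply/setP => y; rewrite inE; apply/andP/imsetP => [[yq xy]|[t]].
    have ay : a != y by apply: contraNneq nxa => ->.
    exists (a * y); last by rewrite mulgA aa mul1g.
    rewrite !inE (star_mul sys qP) // (perp_mul sys qP aq yq xq ay) (negPf nxa) xy !andbT.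
    have [y1 _] := star_inv sys qP yq; apply: contraNneq y1 => E.
    by apply/eqP/(mulgI a); rewrite E mulg1.
  rewrite !inE => /and3P[ta tq xt] ->; rewrite eq_sym in ta.
  by rewrite (star_mul sys qP) // (perp_mul sys qP aq tq xq ta) (negPf nxa) (negPf xt).
have cH : #|H| = #|N :\ a| by rewrite EH card_imset //; apply: mulgI.
have xH : x \in H by rewrite inE xq (perp_refl sys qP xq).
have := cardsD1 a N; have := cardsD1 x H; rewrite aN xH -cH !add1n => EH' EN.
have -> : [set y in q | (y != x) && perp x y] = H :\ x.
  by apply/setP => y; rewrite !inE andbCA.
move: NH; rewrite EN EH' addSn addnn => -[/(congr1 half)].
by rewrite doubleK => -[].
Qed.

Lemma card_star_lines q x : q \in Pts -> x \in q ->
  #|[set l in lines X | (x \in l) && (l \subset q)]| = 3.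
Proof.
move=> qP xq; set L := [set l in _ | _].
suff /eqP : (#|L| * 2 = 6 * 1)%N by rewrite -[(6 * 1)%N]/(3 * 2)%N eqn_pmul2r // => /eqP.
rewrite -(card_perp qP xq); apply: (double_count (r := fun l y => y \in l)).
  move=> l /setIdP[lX /andP[xl lq]]; have := cardsD1 x l.
  rewrite (line_card sys Glines lX) xl => -[->]; apply: eq_card => y; rewrite !inE; case: (boolP (y \in l)); rewrite ?andbF // !andbT => yl.
  have yq := subsetP lq y yl; rewrite yq /= eq_sym; apply: andb_idr => ne.
  by have [_ [P []]] := line_eq sys Glines lX xl yl ne.
move=> y /setIdP[yq /andP[ne xy]]; apply/eqP/cards1P; exists (tri x y).
have ne' : x != y by rewrite eq_sym.
apply/setP => l; rewrite in_set1; apply/setIdP/eqP => [[/setIdP[lX /andP[xl _]] yl]|->].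
  by have [] := line_eq sys Glines lX xl yl ne'.
have [xt yt] : x \in tri x y /\ y \in tri x y by rewrite !in_tri !eqxx orbT.
split=> //; apply/setIdP; split; first exact: (line_tri Glines qP).
by rewrite xt; apply/subsetP => z /(tri_star sys qP xq yq ne' xy)[].
Qed.

(** Each of the two stars through x has 3 lines on x, and they share only the line in which they
    meet: 3 + 3 - 1 = 5. *)
Lemma suboctagon_order : has_order 2 4 Y.
Proof.
split=> [l lY|x /sub_pointsP[q qQ xq]].
  by rewrite sub_line_points //; have [lX _] := (sub_linesP l).1 lY; apply: (line_card sys Glines).
have [q' [q'Q ne xq' only]] := two_stars qQ xq; have ne' : q != q' by rewrite eq_sym.
pose L p := [set l in lines X | (x \in l) && (l \subset p)].
have -> : point_lines Y x = L q :|: L q'.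
  apply/setP => l; rewrite in_setU; apply/setIdP/orP => [[/sub_linesP[lX [p pQ lp]] xl]|].
    have {}xl : x \in l := xl; have xp := subsetP lp x xl.
    by have [<-|<-] := only p pQ xp; [left|right]; apply/setIdP; rewrite xl.
  by case=> /setIdP[lX /andP[xl lp]]; split=> //; apply/sub_linesP; split=> //; [exists q|exists q'].
have mE : meets q q' := meetsI xq xq'.
have [u [v [uq vq uv puv E]]] := meet_tri (inP qQ) (inP q'Q) ne' mE.
have cI : #|L q :&: L q'| = 1%N.
  apply/eqP/cards1P; exists (q :&: q'); apply/setP => l; rewrite in_set1 in_setI.
  apply/andP/eqP => [[/setIdP[lX /andP[xl lq]] /setIdP[_ /andP[_ lq']]]|->].
    apply/eqP; rewrite eqEcard subsetI lq lq' (line_card sys Glines lX).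
    by rewrite (card_meet sys (inP qQ) (inP q'Q) ne' mE).
  have IX : q :&: q' \in lines X by rewrite E; apply: (line_tri Glines (inP qQ)).
  by split; apply/setIdP; rewrite in_setI xq xq' ?subsetIl ?subsetIr.
have cU := cardsUI (L q) (L q'); rewrite cI !card_star_lines ?inP // in cU.
by rewrite addn1 in cU; case: cU.
Qed.

Lemma suboctagon_full : full_subgeometry Y X.
Proof.
split.
- apply/subsetP => x /sub_pointsP[q qQ xq].
  exact: (subsetP (star_points Gpoints (inP qQ))).
- by apply/subsetP => l /sub_linesP[].
- by [].
move=> l lY; have [lX [q qQ lq]] := (sub_linesP l).1 lY.
rewrite (line_points_octagon sys Gpoints Glines lX).
by apply/subsetP => x xl; apply/sub_pointsP; exists q => //; apply: (subsetP lq).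
Qed.

End Projection.

Local Close Scope group_scope.
Local Open Scope ring_scope.

(** * Isomorphisms with W(2) and with the dual hexagon *)

Lemma subspaces1P (F : finFieldType) n (U : {set 'rV[F]_n}) :
  U \in subspaces F n 1 <->
  exists2 u, u != 0 & forall w, w \in U <-> exists c, w = c *: u.
Proof.
split=> [/imsetP[M fM ->] | [u nu Uu]].
  rewrite inE /row_free rank_rV eqb1 in fM; exists M => // w.
  by rewrite inE; split=> /sub_rVP.
apply/imsetP; exists u; first by rewrite inE /row_free rank_rV nu.
by apply/setP => w; rewrite inE; apply/idP/sub_rVP; apply Uu.
Qed.

Lemma subspaces2P (F : finFieldType) n (U : {set 'rV[F]_n}) :
  U \in subspaces F n 2 <-> exists u v,
    (forall b c, b *: u + c *: v = 0 -> b = 0 /\ c = 0) /\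
    (forall w, w \in U <-> exists b c, w = b *: u + c *: v).
Proof.
have mulE (b c : F) (u v : 'rV[F]_n) :
    row_mx b%:M c%:M *m (col_mx u v : 'M_(1 + 1, n)) = b *: u + c *: v.
  by rewrite mul_row_col !mul_scalar_mx.
have scal0 (b : F) : (b%:M == 0 :> 'M_1) = (b == 0).
  by rewrite -scalemx1 scalemx_eq0 oner_eq0 orbF.
have rowE (D : 'rV[F]_(1 + 1)) : exists b c, D = row_mx b%:M c%:M.
  exists (lsubmx D 0 0), (rsubmx D 0 0); rewrite -[D in LHS]hsubmxK.
  by congr row_mx; apply: mx11_scalar.
have memE (u v w : 'rV[F]_n) :
    (w <= (col_mx u v : 'M_(1 + 1, n)))%MS <-> exists b c, w = b *: u + c *: v.
  split=> [/submxP[D ->] | [b [c ->]]].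
    by have [b [c ->]] := rowE D; exists b, c.
  by apply/submxP; exists (row_mx b%:M c%:M); rewrite mulE.
split=> [/imsetP[M fM ->] | [u [v [fuv Uuv]]]].
  have EM : M = col_mx (usubmx (M : 'M_(1 + 1, n))) (dsubmx (M : 'M_(1 + 1, n))).
    by rewrite vsubmxK.
  move: (usubmx _) (dsubmx _) EM fM => u v -> fM; exists u, v; split.
    move=> b c; rewrite -mulE => D0; rewrite inE in fM.
    have /eqP : row_mx b%:M c%:M = 0 :> 'rV_(1 + 1).
      by apply: (row_free_inj fM); rewrite D0 mul0mx.
    by rewrite row_mx_eq0 !scal0 => /andP[/eqP-> /eqP->].
  by move=> w; rewrite inE; apply: memE.
apply/imsetP; exists (col_mx u v : 'M_(1 + 1, n)).
  rewrite inE; apply: inj_row_free => D; have [b [c ->]] := rowE D.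
  rewrite mulE => /fuv[-> ->].
  have <- : row_mx 0 0 = 0 :> 'rV[F]_(1 + 1) by rewrite row_mx0.
  by apply: (f_equal2 (@row_mx F 1 1 1)); apply/eqP; rewrite scal0.
by apply/setP => w; rewrite inE; apply/idP/idP => [/Uuv/memE | /memE/Uuv].
Qed.

Lemma F2_cases (c : 'F_2) : c = 0 \/ c = 1.
Proof. by case: c => -[|[|//]] lt; [left | right]; apply: val_inj. Qed.

Lemma row4E (R : pzSemiRingType) (s : seq bool) k : (k < 4)%N ->
  (\row_(i < 4) (nth false s i)%:R : 'rV[R]_4) 0 (inord k) = (nth false s k)%:R.
Proof. by move=> lt; rewrite mxE inordK. Qed.

(** * Symplectic coordinates on a star *)

Section StarSpace.
Variables (gT : finGroupType) (G : {group gT}).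
Variables (Pts : {set {set gT}}) (perp : rel gT).
Hypothesis sys : star_system Pts perp.
Hypothesis Gpoints : central_involutions G = cover Pts.
Hypothesis Glines : forall l, l \in octagon_lines G <-> exists P x y,
  [/\ P \in Pts, x \in P, y \in P, x != y & perp x y /\ l = [set x; y; (x * y)%g]].
Variable P : {set gT}.
Hypothesis PP : P \in Pts.
Implicit Types (x y z w : gT).

Let N x y := ~~ perp x y.

Let N_sym x y : x \in P -> y \in P -> N x y = N y x.
Proof. by move=> xP yP; rewrite /N (perp_sym sys PP xP yP). Qed.

Let N_mul x y z : x \in P -> y \in P -> z \in P -> x != y ->
  N z (x * y)%g = N z x (+) N z y.
Proof.
move=> xP yP zP ne; rewrite /N (perp_mul sys PP xP yP zP ne).
by case: (perp z x); case: (perp z y).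
Qed.

Let N_refl x : x \in P -> N x x = false.
Proof. by move=> xP; rewrite /N (perp_refl sys PP xP). Qed.

Let mulP x y : x \in P -> y \in P -> x != y -> (x * y)%g \in P.
Proof. exact: (star_mul sys PP). Qed.

Variables a c b d : gT.
Hypotheses (aP : a \in P) (cP : c \in P) (bP : b \in P) (dP : d \in P).
Hypotheses (ac : ~~ perp a c) (bd : ~~ perp b d).
Hypotheses (ab : perp a b) (ad : perp a d) (cb : perp c b) (cd : perp c d).

Let Nbasis : (N a c * N c a * N b d * N d b)%type *
  ((N a b = false) * (N b a = false) * (N a d = false) * (N d a = false) *
   (N c b = false) * (N b c = false) * (N c d = false) * (N d c = false) *
   (N a a = false) * (N b b = false) * (N c c = false) * (N d d = false)).
Proof.
rewrite (N_sym bP aP) (N_sym dP aP) (N_sym bP cP) (N_sym dP cP) (N_sym cP aP).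
by rewrite (N_sym dP bP) !N_refl // /N ac bd ab ad cb cd.
Qed.

(** Being perpendicular to a and b, such a w would be a * b by [perp_max], which is not
    perpendicular to c. *)
Let radical w : w \in P -> N w a = false -> N w b = false -> N w c = false ->
  N w d = false -> False.
Proof.
move=> wP wa wb wc wd.
have [E|nwa] := eqVneq w a; first by rewrite E Nbasis in wc.
have [E|nwb] := eqVneq w b; first by rewrite E Nbasis in wd.
have nab : a != b by apply: contraNneq ac => ->; rewrite (perp_sym sys PP bP cP).
have Ew : w = (a * b)%g.
  apply: (perp_max sys PP aP bP wP) => //; rewrite 1?eq_sym //.
    by apply/negbNE; rewrite -/(N a w) N_sym ?wa.
  by apply/negbNE; rewrite -/(N b w) N_sym ?wb.
by move: wc; rewrite N_sym // Ew N_mul // N_sym // Nbasis (N_sym cP bP) Nbasis.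
Qed.

Let h y x := (N y c && N x a) (+) (N y a && N x c) (+) (N y d && N x b) (+) (N y b && N x d).

Let C x := forall y, y \in P -> N y x = h y x.

Let reduce g x : g \in P -> x \in P -> C g -> (x != g -> C (x * g)%g) -> C x.
Proof.
move=> gP xP Cg Cxg; have [-> //|ne] := eqVneq x g; have {}Cxg := Cxg ne.
have xgP := mulP xP gP ne; move=> y yP; have := Cxg y yP; rewrite N_mul // (Cg y yP) /h.
have mul k : k \in P -> N (x * g)%g k = N x k (+) N g k.
  by move=> kP; rewrite N_sym // N_mul // (N_sym kP xP) (N_sym kP gP).
rewrite !mul // !andb_addr.
move: (N y c && _) (N y a && _) (N y d && _) (N y b && _) => p1 p2 p3 p4.
move: (N y c && _) (N y a && _) (N y d && _) (N y b && _) => q1 q2 q3 q4.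
by case: (N y x) p1 p2 p3 p4 q1 q2 q3 q4; do 8 case.
Qed.

(** Multiplying x by a, c, b or d flips exactly one of N x c, N x a, N x d and N x b. By [reduce]
    the claim descends until all four vanish, which [radical] excludes. *)
Let formE : forall x, x \in P -> C x.
Proof.
have Ca : C a by move=> y yP; rewrite /h !Nbasis !andbF !andbT !(addbF, addFb).
have Cc : C c by move=> y yP; rewrite /h !Nbasis !andbF !andbT !(addbF, addFb).
have Cb : C b by move=> y yP; rewrite /h !Nbasis !andbF !andbT !(addbF, addFb).
have Cd : C d by move=> y yP; rewrite /h !Nbasis !andbF !andbT !(addbF, addFb).
have mul x g k : x \in P -> g \in P -> k \in P -> x != g -> N (x * g)%g k = N x k (+) N g k.
  by move=> xP gP kP ne; rewrite N_sym ?mulP // N_mul // (N_sym kP xP) (N_sym kP gP).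
have s1 x : x \in P -> N x a = false -> N x b = false -> N x d = false -> C x.
  move=> xP xa xb xd; case xc: (N x c); last by case: (radical xP xa xb xc xd).
  apply: (reduce aP xP) => // ne.
  by case: (@radical (x * a)%g); rewrite ?mulP ?mul // ?xa ?xb ?xc ?xd !Nbasis.
have s2 x : x \in P -> N x b = false -> N x d = false -> C x.
  move=> xP xb xd; case xa: (N x a); last exact: s1.
  by apply: (reduce cP xP) => // ne; apply: s1; rewrite ?mulP ?mul // ?xa ?xb ?xd !Nbasis.
have s3 x : x \in P -> N x b = false -> C x.
  move=> xP xb; case xd: (N x d); last exact: s2.
  by apply: (reduce bP xP) => // ne; apply: s2; rewrite ?mulP ?mul // ?xb ?xd !Nbasis.
move=> x xP; case xb: (N x b); last exact: s3.
by apply: (reduce dP xP) => // ne; apply: s3; rewrite ?mulP ?mul // ?xb !Nbasis.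
Qed.

(** The coordinates of x on a, c, b, d, each read off by pairing with the hyperbolic partner; this
    order matches the two hyperbolic planes of [symp]. *)
Let th x : 'rV['F_2]_4 := \row_(i < 4) (nth false [:: N x c; N x a; N x d; N x b] i)%:R.

Let thE x : [/\ th x 0 (inord 0) = (N x c)%:R, th x 0 (inord 1) = (N x a)%:R,
  th x 0 (inord 2) = (N x d)%:R & th x 0 (inord 3) = (N x b)%:R].
Proof. by split; rewrite row4E. Qed.

Let th_inj0 x : x \in P -> th x != 0.
Proof.
move=> xP; apply/eqP => E; have [] := thE x; rewrite E !mxE.
have nat0 (k : bool) : 0 = k%:R :> 'F_2 -> k = false by case: k.
by move=> /nat0 ? /nat0 ? /nat0 ? /nat0 ?; apply: (radical xP).
Qed.

Let th_mul x y : x \in P -> y \in P -> x != y -> th (x * y)%g = th x + th y.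
Proof.
move=> xP yP ne; have xyP := mulP xP yP ne.
have F2D (k l : bool) : (k (+) l)%:R = k%:R + l%:R :> 'F_2.
  by case: k; case: l; apply: val_inj.
apply/rowP => i; rewrite !mxE -F2D; congr (_%:R).
rewrite !(N_sym xyP) // !N_mul // !(N_sym xP) // !(N_sym yP) //.
by case: i => -[|[|[|[|]]]].
Qed.

Let thxx u : u + u = 0 :> 'rV['F_2]_4.
Proof. by apply/rowP => i; rewrite !mxE; case: (F2_cases (u 0 i)) => ->; apply: val_inj. Qed.

Let th_inj : {in P &, injective th}.
Proof.
move=> x y xP yP E; apply/eqP; apply: contraT => ne.
by have := th_inj0 (mulP xP yP ne); rewrite th_mul // E thxx eqxx.
Qed.

Let th_im : th @: P = [set~ 0].
Proof.
apply/eqP; rewrite eqEcard; apply/andP; split.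
  by apply/subsetP => _ /imsetP[x xP ->]; rewrite !inE th_inj0.
by rewrite card_in_imset // (card_star15 sys PP) cardsC1 card_mx card_Fp.
Qed.

Let th_onto u : u != 0 -> exists2 x, x \in P & u = th x.
Proof. by move=> nu; have : u \in th @: P; [rewrite th_im !inE | case/imsetP=> x; exists x]. Qed.

Let th_symp x y : x \in P -> y \in P -> (symp (th x) (th y) == 0) = perp x y.
Proof.
move=> xP yP; apply: negb_inj; rewrite -/(N x y) (formE yP xP) /symp /h.
have [-> -> -> ->] := thE x; have [-> -> -> ->] := thE y.
move: (N x a) (N x b) (N x c) (N x d) (N y a) (N y b) (N y c) (N y d).
by do 8 case; vm_compute.
Qed.

Let sub1P U : U \in subspaces 'F_2 4 1 <-> exists2 x, x \in P & U = [set 0; th x].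
Proof.
have F2Z (u w : 'rV['F_2]_4) : (exists c, w = c *: u) <-> w \in [set 0; u].
  rewrite !inE; split=> [[e ->] | /orP[] /eqP->].
  - by case: (F2_cases e) => ->; rewrite ?scale0r ?scale1r eqxx ?orbT.
  - by exists 0; rewrite scale0r.
  by exists 1; rewrite scale1r.
rewrite subspaces1P; split=> [[u /th_onto[x xP ->] Uu] | [x xP ->]].
  exists x => //; apply/setP => w.
  by apply/idP/idP => [/Uu/F2Z | /F2Z/Uu].
by exists (th x) => [|w]; [apply: th_inj0 | split=> /F2Z].
Qed.

Let F2span (u v w : 'rV['F_2]_4) :
  (exists b c, w = b *: u + c *: v) <-> w \in [set 0; u; v; u + v].
Proof.
rewrite !inE; split=> [[e [f ->]] | /orP[/orP[/orP[]|]|] /eqP->].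
- case: (F2_cases e) => ->; case: (F2_cases f) => ->;
  by rewrite ?scale0r ?scale1r ?addr0 ?add0r eqxx ?orbT.
- by exists 0, 0; rewrite !scale0r addr0.
- by exists 1, 0; rewrite scale0r scale1r addr0.
- by exists 0, 1; rewrite scale0r scale1r add0r.
by exists 1, 1; rewrite !scale1r.
Qed.

Let sub2P U : U \in lines (symplectic_gq 'F_2) <-> exists x y,
  [/\ x \in P, y \in P, x != y, perp x y & U = 0 |: th @: tri x y].
Proof.
have triE x y : x \in P -> y \in P -> x != y ->
    0 |: th @: tri x y = [set 0; th x; th y; th x + th y].
  move=> xP yP ne; rewrite /tri !imsetU !imset_set1 th_mul //.
  by rewrite !setUA.
rewrite inE; split=> [/andP[/subspaces2P[u [v [fuv Uuv]]] iso] | [x [y [xP yP ne xy ->]]]].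
  have nu : u != 0.
    apply/eqP => u0; have [] := fuv 1 0; first by rewrite u0 scaler0 scale0r addr0.
    by move/eqP; rewrite oner_eq0.
  have nv : v != 0.
    apply/eqP => v0; have [] := fuv 0 1; first by rewrite v0 scaler0 scale0r addr0.
    by move=> _ /eqP; rewrite oner_eq0.
  have nuv : u != v.
    apply/eqP => E; have [] := fuv 1 1; first by rewrite E !scale1r thxx.
    by move/eqP; rewrite oner_eq0.
  have [x xP Ex] := th_onto nu; have [y yP Ey] := th_onto nv.
  rewrite Ex Ey in Uuv nuv; have ne : x != y by apply: contraNneq nuv => ->.
  exists x, y; split=> //.
    rewrite -th_symp //; apply: (forall_inP (forall_inP iso _ _)).
      by apply/Uuv/F2span; rewrite !inE eqxx !orbT.
    by apply/Uuv/F2span; rewrite !inE eqxx !orbT.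
  by rewrite triE //; apply/setP => w; apply/idP/idP => [/Uuv/F2span | /F2span/Uuv].
apply/andP; split.
  apply/subspaces2P; exists (th x), (th y); split=> [e f | w].
    case: (F2_cases e) => ->; case: (F2_cases f) => ->;
      rewrite ?scale0r ?scale1r ?addr0 ?add0r // => /eqP E.
    - by case/negP: (th_inj0 yP).
    - by case/negP: (th_inj0 xP).
    by rewrite -th_mul // in E; case/negP: (th_inj0 (mulP xP yP ne)).
  by rewrite triE //; split=> /F2span.
have symp0 (u : 'rV['F_2]_4) : symp 0 u = 0 by rewrite /symp !mxE !mul0r !subr0 addr0.
have symp0r (u : 'rV['F_2]_4) : symp u 0 = 0 by rewrite /symp !mxE !mulr0 !subr0 addr0.
apply/forall_inP => u uU; apply/forall_inP => v vU.
case/setU1P: uU => [-> | /imsetP[z zt ->]]; first by rewrite symp0.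
case/setU1P: vU => [-> | /imsetP[w wt ->]]; first by rewrite symp0r.
have [zP _] := tri_star sys PP xP yP ne xy zt.
have [wP _] := tri_star sys PP xP yP ne xy wt.
rewrite th_symp //; have [<- | nzw] := eqVneq z w; first exact: (perp_refl sys PP zP).
by have [] := tri_eq sys PP xP yP ne xy zt wt nzw.
Qed.

Lemma star_gq_basis : isomorphic (induced (octagon G) P) (symplectic_gq 'F_2).
Proof.
have pointsP : points (induced (octagon G) P) = P.
  by apply/setIidPr; apply: (star_points Gpoints PP).
have linesPP l : l \in lines (induced (octagon G) P) <-> exists x y,
    [/\ x \in P, y \in P, x != y, perp x y & l = tri x y].
  rewrite (induced_lines sys Gpoints Glines); split=> [/andP[]|[x [y [xP yP ne xy ->]]]].
    exact: (star_isotropic sys Glines).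
  rewrite (line_tri Glines PP) //=.
  by apply/subsetP => z /(tri_star sys PP xP yP ne xy)[].
have sub l : l \in lines (induced (octagon G) P) -> l \subset P.
  by rewrite (induced_lines sys Gpoints Glines) => /andP[].
have th_mem x (l : {set gT}) : x \in P -> l \subset P -> (th x \in 0 |: th @: l) = (x \in l).
  move=> xP lP; rewrite in_setU1 (negPf (th_inj0 xP)) /=.
  apply/imsetP/idP => [[y yl E] | xl]; last by exists x.
  by rewrite (th_inj xP (subsetP lP y yl) E).
exists (fun x => [set 0; th x]), (fun l : {set gT} => 0 |: th @: l); rewrite pointsP; split.
- split=> [x y xP yP E|].
    have : th x \in [set 0; th y] by rewrite -E set22.
    by rewrite in_set2 (negPf (th_inj0 xP)) => /eqP/(th_inj xP yP).
  apply/setP => U; apply/imsetP/idP => [H | /sub1P //].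
  by apply/sub1P.
- split=> [l n lX nX E|].
    have [lP nP] := (sub l lX, sub n nX).
  apply/setP => x; case xP: (x \in P).
    by rewrite -(th_mem x l xP lP) -(th_mem x n xP nP) E.
  by rewrite (contraFF (subsetP lP x) xP) (contraFF (subsetP nP x) xP).
  apply/setP => U; apply/imsetP/idP => [[l /linesPP[x [y [xP yP ne xy ->]]] ->] | ].
    by apply/sub2P; exists x, y.
  case/sub2P=> x [y [xP yP ne xy ->]]; exists (tri x y) => //.
  by apply/linesPP; exists x, y.
move=> x l xP lX /=; rewrite subUset !sub1set in_setU1 eqxx /=.
exact: th_mem (sub l lX).
Qed.

End StarSpace.

Lemma star_gq (gT : finGroupType) (G : {group gT}) (Pts : {set {set gT}}) (perp : rel gT) :
  star_system Pts perp -> central_involutions G = cover Pts ->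
  (forall l, l \in octagon_lines G <-> exists P x y,
     [/\ P \in Pts, x \in P, y \in P, x != y & perp x y /\ l = [set x; y; (x * y)%g]]) ->
  {in Pts, forall P, isomorphic (induced (octagon G) P) (symplectic_gq 'F_2)}.
Proof.
move=> sys Gpoints Glines P PP.
have [a [c [b [d [[aP cP bP dP] ac bd /andP[ab ad] /andP[cb cd]]]]]] := symplectic_basis sys PP.
exact: (star_gq_basis sys Gpoints Glines PP aP cP bP dP).
Qed.

(** * The dual of the split Cayley hexagon *)

Section DualHexagon.
Variables (F : finFieldType) (Z : zorn_algebra F).
Hypothesis F4 : #|F| = 4%N.
Variables (gT : finGroupType) (G : {group gT}).
Variable f : {morphism zorn_aut_group Z >-> gT}.
Hypotheses (injf : ('injm f)%g) (fG : (f @* zorn_aut_group Z)%g = G).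
Local Notation Pts := (image_stars f (star_set Z)).
Implicit Types (p q u v z w : Z) (b c : F) (L P : {set gT}).

(** The inverse of the passage from points to stars, stated on whole sets so that no representative
    has to be chosen; 0 is added to obtain a subspace. *)
Definition star_point P : {set Z} := 0 |: [set z | null z && (f @: star z == P)].
Definition star_span L : {set Z} := 0 |: [set z | null z && (L \subset f @: star z)].

Lemma image_starS (A : {set {perm Z}}) q : null q -> A \subset zorn_aut_group Z ->
  (f @: A \subset f @: star q) = (A \subset star q).
Proof.
move=> nq sA; apply/idP/idP => [/subsetP sub | /imsetS //].
apply/subsetP => x xA; rewrite -(mem_image_star injf (star_sub F4) (star_in_set nq)).
  exact/sub/imset_f.
exact: (subsetP sA).
Qed.

Lemma in_star_point p z : null p ->
  z \in star_point (f @: star p) <-> exists c, z = c *: p.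
Proof.
move=> np; rewrite in_setU1 in_set; split=> [/orP[/eqP->|/andP[nz /eqP E]]|[c ->]].
- by exists 0; rewrite scale0r.
- apply: (star_inj F4 np nz); apply/eqP; rewrite eqEsubset.
  have [sp sz] := (star_sub F4 (star_in_set np), star_sub F4 (star_in_set nz)).
  by apply/andP; split; [rewrite -(image_starS nz sp) E | rewrite -(image_starS np sz) E].
have [->|c0] := eqVneq c 0; first by rewrite scale0r eqxx.
by rewrite nullZ // starZ // eqxx orbT.
Qed.

(** For an element of both stars, the elation of (p, v) say, [long_roots_line] describes the points
    whose star contains it as those of <p, v>, and this line is <p, q>. *)
Lemma in_star_span p q z : null p -> null q -> star p != star q -> p ** q = 0 ->
  z \in star_span (f @: (star p :&: star q)) <-> exists b c, z = b *: p + c *: q.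
Proof.
move=> np nq ne pq; have [x /setIP[xp xq]] := set0Pn _ (meets_star F4 np nq pq).
have [v [pv Ex x1]] := starP _ _ xp; rewrite Ex in x1 xp xq.
have [[t1 t2 /= t0 Eq]] := (long_roots_line F4 np pv x1 nq).1 xq.
have t20 : t2 != 0.
  apply/eqP => E; apply: (@star_neq _ Z F4 p q t1 np nq ne).
  by rewrite Eq E scale0r addr0.
have Ev : v = t2^-1 *: q - (t2^-1 * t1) *: p.
  by rewrite Eq scalerDr !scalerA mulVf // scale1r addrC addKr.
have sA : star p :&: star q \subset zorn_aut_group Z.
  exact: subset_trans (subsetIl _ _) (star_sub F4 (star_in_set np)).
rewrite in_setU1 in_set; split=> [/orP[/eqP->|/andP[nz]]|[b [c Ez]]].
- by exists 0, 0; rewrite !scale0r addr0.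
- rewrite image_starS // => /subsetP/(_ (elation p v)); rewrite inE xp xq => /(_ isT).
  case/(long_roots_line F4 np pv x1 nz)=> -[s1 s2 /= _ ->].
  exists (s1 - s2 * (t2^-1 * t1)), (s2 * t2^-1).
  by rewrite Ev scalerBr !scalerA scalerBl -addrA; congr (_ + _); apply: addrC.
have [//|z0] := eqVneq z 0; have nz : null z.
  rewrite /null z0 Ez omulDl !omulDr !omulZl !omulZr pq (null_mulC np nq pq).
  by rewrite !null_sqr // !scaler0 !addr0 eqxx.
rewrite nz image_starS //=.
have xz : elation p v \in star z.
  apply/(long_roots_line F4 np pv x1 nz); exists (b + c * t1, c * t2) => /=; last first.
    by rewrite Ez Eq scalerDl scalerDr !scalerA addrA.
  apply: contraNneq z0 => -[E1 E2].
  by rewrite Ez Eq scalerDr !scalerA addrA -scalerDl E1 E2 !scale0r addr0.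
have [<-|nez] := eqVneq (star p) (star z); first exact: subsetIl.
rewrite (meet_eq (root_star_system Z F4) (star_in_set np) (star_in_set nq) (star_in_set nz) ne nez xp xq xz).
exact: subsetIr.
Qed.

Lemma Sstar_spanP L : L \in Sstar G <-> exists p q,
  [/\ null p, null q, star p != star q, p ** q = 0 & L = f @: (star p :&: star q)].
Proof.
split=> [/(SstarP F4 injf fG)[P [Q []]] | [p [q [np nq ne pq ->]]]].
  case/imsetP=> _ /star_setP[p np ->] -> /imsetP[_ /star_setP[q nq ->] ->] /image_star_neq ne.
  have [sp sq] := (star_in_set np, star_in_set nq).
  rewrite (image_meets injf (star_sub F4)) // (image_meet injf (star_sub F4)) //.
  by move=> m ->; exists p, q; split=> //; apply: star_meets m.
have [sp sq] := (star_in_set np, star_in_set nq).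
apply/(SstarP F4 injf fG); exists (f @: star p), (f @: star q).
rewrite (imset_f _ sp) (imset_f _ sq).
rewrite (image_meets injf (star_sub F4)) // (image_meet injf (star_sub F4)) //.
rewrite meets_star //; split=> //; apply: contraNneq ne => E.
rewrite eqEsubset -(image_starS nq (star_sub F4 sp)) -(image_starS np (star_sub F4 sq)).
by rewrite E !subxx.
Qed.

(* The roles of points and lines are exchanged: the star of p is a quad, and two
   meeting stars, of p and q, have the octagon line of <p, q> in common. *)
Lemma dual_hexagon (Y : geometry {set Z} {set Z}) :
  (forall U, U \in points Y <-> exists2 p, null p &
     forall w, w \in U <-> exists c, w = c *: p) ->
  (forall U, U \in lines Y <-> exists p q,
     [/\ null p, null q, p ** q = 0, forall c, q <> c *: p &
       forall w, w \in U <-> exists b c, w = b *: p + c *: q]) ->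
  (forall U V, inc Y U V = (U \subset V)) ->
  isomorphic (containment (Sstar G) Pts) (dual Y).
Proof.
move=> Ypoints Ylines Yinc; exists star_span, star_point.
have spanI L z : null z -> (z \in star_span L) = (L \subset f @: star z).
  by move=> nz; rewrite in_setU1 in_set nz (negPf (null_neq0 nz)).
have pointI P z : null z -> (z \in star_point P) = (f @: star z == P).
  by move=> nz; rewrite in_setU1 in_set nz (negPf (null_neq0 nz)).
split.
- split=> [L L' /Sstar_spanP[p [q [np nq ne pq EL]]] /Sstar_spanP[p' [q' [np' nq' ne' pq' EL']]] E|].
    have sub r s r' s' : null r -> null s -> star r != star s -> r ** s = 0 ->
        star_span (f @: (star r :&: star s)) = star_span (f @: (star r' :&: star s')) ->
        f @: (star r' :&: star s') \subset f @: (star r :&: star s).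
      move=> nr ns nrs rs Ers; rewrite -(image_meet injf (star_sub F4) (star_in_set nr) (star_in_set ns)).
      have rS : r \in star_span (f @: (star r :&: star s)).
        by apply/(in_star_span _ nr ns nrs rs); exists 1, 0; rewrite scale1r scale0r addr0.
      have sS : s \in star_span (f @: (star r :&: star s)).
        by apply/(in_star_span _ nr ns nrs rs); exists 0, 1; rewrite scale1r scale0r add0r.
      by rewrite Ers (spanI _ r nr) in rS; rewrite Ers (spanI _ s ns) in sS; rewrite subsetI rS.
    move: E; rewrite EL EL' => E; apply/eqP; rewrite eqEsubset; apply/andP; split.
      exact: (sub p' q' p q np' nq' ne' pq' (esym E)).
    exact: (sub p q p' q' np nq ne pq E).
  apply/setP => U; apply/imsetP/idP => [[L /Sstar_spanP[p [q [np nq ne pq ->]]] ->] | ].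
    apply/Ylines; exists p, q; split=> // [c|w]; first exact: star_neq.
    exact: in_star_span.
  case/Ylines=> p [q [np nq pq nqp Uw]]; have ne : star p != star q.
    by apply/eqP => /(star_inj F4 np nq)[c /nqp].
  exists (f @: (star p :&: star q)); first by apply/Sstar_spanP; exists p, q.
  by apply/setP => w; apply/idP/idP => [/Uw/(in_star_span _ np nq ne pq) | /(in_star_span _ np nq ne pq)/Uw].
- split=> [P Q /imsetP[_ /star_setP[p np ->] ->] QP E|].
    by apply/eqP; rewrite -pointI // -E pointI.
  apply/setP => U; apply/imsetP/idP => [[_ /imsetP[_ /star_setP[p np ->] ->] ->] | ].
    by apply/Ypoints; exists p => // w; apply: in_star_point.
  case/Ypoints=> p np Uw; exists (f @: star p); first exact/imset_f/star_in_set.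
  by apply/setP => w; apply/idP/idP => [/Uw/(in_star_point _ np) | /(in_star_point _ np)/Uw].
move=> L P _ /imsetP[_ /star_setP[p np ->] ->]; rewrite /= Yinc.
apply/idP/idP => [/subsetP/(_ p) | LP].
  by rewrite pointI // spanI // eqxx; apply.
apply/subsetP => z; rewrite !in_setU1 !in_set => /orP[->//|/andP[-> /eqP->]].
by rewrite LP orbT.
Qed.

End DualHexagon.

Lemma dual_split_cayley (F : finFieldType) (gT : finGroupType) (G : {group gT})
    (f : {morphism zorn_aut_group (octonions F) >-> gT}) :
  #|F| = 4%N -> ('injm f)%g -> (f @* zorn_aut_group (octonions F))%g = G ->
  isomorphic (containment (Sstar G) (image_stars f (star_set (octonions F))))
             (dual (split_cayley_hexagon F)).
Proof.
move=> F4 injf fG; apply: (dual_hexagon F4 injf fG) => // U.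
  rewrite /= in_set; split=> [/andP[/subspaces1P[p p0 Uw] /forall_inP nU] | [p np Uw]].
    exists p => //; rewrite /null p0; apply: (forall_inP (nU p _)).
      by apply/Uw; exists 1; rewrite scale1r.
    by apply/Uw; exists 1; rewrite scale1r.
  apply/andP; split; first by apply/subspaces1P; exists p => //; apply: null_neq0 np.
  apply/forall_inP => x /Uw[b ->]; apply/forall_inP => y /Uw[c ->].
  have -> : oct_mul (b *: p) (c *: p) = (b *: p : octonions F) ** (c *: p) by [].
  by rewrite omulZl omulZr (null_sqr np) !scaler0.
rewrite /= in_set; split=> [/andP[/subspaces2P[p [q [free Uw]]] /forall_inP nU] | [p [q [np nq pq ne Uw]]]].
  have pU : p \in U by apply/Uw; exists 1, 0; rewrite scale1r scale0r addr0.
  have qU : q \in U by apply/Uw; exists 0, 1; rewrite scale1r scale0r add0r.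
  have mU x y : x \in U -> y \in U -> oct_mul x y = 0.
    by move=> xU yU; apply/eqP/(forall_inP (nU x xU)).
  exists p, q; split=> //; rewrite ?/null.
  - apply/andP; split; last by apply/eqP/mU.
    apply/eqP => E; have [] := free 1 0; first by rewrite E scaler0 scale0r addr0.
    by move/eqP; rewrite oner_eq0.
  - apply/andP; split; last by apply/eqP/mU.
    apply/eqP => E; have [] := free 0 1; first by rewrite E scaler0 scale0r addr0.
    by move=> _ /eqP; rewrite oner_eq0.
  - exact: mU.
  move=> c E; have [] := free c (- 1); first by rewrite E scaleN1r subrr.
  by move=> _ /eqP; rewrite oppr_eq0 oner_eq0.
apply/andP; split.
  apply/subspaces2P; exists p, q; split=> // b c E.
  have c0 : c = 0.
    apply/eqP; apply: contraT => c0; case: (ne (- (c^-1 * b))).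
    apply: (scalerI c0); rewrite scalerA mulrN mulVKf // scaleNr.
    by apply/eqP; rewrite -addr_eq0 addrC E.
  split=> //; apply/eqP; move/eqP: E; rewrite c0 scale0r addr0 scaler_eq0.
  by rewrite (negPf (null_neq0 np)) orbF.
have qp : (q : octonions F) ** p = 0 := null_mulC np nq pq.
have {}pq : (p : octonions F) ** q = 0 := pq.
apply/forall_inP => x /Uw[b [c ->]]; apply/forall_inP => y /Uw[b' [c' ->]].
have -> : oct_mul (b *: p + c *: q) (b' *: p + c' *: q) =
  (b *: p + c *: q : octonions F) ** (b' *: p + c' *: q) by [].
by rewrite omulDl !omulDr !omulZl !omulZr pq qp (null_sqr np) (null_sqr nq) !scaler0 !addr0.
Qed.

Local Close Scope ring_scope.

(** * From a subhexagon of order (4, 1) to its stars *)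

Section Subhexagon.
Variables (gT : finGroupType) (G : {group gT}).
Variables (Pts : {set {set gT}}) (perp : rel gT).
Hypothesis sys : star_system Pts perp.
Hypothesis Gpoints : central_involutions G = cover Pts.
Hypothesis Glines : forall l, l \in octagon_lines G <-> exists P x y,
  [/\ P \in Pts, x \in P, y \in P, x != y & perp x y /\ l = [set x; y; (x * y)%g]].
Hypothesis Gspans : forall l, l \in Sstar G <-> exists P Q,
  [/\ P \in Pts, Q \in Pts, P != Q, meets P Q & l = P :&: Q].
Variables S Q : {set {set gT}}.
Local Notation H := (containment S Q).
Hypothesis subH : full_subgeometry H (containment (Sstar G) Pts).
Hypothesis hexH : generalized_polygon 6 H.
Hypothesis ordH : has_order 4 1 H.
Implicit Types (x : gT) (p q l : {set gT}).

Lemma span_uniq l l' x : l \in Sstar G -> l' \in Sstar G -> x \in l -> x \in l' -> l = l'.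
Proof.
case/Gspans=> P [P' [PP P'P ne _ ->]] /Gspans[R [R' [RP R'P ne' _ ->]]].
move=> /setIP[xP xP'] /setIP[xR xR'].
have [E|nPR] := eqVneq P R; first by rewrite -E in ne' *; apply: (meet_eq sys PP _ _ _ _ xP).
rewrite (meet_eq sys PP P'P RP ne nPR xP xP' xR) setIC.
by apply: (meet_eq sys RP _ _ _ _ xR) => //; rewrite eq_sym.
Qed.

Lemma span_card l : l \in Sstar G -> #|l| = 3.
Proof. by case/Gspans=> P [P' [PP P'P ne m ->]]; apply: (card_meet sys). Qed.

Let SS l : l \in S -> l \in Sstar G. Proof. by case: subH => /subsetP sub _ _ _ /sub. Qed.
Let QP : Q \subset Pts. Proof. by case: subH. Qed.

(** The five lines of S in q are pairwise disjoint and have three points each, so they fill the 15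
    points of the star. *)
Lemma subhexagon_cover q x : q \in Q -> x \in q -> exists l, [/\ l \in S, x \in l & l \subset q].
Proof.
move=> qQ; have c5 : #|line_points H q| = 5 by case: ordH => c5 _; apply: c5.
have tr : trivIset (line_points H q).
  apply/trivIsetP => l n /setIdP[lS _] /setIdP[nS _]; apply: contraR.
  by case/pred0Pn=> z /andP[zl zn]; apply/eqP/(span_uniq (SS lS) (SS nS) zl zn).
have sub : cover (line_points H q) \subset q by apply/bigcupsP => l /setIdP[].
have -> : q = cover (line_points H q).
  apply/eqP; rewrite eq_sym eqEcard sub -(eqP tr).
  rewrite (eq_bigr (fun=> 3)) => [|l /setIdP[lS _]]; last exact: span_card (SS lS).
  by rewrite sum_nat_const c5 (card_star15 sys (subsetP QP q qQ)).
by case/bigcupP=> l lH xl; have /setIdP[lS _] := lH; exists l; rewrite (bigcup_sup l).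
Qed.

Let two l : l \in S -> #|point_lines H l| = 2.
Proof. by move=> lS; case: ordH => _; apply. Qed.

Lemma subhexagon_two_stars q x : q \in Q -> x \in q -> exists q',
  [/\ q' \in Q, q' != q, x \in q' & forall p, p \in Q -> x \in p -> p = q \/ p = q'].
Proof.
move=> qQ xq; have [l [lS xl lq]] := subhexagon_cover qQ xq.
have qH : q \in point_lines H l by apply/setIdP.
have := two lS; rewrite (cardsD1 q) qH => -[/eqP/cards1P[q' Eq']].
have /setD1P[nq /setIdP[q'Q lq']] : q' \in point_lines H l :\ q by rewrite Eq' set11.
exists q'; split=> //; first exact: (subsetP lq').
move=> p pQ xp; have [n [nS xn np]] := subhexagon_cover pQ xp.
have [->|npq] := eqVneq p q; [by left | right].
apply/set1P; rewrite -Eq'; apply/setD1P; split=> //; apply/setIdP; split=> //.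
by rewrite (span_uniq (SS lS) (SS nS) xl xn).
Qed.

(** The points of the hexagon are octagon lines and its lines are stars, so l and q are vertices of
    opposite kinds. Their distance is odd and at most 6, hence at most 5, and a path of that length
    passes through at most three stars, q included. *)
Lemma subhexagon_near_stars q0 x q : q0 \in Q -> x \in q0 -> q \in Q ->
  [\/ x \in q, exists q1, [/\ q1 \in Q, x \in q1 & meets q1 q] |
      exists q1 q2, [/\ q1 \in Q, q2 \in Q, x \in q1, meets q1 q2 & meets q2 q]].
Proof.
move=> q0Q xq0 qQ; have [l [lS xl _]] := subhexagon_cover q0Q xq0.
have mt n p p' : n \in S -> n \subset p -> n \subset p' -> meets p p'.
  move=> nS np np'; have /card_gt0P[z zn] : 0 < #|n| by rewrite (span_card (SS nS)).
  exact: meetsI (subsetP np z zn) (subsetP np' z zn).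
have lV : inl l \in incidence_vertices H by rewrite inE.
have qV : inr q \in incidence_vertices H by rewrite inE.
case: hexH => conn diam _; have [p [lp Eq sz]] := dist_path (conn _ _ lV qV).
have sz6 : size p <= 6.
  rewrite sz -[X in _ <= X]diam; apply: leq_trans (leq_bigmax_cond _ lV).
  exact: (leq_bigmax_cond (F := fun y => dist (incidence H) (inl l) y) _ qV).
case: p lp Eq sz6 {sz} => [|[?|q1] p] //= /andP[/and3P[_ q1Q lq1] lp] Eq sz.
have xq1 := subsetP lq1 x xl.
case: p lp Eq sz => [_ [<-] _|[l1|?] p] //=; first by apply: Or31.
case/andP=> /and3P[l1S _ l11]; case: p => [|[?|q2] p] //= /andP[/and3P[_ q2Q l12] lp] Eq sz.
case: p lp Eq sz => [_ [<-] _|[l2|?] p] //=.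
  by apply: Or32; exists q1; split=> //; apply: (mt l1).
case/andP=> /and3P[l2S _ l22]; case: p => [|[?|q3] p] //= /andP[/and3P[_ q3Q l23] lp] Eq sz.
case: p lp Eq sz => [_ [<-] _|[l3|?] [|? p]] //=.
by apply: Or33; exists q1, q2; split=> //; [apply: (mt l1) | apply: (mt l2)].
Qed.

Lemma subhexagon_neq0 : Q != set0.
Proof.
case: hexH => _ diam _; have [v vV] : exists v, v \in incidence_vertices H.
  apply/set0Pn; apply: contra_eq_neq diam => ->.
  by rewrite /diameter big_set0.
case: v vV => [l|q]; rewrite inE => vH; last by apply/set0Pn; exists q.
have /card_gt0P[q /setIdP[qQ _]] : 0 < #|point_lines H l| by rewrite (two vH).
by apply/set0Pn; exists q.
Qed.

Lemma subhexagon_points :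
  [set x in points (octagon G) | [exists l in S, x \in l]] = cover Q.
Proof.
apply/setP => x; apply/setIdP/bigcupP => [[_ /exists_inP[l lS xl]] | [q qQ xq]].
  have /card_gt0P[q /setIdP[qQ lq]] : 0 < #|point_lines H l| by rewrite two.
  by exists q => //; apply: (subsetP lq).
split; first exact: subsetP (star_points Gpoints (subsetP QP q qQ)) x xq.
by have [l [lS xl _]] := subhexagon_cover qQ xq; apply/exists_inP; exists l.
Qed.

Lemma subhexagon_octagon :
  let G' : geometry gT {set gT} :=
    Geometry
      [set x in points (octagon G) | [exists l in S, x \in l]]
      [set l in lines (octagon G) | [exists q in Q, l \subset q]]
      (fun x l => x \in l) in
  [/\ full_subgeometry G' (octagon G), near_2d_gon 4 G' & has_order 2 4 G'].
Proof.
rewrite /= subhexagon_points; split.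
- exact: (suboctagon_full sys Gpoints Glines QP).
- exact: (suboctagon_near sys Gpoints Glines QP subhexagon_two_stars subhexagon_near_stars subhexagon_neq0).
exact: (suboctagon_order sys Glines QP subhexagon_two_stars).
Qed.

End Subhexagon.

Theorem theorem1p2 (F : finFieldType) (gT : finGroupType) (G : {group gT}) :
  #|F| = 4 -> G \isog oct_ring_aut F ->
  {in Qstar G, forall Q : {set gT},
     isomorphic (induced (octagon G) Q) (symplectic_gq 'F_2)} /\
  isomorphic (containment (Sstar G) (Qstar G))
             (dual (split_cayley_hexagon F)) /\
  (forall S Q : {set {set gT}},
     full_subgeometry (containment S Q) (containment (Sstar G) (Qstar G)) ->
     generalized_polygon 6 (containment S Q) ->
     has_order 4 1 (containment S Q) ->
     let G' : geometry gT {set gT} :=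
       Geometry
         [set x in points (octagon G) | [exists l in S, x \in l]]
         [set l in lines (octagon G) | [exists q in Q, l \subset q]]
         (fun x l => x \in l) in
     [/\ full_subgeometry G' (octagon G), near_2d_gon 4 G' & has_order 2 4 G']).
Proof.
move=> F4 isoG; have : zorn_aut_group (octonions F) \isog G by rewrite isog_sym.
case/isogP=> f injf fG.
have sys := octagon_star_system F4 injf.
have Gpoints : central_involutions G = cover (image_stars f (star_set (octonions F))).
  by rewrite (central_involutions_image F4 injf fG) cover_stars.
have Glines := octagon_linesP F4 injf fG.
have Gspans := SstarP F4 injf fG.
rewrite (quads_stars sys Gpoints Glines); split; first exact: (star_gq sys Gpoints Glines).
split; first exact: dual_split_cayley.
by move=> S Q subH hexH ordH; apply: (subhexagon_octagon sys Gpoints Glines Gspans subH hexH ordH).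
Qed.
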